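(* Let $\alpha\in(\frac12,1)$, let $b,\sigma:[0,\infty)\times\mathbb{R}^d\to\mathbb{R}^d$ be measurable, and suppose that: (H1) there exists $L>0$ such that for all $x,y\in\mathbb{R}^d$ and $t\in[0,\infty)$, $\|b(t,x)-b(t,y)\|+\|\sigma(t,x)-\sigma(t,y)\|\le L\|x-y\|$; (H2) $\operatorname{ess\,sup}_{\tau\in[0,\infty)}\|\sigma(\tau,0)\|<\infty$ and $\int_0^\infty\|b(\tau,0)\|^2\,d\tau<\infty$. Consider the Caputo fractional stochastic differential equation $$ {}^{C}D^{\alpha}_{0+}X(t)=b(t,X(t))+\sigma(t,X(t))\frac{dW_t}{dt}. $$ Then: (i) for any $\eta\in\mathfrak{X}_0$, the equation with the initial condition $X(0)=\eta$ has a unique global solution on the whole interval $[0,\infty)$, denoted by $\varphi(\cdot,\eta)$; (ii) on any bounded time interval $[0,T]$, where $T>0$, the solution $\varphi(\cdot,\eta)$ depends continuously on $\eta$, i.e. for every $\eta\in\mathfrak{X}_0$, $$\lim_{\zeta\to\eta}\ \sup_{t\in[0,T]}\|\varphi(t,\zeta)-\varphi(t,\eta)\|_{\rm ms}=0,$$ where $\zeta\to\eta$ in $\mathfrak{X}_0$ with respect to $\|\cdot\|_{\rm ms}$.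
   Context: $(W_t)_{t\in[0,\infty)}$ is a standard scalar Brownian motion on a complete filtered probability space $(\Omega,\mathcal{F},\mathbb{F}:=\{\mathcal{F}_t\}_{t\in[0,\infty)},\mathbb{P})$. $\mathbb{R}^d$ carries the standard Euclidean norm $\|\cdot\|$. For $t\ge 0$, $\mathfrak{X}_t:=\mathbb{L}^2(\Omega,\mathcal{F}_t,\mathbb{P})$ is the space of all $\mathcal{F}_t$-measurable mean square integrable functions $f:\Omega\to\mathbb{R}^d$, with $\|f\|_{\rm ms}:=\sqrt{\mathbb{E}\|f\|^2}$. A process $X$ on $[0,\infty)$ is $\mathbb{F}$-adapted if $X(t)\in\mathfrak{X}_t$ for all $t\ge 0$. For $\eta\in\mathfrak{X}_0$, an $\mathbb{F}$-adapted process $X$ is called a solution of the equation ${}^{C}D^{\alpha}_{0+}X(t)=b(t,X(t))+\sigma(t,X(t))\frac{dW_t}{dt}$ with initial condition $X(0)=\eta$ if for all $t\in[0,\infty)$ $$X(t)=\eta+\frac{1}{\Gamma(\alpha)}\left(\int_0^t(t-\tau)^{\alpha-1}b(\tau,X(\tau))\,d\tau+\int_0^t(t-\tau)^{\alpha-1}\sigma(\tau,X(\tau))\,dW_\tau\right),$$ where $\Gamma$ is the Gamma function and the second integral is an Itô integral. *)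

(* Defs.v *)
From HB Require Import structures.
From mathcomp Require Import all_boot all_order all_algebra.
From mathcomp Require Import all_classical all_reals all_analysis.

Set Implicit Arguments.
Unset Strict Implicit.
Unset Printing Implicit Defensive.

Import Order.TTheory GRing.Theory Num.Theory.
Import numFieldNormedType.Exports.

Local Open Scope classical_set_scope.
Local Open Scope ring_scope.

(* Time is the half-line [0, +oo[ of R: a function of time has a total type
   R -> _, but only its values at nonnegative times are ever constrained.
   A stochastic process is a function R -> Omega -> _. *)

(* R^d carries its Borel sigma-algebra, presented as the product sigma-algebra
   generated by the d coordinate maps (as the library does for tuples). *)
Definition row_coord (R : realType) (d : nat) (i : 'I_d) (x : 'rV[R]_d) : R :=
  x ord0 i.

Definition row_display : measure_display.
Proof. exact: default_measure_display. Qed.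

HB.instance Definition _ (R : realType) (d : nat) :=
  @isMeasurable.Build row_display 'rV[R]_d
    (g_sigma_preimage (@row_coord R d))
    (@sigma_algebra0 _ _ _)
    (@sigma_algebraC _ _)
    (@sigma_algebra_bigcup _ _ _).

(* The norm `|x| of the library on 'rV[R]_d is the sup norm. *)
Definition eucl_norm (R : realType) (d : nat) (x : 'rV[R]_d) : R :=
  Num.sqrt (\sum_(i < d) x ord0 i ^+ 2).

Definition Gamma (R : realType) (a : R) : R :=
  \int[lebesgue_measure]_(x in `]0, +oo[) (x `^ (a - 1) * expR (- x)).

Definition measurable_wrt (T : Type) (dd : measure_display)
    (S : measurableType dd) (G : set (set T)) (f : T -> S) : Prop :=
  forall B : set S, measurable B -> G (f @^-1` B).

Lemma measurable_nonneg_times (R : realType) :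
  measurable (`[0, +oo[%classic : set R).
Proof. exact: measurable_itv. Qed.
Arguments measurable_nonneg_times : clear implicits.

(* The last clause makes the space complete: as F t only consists of measurable
   sets, it implies measure_is_complete P. *)
Record complete_filtration (dd : measure_display) (Omega : measurableType dd)
    (R : realType) (P : probability Omega R) (F : R -> set (set Omega)) : Prop := {
  filtration_sigma_algebra : forall t : R, 0 <= t -> sigma_algebra setT (F t);
  filtration_measurable : forall t : R, 0 <= t -> F t `<=` measurable;
  filtration_nondecreasing : forall s t : R, 0 <= s -> s <= t -> F s `<=` F t;
  filtration_complete : forall t : R, 0 <= t ->
    forall N : set Omega, P.-negligible N -> F t N }.

Record brownian_motion (dd : measure_display) (Omega : measurableType dd)
    (R : realType) (P : probability Omega R) (F : R -> set (set Omega))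
    (W : R -> Omega -> R) : Prop := {
  brownian_adapted : forall t : R, 0 <= t -> measurable_wrt (F t) (W t);
  brownian_start : {ae P, forall w, W 0 w = 0};
  brownian_indep : forall s t : R, 0 <= s -> s < t ->
    forall (A : set Omega) (B : set R), F s A -> measurable B ->
      P (A `&` (fun w => W t w - W s w) @^-1` B) =
      (P A * P ((fun w => W t w - W s w)%R @^-1` B))%E;
  (* the second parameter of normal_prob is the standard deviation *)
  brownian_normal : forall s t : R, 0 <= s -> s < t ->
    forall B : set R, measurable B ->
      P ((fun w => W t w - W s w) @^-1` B) = normal_prob 0 (Num.sqrt (t - s)) B;
  brownian_continuous :
    {ae P, forall w, {within `[0, +oo[, continuous (fun t => W t w)}} }.

(* The process sum_(i < n) xi_i 1_(]t_i, t_(i+1)]). *)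
Record simple_process (R : realType) (Omega : Type) := SimpleProcess {
  sp_size : nat;
  sp_time : nat -> R;
  sp_coef : nat -> Omega -> R }.

Definition simple_process_on (R : realType) (Omega : Type)
    (F : R -> set (set Omega)) (t : R) (H : simple_process R Omega) : Prop :=
  [/\ 0 <= sp_time H 0%N /\ sp_time H (sp_size H) <= t,
      forall i, (i < sp_size H)%N -> sp_time H i <= sp_time H i.+1 &
      forall i, (i < sp_size H)%N ->
        measurable_wrt (F (sp_time H i)) (sp_coef H i) /\
        exists M : R, forall w, `|sp_coef H i w| <= M].

Definition sp_eval (R : realType) (Omega : Type) (H : simple_process R Omega)
    (s : R) (w : Omega) : R :=
  \sum_(i < sp_size H)
    sp_coef H i w * \1_(`]sp_time H i, sp_time H i.+1]%classic : set R) s.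

Definition sp_integral (R : realType) (Omega : Type) (W : R -> Omega -> R)
    (H : simple_process R Omega) (w : Omega) : R :=
  \sum_(i < sp_size H)
    sp_coef H i w * (W (sp_time H i.+1) w - W (sp_time H i) w).

(* The integrands of the L^2 theory: measurable adapted f with
   E int_0^t f(s)^2 ds < +oo. *)
Definition ito_integrable (dd : measure_display) (Omega : measurableType dd)
    (R : realType) (P : probability Omega R) (F : R -> set (set Omega))
    (t : R) (f : R -> Omega -> R) : Prop :=
  [/\ measurable_fun ((`[0, t]%classic : set R) `*` [set: Omega])
        (fun p : R * Omega => f p.1 p.2),
      forall s : R, 0 <= s -> s <= t -> measurable_wrt (F s) (f s) &
      (\int[P]_w \int[lebesgue_measure]_(s in `[0%R, t])
          ((f s w) ^+ 2)%:E < +oo)%E].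

(* I is (a version of) int_0^t f dW: the L^2(P) limit of the integrals of simple
   processes converging to f in L^2(P (x) ds). The integral being an element of
   L^2(P), it is determined up to almost sure equality only, whence a relation. *)
Definition is_ito_integral (dd : measure_display) (Omega : measurableType dd)
    (R : realType) (P : probability Omega R) (F : R -> set (set Omega))
    (W : R -> Omega -> R) (t : R) (f : R -> Omega -> R) (I : Omega -> R) : Prop :=
  [/\ ito_integrable P F t f,
      measurable_wrt (F t) I &
      exists H : nat -> simple_process R Omega,
        [/\ forall n, simple_process_on F t (H n),
            (\int[P]_w \int[lebesgue_measure]_(s in `[0%R, t])
                ((f s w - sp_eval (H n) s w) ^+ 2)%:E)%E @[n --> \oo] --> 0%E &
            (\int[P]_w ((I w - sp_integral W (H n) w) ^+ 2)%:E)%E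
                @[n --> \oo] --> 0%E]].

Definition ms_space (dd : measure_display) (Omega : measurableType dd)
    (R : realType) (d : nat) (P : probability Omega R) (G : set (set Omega)) :
    set (Omega -> 'rV[R]_d) :=
  [set f | measurable_wrt G f /\
           ('E_P[fun w => (eucl_norm (f w) ^+ 2)%R] < +oo)%E].

(* Only meaningful (and only used) for square integrable f: fine sends +oo
   to 0. *)
Definition ms_norm (dd : measure_display) (Omega : measurableType dd)
    (R : realType) (d : nat) (P : probability Omega R)
    (f : Omega -> 'rV[R]_d) : R :=
  Num.sqrt (fine 'E_P[fun w => (eucl_norm (f w) ^+ 2)%R]).

Definition adapted (dd : measure_display) (Omega : measurableType dd)
    (R : realType) (d : nat) (P : probability Omega R)
    (F : R -> set (set Omega)) (X : R -> Omega -> 'rV[R]_d) : Prop :=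
  forall t : R, 0 <= t -> ms_space P (F t) (X t).

(* Solutions are jointly measurable in (t, w), as the time integrals require, and
   both integrals in the equation are required to exist: the first one as a
   Lebesgue integral along almost every path, the second one as an Ito integral.
   The value of the kernel (t - s)^(alpha - 1) at s = t is irrelevant. *)
Definition is_solution (dd : measure_display) (Omega : measurableType dd)
    (R : realType) (d : nat) (P : probability Omega R)
    (F : R -> set (set Omega)) (W : R -> Omega -> R) (alpha : R)
    (b sigma : R -> 'rV[R]_d -> 'rV[R]_d)
    (eta : Omega -> 'rV[R]_d) (X : R -> Omega -> 'rV[R]_d) : Prop :=
  [/\ measurable_fun ((`[0, +oo[%classic : set R) `*` [set: Omega])
        (fun p : R * Omega => X p.1 p.2),
      adapted P F X &
      forall t : R, 0 <= t ->
        (forall i : 'I_d, {ae P, forall w,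
          lebesgue_measure.-integrable `[0, t]
            (fun s => ((t - s) `^ (alpha - 1) * b s (X s w) ord0 i)%:E)}) /\
        exists J : 'I_d -> Omega -> R,
          (forall i, is_ito_integral P F W t
            (fun s w => (t - s) `^ (alpha - 1) * sigma s (X s w) ord0 i) (J i)) /\
          {ae P, forall w, X t w = eta w + (Gamma alpha)^-1 *:
            (\row_i (\int[lebesgue_measure]_(s in `[0, t])
                       ((t - s) `^ (alpha - 1) * b s (X s w) ord0 i))
             + \row_i J i w)}].

(* Main.v *)
(* All estimates rest on k(r) = r^(alpha - 1) being square integrable near 0,
   which is where alpha > 1/2 enters. By Cauchy-Schwarz for the drift and the Ito
   isometry for the noise, the right-hand sides Z, Z' of the equation for X, Y
   with initial values eta, zeta satisfy
     E |Z_t - Z'_t|^2 <= 3 E |eta - zeta|^2 + K int_0^t k(t - s)^2 E |X_s - Y_s|^2 ds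
   on [0, T]. After weighting by exp(- l t) with l large, convolution with k^2 is
   a contraction; this gives a Gronwall inequality, hence uniqueness and Lipschitz
   dependence on the initial value, and the convergence of the Picard iterates.
   Two points need care. Solutions are only required to have finite second moments
   at each time, so before applying Gronwall one shows int_0^T E |X_s - Y_s|^2 ds
   to be finite: along almost every path the drift difference is integrable, hence
   X - Y is square integrable in time, and a pathwise Gronwall inequality bounds
   its norm by that of the noise part, whose expectation is finite. And a Picard
   step is defined at each time only up to a null set; as it is Hoelder continuous
   in mean square, sampling it along finer and finer grids produces a jointly
   measurable adapted version. *)

(* The existence of Ito integrals has to be established for integrands that are merely jointly
   measurable and adapted. The values of such a process on a fixed grid need not represent it, so
   the grid is shifted by an offset, and the mean error over all offsets is controlled by Lebesgue
   differentiation of the paths. The resulting density of simple processes also shows that time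
   integrals of adapted processes are [F t]-measurable, completeness of [F t] absorbing the null
   sets.

   All approximations run at the rate 4^-k in mean square: it is the rate of the Picard iterates
   once the weight makes the convolution contract by the factor 1/4, and it is fast enough for
   almost sure convergence. A limit can then be realised by one explicit formula, the pointwise
   upper limit, which inherits every measurability of the sequence at once: joint measurability in
   time and outcome and, at each time t, measurability with respect to [F t]. *)
Require Import Defs.
From HB Require Import structures.
From mathcomp Require Import all_boot all_order all_algebra.
From mathcomp Require Import all_classical all_reals all_analysis.
From mathcomp Require Import ess_sup_inf measurable_realfun ring lra.

Set Implicit Arguments.
Unset Strict Implicit.
Unset Printing Implicit Defensive.

Import Order.TTheory GRing.Theory Num.Theory.
Import numFieldNormedType.Exports.

Local Open Scope classical_set_scope.
Local Open Scope ring_scope.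

(** * Integration and L2 limits *)

Section domain_tonelli.
Local Open Scope ereal_scope.
Context {d1 d2 : measure_display} {T1 : measurableType d1} {T2 : measurableType d2}
  {R : realType} (m1 : {sigma_finite_measure set T1 -> \bar R})
  (m2 : {sigma_finite_measure set T2 -> \bar R}).
Variables (D1 : set T1) (D2 : set T2) (mD1 : measurable D1) (mD2 : measurable D2).
Variable f : T1 * T2 -> \bar R.
Hypotheses (mf : measurable_fun setT f) (f0 : forall x, 0 <= f x).

Let mfD2 : measurable_fun setT (f \_ (setT `*` D2)).
Proof.
apply/(measurable_restrictT _ _).1; first by apply: measurableX.
exact: measurable_funTS.
Qed.

Let fD20 x : 0 <= (f \_ (setT `*` D2)) x.
Proof. by rewrite patchE; case: ifP. Qed.

Lemma measurable_fun_integral_dom :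
  measurable_fun setT (fun x => \int[m2]_(y in D2) f (x, y)).
Proof.
have := @measurable_fun_fubini_tonelli_F _ _ _ _ _ m2 _ mfD2 fD20.
apply: eq_measurable_fun => x _; rewrite [RHS]integral_mkcond /fubini_F.
by apply: eq_integral => y _; rewrite !patchE in_setX in_setT.
Qed.

(** Extending [f] by zero outside the rectangle reduces both sides to Tonelli's theorem on the whole
    product. *)
Lemma domain_tonelli :
  \int[m1]_(x in D1) \int[m2]_(y in D2) f (x, y) =
  \int[m2]_(y in D2) \int[m1]_(x in D1) f (x, y).
Proof.
have mg : measurable_fun setT (f \_ (D1 `*` D2)).
  apply/(measurable_restrictT _ _).1; first by apply: measurableX.
  exact: measurable_funTS.
have g0 x : 0 <= (f \_ (D1 `*` D2)) x by rewrite patchE; case: ifP.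
have := @fubini_tonelli _ _ _ _ _ m1 m2 _ mg g0.
rewrite [in X in _ -> X]integral_mkcond [in X in _ -> _ = X]integral_mkcond.
congr (_ = _); apply: eq_integral => x _; rewrite patchE.
  case: ifPn => xD; last first.
    rewrite integral0_eq// => y _; rewrite patchE in_setX (negbTE xD)//.
  by rewrite [RHS]integral_mkcond; apply: eq_integral => y _; rewrite !patchE in_setX xD.
case: ifPn => xD; last first.
  by rewrite integral0_eq// => y _; rewrite patchE in_setX (negbTE xD) andbF.
by rewrite [RHS]integral_mkcond; apply: eq_integral => y _; rewrite !patchE in_setX xD andbT.
Qed.

End domain_tonelli.

Section lebesgue_invariance.
Local Open Scope ereal_scope.
Context {R : realType}.
Local Notation mu := (@lebesgue_measure R).

(** The image of Lebesgue measure under the reflection gives half-open intervals their length, hence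
    is Lebesgue measure by uniqueness. *)
Lemma integral_reflect (a : R) (f : R -> \bar R) :
  measurable_fun setT f -> (forall x, 0 <= f x) ->
  \int[mu]_x f (a - x)%R = \int[mu]_x f x.
Proof.
move=> mf f0.
pose phi : measurableTypeR R -> measurableTypeR R := fun x => (a - x)%R.
have mphi : measurable_fun setT phi by exact: measurable_funB.
have mphi_mixin := isMeasurableFun.Build _ _ _ _ _ mphi.
pose phi' : {mfun _ >-> _} := HB.pack phi mphi_mixin.
rewrite -[LHS](@ge0_integral_pushforward _ _ _ _ _ phi mphi _ setT f)//.
apply: eq_measure_integral => A mA _.
apply/esym/(@lebesgue_measure_unique _ (pushforward mu phi')) => //= _ [[x y]] _ <-.
rewrite /pushforward /= (_ : phi @^-1` _ = `[(a - y), (a - x)[%classic)%R; last first.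
  by apply/seteqP; split => z; rewrite /= !in_itv/= /phi => /andP[? ?]; apply/andP; split; lra.
rewrite !lebesgue_measure_itv/= !lte_fin ltrD2l ltrN2; case: ifP => // _.
by rewrite -!EFinB; congr EFin; lra.
Qed.

(** A translation is the composition of two reflections. *)
Lemma integral_shift (a : R) (f : R -> \bar R) :
  measurable_fun setT f -> (forall x, 0 <= f x) ->
  \int[mu]_x f (x + a)%R = \int[mu]_x f x.
Proof.
move=> mf f0; rewrite -[RHS](integral_reflect a mf f0).
rewrite -[RHS](@integral_reflect 0%R (fun x => f (a - x)%R)) => [|//|//].
  by apply: eq_integral => x _; congr f; lra.
by apply: measurableT_comp => //; exact: measurable_funB.
Qed.

End lebesgue_invariance.

Section cauchy_schwarz.
Local Open Scope ereal_scope.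
Context d (T : measurableType d) (R : realType) (mu : {measure set T -> \bar R}).
Variables (D : set T) (mD : measurable D).

(** Hölder's inequality with both exponents equal to 2, squared so that no roots of extended reals
    remain. *)
Lemma sqr_integral_le (f g : T -> R) : measurable_fun D f -> measurable_fun D g ->
  (\int[mu]_(x in D) `|f x * g x|%:E) * (\int[mu]_(x in D) `|f x * g x|%:E) <=
  (\int[mu]_(x in D) (f x ^+ 2)%:E) * (\int[mu]_(x in D) (g x ^+ 2)%:E).
Proof.
move=> mf mg.
pose f' := (f \_ D)%R; pose g' := (g \_ D)%R.
have mf' : measurable_fun setT f' by exact/(measurable_restrictT f mD).1.
have mg' : measurable_fun setT g' by exact/(measurable_restrictT g mD).1.
have h2 : (0 < 2 :> R)%R by [].
have h22 : (2^-1 + 2^-1 = 1 :> R)%R by lra.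
have := @hoelder _ _ _ mu f' g' _ _ mf' mg' h2 h2 h22.
have EN (h : T -> R) : 'N[mu]_2%:E[EFin \o (h \_ D)%R] = (\int[mu]_(x in D) (h x ^+ 2)%:E) `^ (2^-1).
  rewrite unlock /Lnorm; congr (_ `^ _).
  rewrite [RHS]integral_mkcond; apply: eq_integral => x _.
  rewrite /= !patchE; case: ifP => _.
    by rewrite powR_mulrn// real_normK// num_real.
  by rewrite normr0 powR0// pnatr_eq0.
rewrite !EN.
have -> : 'N[mu]_1[EFin \o (f' \* g')%R] = \int[mu]_(x in D) `|f x * g x|%:E.
  rewrite Lnorm1 [RHS]integral_mkcond; apply: eq_integral => x _.
  by rewrite /= /f' /g' !patchE; case: ifP => _ //; rewrite mulr0 normr0.
set A := \int[mu]_(x in D) (f x ^+ 2)%:E; set B := \int[mu]_(x in D) (g x ^+ 2)%:E.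
have A0 : 0 <= A by apply: integral_ge0 => x _; rewrite lee_fin sqr_ge0.
have B0 : 0 <= B by apply: integral_ge0 => x _; rewrite lee_fin sqr_ge0.
have S (C : \bar R) : 0 <= C -> C `^ (2^-1) * C `^ (2^-1) = C.
  by move=> C0; rewrite -poweRD ?h22 ?poweRe1// /poweRD_def h22 oner_eq0.
move=> H; apply: (le_trans (lee_pmul _ _ H H)).
- by apply: integral_ge0 => x _; rewrite lee_fin.
- by apply: integral_ge0 => x _; rewrite lee_fin.
by rewrite muleACA !S.
Qed.

(** An infinite integral on the left is covered too, since [Rintegral] then returns 0. *)
Lemma sqr_Rintegral_le (f g : T -> R) : measurable_fun D f -> measurable_fun D g ->
  ((\int[mu]_(x in D) (f x * g x))%R ^+ 2)%:E <=
  (\int[mu]_(x in D) (f x ^+ 2)%:E) * (\int[mu]_(x in D) (g x ^+ 2)%:E).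
Proof.
move=> mf mg; apply: le_trans (sqr_integral_le mf mg).
have H : `|(\int[mu]_(x in D) (f x * g x))%R|%:E <= \int[mu]_(x in D) `|f x * g x|%:E.
  rewrite /Rintegral; set z := \int[mu]_(x in D) _.
  have : `|z| <= \int[mu]_(x in D) `|f x * g x|%:E.
    rewrite /z; apply: (le_trans (le_abse_integral _ _ _)) => //.
    by apply/measurable_EFinP; exact: measurable_funM.
  apply: le_trans; case: z => [r| |]//=; by rewrite ?normr0 ?leey.
set I := (\int[mu]_(x in D) (f x * g x))%R in H *.
have -> : (I ^+ 2)%:E = `|I|%:E * `|I|%:E.
  by rewrite -EFinM -normrM -expr2 ger0_norm// sqr_ge0.
by apply: lee_pmul.
Qed.

End cauchy_schwarz.

Lemma cvgn_EFin (R : realType) (u : nat -> R) (l : R) :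
  u @ \oo --> l -> (u n)%:E @[n --> \oo] --> l%:E.
Proof. by move=> ul; apply: cvg_EFin; [exact: nearW|exact: ul]. Qed.

Section sqr_integral.
Local Open Scope ereal_scope.
Context d (T : measurableType d) (R : realType) (m : {measure set T -> \bar R}).
Variables (D : set T) (mD : measurable D).

Lemma measurable_sqr_EFin (f : T -> R) : measurable_fun D f ->
  measurable_fun D (fun x => (f x ^+ 2)%:E).
Proof. by move=> mf; apply/measurable_EFinP; exact: measurable_funX. Qed.

Lemma integral_sqr_ge0 (f : T -> R) : 0 <= \int[m]_(x in D) (f x ^+ 2)%:E.
Proof. by apply: integral_ge0 => x _; rewrite lee_fin sqr_ge0. Qed.

Lemma integral_sqrD_le (f g : T -> R) : measurable_fun D f -> measurable_fun D g ->
  \int[m]_(x in D) ((f x + g x) ^+ 2)%:E <=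
  2%:E * \int[m]_(x in D) (f x ^+ 2)%:E + 2%:E * \int[m]_(x in D) (g x ^+ 2)%:E.
Proof.
move=> mf mg.
have mf2 := measurable_sqr_EFin mf; have mg2 := measurable_sqr_EFin mg.
rewrite -!ge0_integralZl//; [|by move=> x _; rewrite lee_fin sqr_ge0..].
rewrite -ge0_integralD//.
- apply: ge0_le_integral => //.
  + by move=> x _; rewrite lee_fin sqr_ge0.
  + by apply: measurable_sqr_EFin; exact: measurable_funD.
  + by apply: emeasurable_funD; apply: measurable_funeM.
  + move=> x _; rewrite -!EFinM -EFinD lee_fin.
    by have := sqr_ge0 (f x - g x)%R; rewrite !expr2; nra.
- by move=> x _; rewrite -EFinM lee_fin mulr_ge0// sqr_ge0.
- exact: measurable_funeM.
- by move=> x _; rewrite -EFinM lee_fin mulr_ge0// sqr_ge0.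
- exact: measurable_funeM.
Qed.

Lemma integral_sqrB_le (f g h : T -> R) :
  measurable_fun D f -> measurable_fun D g -> measurable_fun D h ->
  \int[m]_(x in D) ((f x - g x) ^+ 2)%:E <=
  2%:E * \int[m]_(x in D) ((f x - h x) ^+ 2)%:E +
  2%:E * \int[m]_(x in D) ((h x - g x) ^+ 2)%:E.
Proof.
move=> mf mg mh; rewrite (eq_integral (fun x => (((f x - h x) + (h x - g x)) ^+ 2)%:E)).
  by apply: integral_sqrD_le; exact: measurable_funB.
by move=> x _; congr (_ ^+ 2)%:E; lra.
Qed.

Lemma integral_sqrN (f g : T -> R) :
  \int[m]_(x in D) ((f x - g x) ^+ 2)%:E = \int[m]_(x in D) ((g x - f x) ^+ 2)%:E.
Proof. by apply: eq_integral => x _; rewrite -sqrrN opprB. Qed.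

End sqr_integral.

(* The upper limit is measurable unconditionally; where it is infinite, fine
   returns the junk value 0. *)
Definition pointwise_lim (T : Type) (R : realType) (X : nat -> T -> R) (w : T) : R :=
  fine (limn_esup (fun k => (X k w)%:E)).

Section L2_limit.
Local Open Scope ereal_scope.
Context d (T : measurableType d) (R : realType).

Lemma measurable_pointwise_lim (X : nat -> T -> R) :
  (forall k, measurable_fun setT (X k)) -> measurable_fun setT (pointwise_lim X).
Proof.
move=> mX; apply: measurableT_comp; first exact: fine_measurable.
by apply: measurable_fun_limn_esup => // k; exact/measurable_EFinP.
Qed.

Lemma pointwise_limE (X : nat -> T -> R) w l :
  (X ^~ w @ \oo --> l)%R -> pointwise_lim X w = l.
Proof.
move=> Xl; rewrite /pointwise_lim.
have Xl' : (fun k => (X k w)%:E) @ \oo --> l%:E by exact: cvgn_EFin.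
by rewrite is_cvg_limn_esupE ?(cvg_lim _ Xl')//; apply/cvg_ex; exists l%:E.
Qed.

Variable m : {measure set T -> \bar R}.
Variables (X : nat -> T -> R) (C : R).
Hypotheses (mX : forall k, measurable_fun setT (X k)) (C0 : (0 <= C)%R).
Hypothesis XC : forall k,
  \int[m]_x ((X k.+1 x - X k x) ^+ 2)%:E <= (C * 4^-1 ^+ k)%:E.

Let mD k : measurable_fun setT (fun x => X k.+1 x - X k x)%R.
Proof. exact: measurable_funB. Qed.

(** The constant 4 reproduces itself: inserting [X k.+1] costs twice 4 C 4^-(k+1), which is 2 C
    4^-k, plus twice C 4^-k. *)
Lemma L2_increment_le k n :
  \int[m]_x ((X (k + n)%N x - X k x) ^+ 2)%:E <= (4 * C * 4^-1 ^+ k)%:E.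
Proof.
elim: n k => [|n IH] k.
  rewrite addn0 integral0_eq; last by move=> x _; rewrite subrr expr0n.
  by rewrite lee_fin !mulr_ge0// exprn_ge0// invr_ge0.
apply: (le_trans (@integral_sqrB_le _ _ _ m setT _ _ _ (X k.+1) _ _ _)) => //.
have h2 : 0 <= (2 : R)%:E by rewrite lee_fin.
rewrite addnS -addSn; apply: (le_trans (leeD (lee_wpmul2l h2 (IH k.+1)) (lee_wpmul2l h2 (XC k)))).
by rewrite -!EFinM -EFinD lee_fin exprS; set z := (_ ^+ k)%R; lra.
Qed.

(** Weighted by 2^j, the squared increments still have integrals at most C 2^-j, so their weighted
    sum s is finite almost everywhere. There the j-th increment is at most sqrt(s) times
    sqrt(1/2)^j, and the telescoping series converges absolutely. *)
Lemma ae_cvg_pointwise_lim :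
  {ae m, forall w, X ^~ w @ \oo --> pointwise_lim X w}.
Proof.
pose f j w := (2 ^+ j * (X j.+1 w - X j w) ^+ 2)%:E : \bar R.
have f0 j w : 0 <= f j w by rewrite lee_fin mulr_ge0 ?sqr_ge0// exprn_ge0.
have mf j : measurable_fun setT (f j).
  by apply/measurable_EFinP; apply: measurable_funM => //; exact: measurable_funX.
have SI : m.-integrable setT (fun w => \sum_(j <oo) f j w).
  apply/integrableP; split; first by apply: ge0_emeasurable_sum.
  rewrite (eq_integral (fun w => \sum_(j <oo) f j w)); last first.
    by move=> w _; rewrite gee0_abs//; apply: nneseries_ge0 => j _ _.
  rewrite integral_nneseries//.
  apply: (@le_lt_trans _ _ (\sum_(j <oo) (C * 2^-1 ^+ j)%:E)).
    apply: lee_nneseries => [j _ _|j _]; first exact: integral_ge0.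
    rewrite [leLHS](_ : _ = (2 ^+ j)%:E * \int[m]_x ((X j.+1 x - X j x) ^+ 2)%:E); last first.
      rewrite -ge0_integralZl//.
      - by apply: measurable_sqr_EFin.
      - by move=> x _; rewrite lee_fin sqr_ge0.
    have h2j : 0 <= ((2 : R) ^+ j)%R%:E by rewrite lee_fin exprn_ge0.
    apply: (le_trans (lee_wpmul2l h2j (XC j))).
    rewrite -EFinM lee_fin mulrCA ler_wpM2l// -exprMn.
    by rewrite (_ : 2 * 4^-1 = 2^-1 :> R)%R//; lra.
  have /cvg_lim -> : \sum_(0 <= j < n) (C * 2^-1 ^+ j)%:E @[n --> \oo] --> (C * (1 - 2^-1)^-1)%:E.
    under eq_fun do rewrite sumEFin.
    apply: cvgn_EFin.
    by apply: (@cvg_geometric_series R C 2^-1); rewrite ger0_norm; lra.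
  - exact: ltry.
  - exact: ereal_hausdorff.
have := integrable_ae measurableT SI.
apply: filterS => w /(_ I) Sfin.
set s := fine (\sum_(j <oo) f j w).
have Ds j : ((X j.+1 w - X j w) ^+ 2 <= s * 2^-1 ^+ j)%R.
  have : f j w <= s%:E.
    rewrite fineK//.
    apply: (@le_trans _ _ (\sum_(0 <= i < j.+1) f i w)); last exact: nneseries_lim_ge.
    by rewrite big_nat_recr//= leeDr//; apply: sume_ge0.
  rewrite lee_fin => H.
  have -> : ((X j.+1 w - X j w) ^+ 2 = 2 ^+ j * (X j.+1 w - X j w) ^+ 2 * 2^-1 ^+ j)%R.
    by rewrite mulrAC -exprMn divff// expr1n mul1r.
  by rewrite ler_wpM2r// exprn_ge0.
have s0 : (0 <= s)%R by apply: fine_ge0; apply: nneseries_ge0 => j _ _.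
pose z : R := Num.sqrt 2^-1.
have z1 : (`|z| < 1)%R.
  by rewrite ger0_norm ?sqrtr_ge0// -[ltRHS]sqrtr1 ltr_sqrt//; lra.
have Dz j : (`|X j.+1 w - X j w| <= Num.sqrt s * z ^+ j)%R.
  rewrite -sqrtr_sqr (le_trans (ler_wsqrtr (Ds j)))//.
  rewrite sqrtrM// ler_wpM2l ?sqrtr_ge0//.
  have zj0 : (0 <= z ^+ j)%R by rewrite exprn_ge0// sqrtr_ge0.
  by rewrite -[leRHS]ger0_norm// -sqrtr_sqr -exprM mulnC exprM sqr_sqrtr// invr_ge0.
suff [l Xl] : exists l : R, (X ^~ w @ \oo --> l)%R by rewrite (pointwise_limE Xl).
have : cvgn (series (telescope (X ^~ w))).
  apply: normed_cvg; apply: (@series_le_cvg _ _ (fun j => Num.sqrt s * z ^+ j)%R) => //.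
  - by move=> j; exact: normr_ge0.
  - by move=> j /=; rewrite mulr_ge0 ?sqrtr_ge0// exprn_ge0// sqrtr_ge0.
  - exact: is_cvg_geometric_series.
rewrite /= seriesEnat /=.
move=> /cvg_ex [l Hl]; exists (l + X 0%N w)%R.
rewrite (_ : (fun k => X k w) = (fun n => \sum_(0 <= k < n) telescope (X ^~ w) k + X 0%N w)%R).
  by apply: cvgD => //; exact: cvg_cst.
by apply/funext => n; rewrite telescope_sumr// subrK.
Qed.

(** Fatou's lemma applied to the squared increments from index k, which converge almost everywhere
    and whose integrals are bounded by [L2_increment_le]. *)
Lemma L2_cvg_pointwise_lim k :
  \int[m]_x ((pointwise_lim X x - X k x) ^+ 2)%:E <= (4 * C * 4^-1 ^+ k)%:E.
Proof.
pose f n w := ((X n w - X k w) ^+ 2)%:E : \bar R.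
have mf n : measurable_fun setT (f n).
  by apply: measurable_sqr_EFin => //; exact: measurable_funB.
have f0 n w : 0 <= f n w by rewrite lee_fin sqr_ge0.
apply: (@le_trans _ _ (\int[m]_x limn_einf (f ^~ x))).
  apply: ae_ge0_le_integral => //.
  - by move=> x _; rewrite lee_fin sqr_ge0.
  - apply: measurable_sqr_EFin => //; apply: measurable_funB => //.
    exact: measurable_pointwise_lim.
  - move=> x _; rewrite limn_einf_lim; apply: lime_ge; first exact: is_cvg_einfs.
    by near=> n; apply: le_ereal_inf_tmp => _ [? _ <-].
  - rewrite (_ : (fun x => _) = (fun x => - limn_esup (fun n => - f n x))); last first.
      by apply/funext => x; rewrite -[RHS]/(- limn_esup (-%E \o (f ^~ x))) limn_esupN oppeK.
    by apply: measurableT_comp => //; apply: measurable_fun_limn_esup => // n; exact: measurableT_comp.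
  - have := ae_cvg_pointwise_lim; apply: filterS => w Xw _.
    have Xw' : f ^~ w @ \oo --> ((pointwise_lim X w - X k w) ^+ 2)%:E.
      apply: cvgn_EFin; rewrite expr2; under eq_fun do rewrite expr2.
      by apply: cvgM; apply: cvgB => //; exact: cvg_cst.
    by rewrite is_cvg_limn_einfE ?(cvg_lim _ Xw')//; apply/cvg_ex; eexists; exact: Xw'.
apply: (le_trans (fatou _ _ _ _)) => //.
rewrite limn_einf_lim; apply: lime_le; first exact: is_cvg_einfs.
near=> n; have kn : (k <= n)%N by near: n; exact: nbhs_infty_ge.
apply: (@le_trans _ _ (\int[m]_x f n x)).
  by apply: ereal_inf_lbound; exists n => /=.
by rewrite /f -(subnKC kn); exact: L2_increment_le.
Unshelve. all: by end_near. Qed.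

End L2_limit.

Lemma le0_geometric (R : realType) (x : \bar R) (C : R) :
  (forall n, x <= (C * 4^-1 ^+ n)%:E)%E -> (x <= 0)%E.
Proof.
move=> xC; apply/lee_addgt0Pr => e e0; rewrite add0e.
have : (C * 4^-1 ^+ n) @[n --> \oo] --> (0 : R).
  rewrite -[0](mulr0 C); apply: cvgM; first exact: cvg_cst.
  by apply: cvg_expr; rewrite ger0_norm; lra.
move=> /cvgrPdist_lt/(_ e e0)[n _ /(_ n (leqnn n))]; rewrite sub0r normrN => h.
by apply: le_trans (xC n) _; rewrite lee_fin; apply: le_trans (ltW h); exact: ler_norm.
Qed.

(** * The singular kernel and Gronwall inequalities *)

Section nonneg_convolution.
Local Open Scope ereal_scope.
Context {R : realType}.
Local Notation mu := (@lebesgue_measure R).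
Variable g : R -> \bar R.
Hypotheses (mg : measurable_fun setT g) (g0 : forall x, 0 <= g x).
Hypothesis gN : forall x, (x <= 0)%R -> g x = 0.

Let mgr (A : set R) : measurable A -> measurable_fun setT (g \_ A).
Proof. by move=> mA; apply/(measurable_restrictT _ _).1 => //; exact: measurable_funTS. Qed.

Let gr0 (A : set R) x : 0 <= (g \_ A) x.
Proof. by rewrite patchE; case: ifP. Qed.

Let mreflect (f : R -> \bar R) (t : R) : measurable_fun setT f ->
  measurable_fun setT (fun s : R => f (t - s)%R).
Proof. by move=> mf; apply: measurableT_comp => //; exact: measurable_funB. Qed.

Let mshift (f : R -> \bar R) (t : R) : measurable_fun setT f ->
  measurable_fun setT (fun s : R => f (s - t)%R).
Proof. by move=> mf; apply: measurableT_comp => //; exact: measurable_funB. Qed.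

Lemma integral_reflect_itv (T t : R) : (t <= T)%R ->
  \int[mu]_(s in `[0%R, T]) g (t - s)%R = \int[mu]_(s in `[0%R, t]) g s.
Proof.
move=> tT; rewrite [RHS]integral_mkcond -[RHS](integral_reflect t)//; last exact: mgr.
rewrite [LHS]integral_mkcond; apply: eq_integral => s _; rewrite !patchE !mem_setE/= !in_itv/=.
case: (ltP s t) => st; last first.
  by rewrite gN ?subr_le0//; case: ifP; case: ifP.
have [s0|s0] := leP 0%R s; last by rewrite ifF//; lra.
by rewrite !ifT//; lra.
Qed.

Lemma integral_reflect_itv_ge (T s t : R) : (s <= t)%R ->
  \int[mu]_(r in `[s, T]) g (t - r)%R <= \int[mu]_(r in `[0%R, (t - s)%R]) g r.
Proof.
move=> st; rewrite [leRHS]integral_mkcond -[leRHS](integral_reflect t)//; last exact: mgr.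
rewrite [leLHS]integral_mkcond; apply: ge0_le_integral => //.
- by move=> x _; apply: erestrict_ge0.
- by apply/(measurable_restrictT _ _).1 => //; apply: measurable_funTS; exact: mreflect.
- by apply: mreflect; exact: mgr.
move=> r _; rewrite !patchE !mem_setE/= !in_itv/=; case: ifPn => [/andP[sr rT]|_]; last by case: ifP.
case: (ltP r t) => rt; first by rewrite ifT//; lra.
by rewrite gN ?subr_le0//; case: ifP.
Qed.

Lemma integral_shift_itv (T s : R) : (0 <= s)%R ->
  \int[mu]_(t in `[0%R, T]) g (t - s)%R <= \int[mu]_(r in `[0%R, T]) g r.
Proof.
move=> s0; rewrite [leRHS]integral_mkcond -[leRHS](integral_shift (- s)%R)//; last exact: mgr.
rewrite [leLHS]integral_mkcond; apply: ge0_le_integral => //.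
- by move=> x _; apply: erestrict_ge0.
- by apply/(measurable_restrictT _ _).1 => //; apply: measurable_funTS; exact: mshift.
- by apply: mshift; exact: mgr.
move=> r _; rewrite !patchE !mem_setE/= !in_itv/=; case: ifPn => [/andP[sr rT]|_]; last by case: ifP.
case: (ltP s r) => rs; first by rewrite ifT//; lra.
by rewrite gN ?subr_le0//; case: ifP.
Qed.

End nonneg_convolution.

Section kernel.
Local Open Scope ereal_scope.
Context {R : realType}.
Local Notation mu := (@lebesgue_measure R).
Variable alpha : R.
Hypothesis alpha_itv : (2^-1 < alpha < 1)%R.

(* Vanishing on ]-oo, 0], so that the integrand ker (t - s) * f s ignores the
   times s >= t and integrals over [0, t] can be taken over a common [0, T]. *)
Definition ker (r : R) : R := if (0 < r)%R then (r `^ (alpha - 1))%R else 0%R.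

Lemma ker_ge0 r : (0 <= ker r)%R.
Proof. by rewrite /ker; case: ifP => // _; exact: powR_ge0. Qed.

Lemma ker_gt0 r : (0 < r)%R -> (0 < ker r)%R.
Proof. by move=> r0; rewrite /ker r0 powR_gt0. Qed.

Lemma ker_neg r : (r <= 0)%R -> ker r = 0%R.
Proof. by rewrite /ker ltNge => ->. Qed.

(** The point r = 0 is included: the power of 0 with the nonzero exponent alpha - 1 has the default
    value 0. *)
Lemma kerE r : (0 <= r)%R -> ker r = (r `^ (alpha - 1))%R.
Proof.
move: alpha_itv => a12; rewrite le_eqVlt => /predU1P[<-|r0]; last by rewrite /ker r0.
by rewrite ker_neg// powR0//; apply/eqP; lra.
Qed.

Lemma ker_nincr r s : (0 < r)%R -> (r <= s)%R -> (ker s <= ker r)%R.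
Proof.
move: alpha_itv => a12 r0 rs; rewrite /ker r0 (lt_le_trans r0 rs).
rewrite (_ : alpha - 1 = - (1 - alpha))%R; last by lra.
have s0 := lt_le_trans r0 rs.
by rewrite !powRN lef_pV2 ?posrE ?powR_gt0//; apply: ge0_ler_powR; rewrite ?nnegrE; lra.
Qed.

Lemma measurable_ker : measurable_fun setT ker.
Proof.
apply: measurable_fun_ifT => //; exact: measurable_fun_ltr.
Qed.

Lemma sqr_kerE r : (0 < r)%R -> (ker r ^+ 2 = r `^ (2 * alpha - 2))%R.
Proof.
move: alpha_itv => a12 r0; rewrite /ker r0 -powR_mulrn ?powR_ge0// -powRrM.
by congr (_ `^ _)%R; lra.
Qed.

Lemma measurable_sqr_ker : measurable_fun setT (fun r => (ker r ^+ 2)%:E).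
Proof. by apply: measurable_sqr_EFin => //; exact: measurable_ker. Qed.

Definition ker_mass (x : R) : \bar R := \int[mu]_(r in `[0%R, x]) (ker r ^+ 2)%:E.

Lemma ker_mass_ge0 x : 0 <= ker_mass x.
Proof. exact: integral_sqr_ge0. Qed.

(** With be = 2 alpha - 1 > 0, the square of the kernel has the primitive r^be / be on positive
    arguments. The fundamental theorem of calculus is applied away from the singularity, and
    monotone convergence exhausts the interval ]0, x]. *)
Lemma ker_mass_le x : (0 <= x)%R ->
  ker_mass x <= ((2 * alpha - 1)^-1 * x `^ (2 * alpha - 1))%:E.
Proof.
rewrite le_eqVlt => /predU1P[<-|x0].
  rewrite /ker_mass set_itv1 integral_set1 lee_fin mulr_ge0 ?powR_ge0// invr_ge0.
  by move: alpha_itv; lra.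
move: alpha_itv => a12.
set be := (2 * alpha - 1)%R; have be0 : (0 < be)%R by rewrite /be; lra.
(* The denominator n + 2, rather than n + 1, keeps every interval nondegenerate. *)
pose F n : set R := `[(x / n.+2%:R)%R, x]%classic.
have F0 n : (0 < x / n.+2%:R)%R by rewrite divr_gt0.
have Fx n : (x / n.+2%:R < x)%R by rewrite ltr_pdivrMr// ltr_pMr// ltr1n.
have FE : \bigcup_n F n = `]0%R, x]%classic.
  apply/seteqP; split => r /=.
    move=> [n _]; rewrite /F /= !in_itv/= => /andP[xr rx].
    by rewrite rx (lt_le_trans (F0 n)).
  rewrite in_itv/= => /andP[r0 rx].
  exists (Num.truncn (x / r)) => //; rewrite /F /= in_itv/= rx andbT.
  rewrite ler_pdivrMr// -ler_pdivrMl// mulrC.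
  by apply: ltW; apply: (lt_trans (truncnS_gt _)); rewrite ltr_nat.
have -> : ker_mass x = \int[mu]_(r in `]0%R, x]) (ker r ^+ 2)%:E.
  rewrite /ker_mass -integral_itv_obnd_cbnd//.
  exact: measurable_funTS measurable_sqr_ker.
rewrite -FE.
have H : \int[mu]_(r in F i) (ker r ^+ 2)%:E @[i --> \oo] -->
    \int[mu]_(r in \bigcup_i F i) (ker r ^+ 2)%:E.
  apply: ge0_nondecreasing_set_cvg_integral.
  - move=> m n mn; apply/subsetPset => r; rewrite /F /= !in_itv/= => /andP[h ->].
    by rewrite andbT (le_trans _ h)// ler_pM2l// lef_pV2 ?posrE// ler_nat !ltnS.
  - by move=> i; exact: measurable_itv.
  - by move=> i; exact: measurable_funTS measurable_sqr_ker.
  - by move=> i r _; rewrite lee_fin sqr_ge0.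
rewrite -(cvg_lim _ H)//; apply: lime_le; first by apply/cvg_ex; eexists; exact: H.
apply: nearW => n /=.
have -> : \int[mu]_(r in F n) (ker r ^+ 2)%:E = \int[mu]_(r in F n) (r `^ (be - 1))%:E.
  apply: eq_integral => r; rewrite inE /F /= in_itv/= => /andP[h _].
  by rewrite sqr_kerE ?(lt_le_trans _ h)// /be; congr (_ `^ _)%:E; lra.
pose G (r : R) : R := (be^-1 * r `^ be)%R.
have dG (r : R) : (0 < r)%R -> is_derive r (1%R : R) G (r `^ (be - 1))%R.
  move=> r0; rewrite (_ : r `^ (be - 1) = be^-1 *: (be * r `^ (be - 1)))%R; last first.
    by rewrite /GRing.scale/= mulrA mulVf ?mul1r// gt_eqF.
  by apply: is_deriveZ; exact: is_derive1_powR.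
have cpow (p r : R) : (0 < r)%R -> {for r, continuous (fun z : R => z `^ p)%R}.
  move=> r0; apply: differentiable_continuous; apply/derivable1_diffP.
  by apply: derivable_powR; rewrite in_itv/= r0.
rewrite (@continuous_FTC2 _ _ G)//.
- rewrite -EFinB lee_fin /G lerBlDr lerDl mulr_ge0 ?powR_ge0// invr_ge0; exact: ltW.
- apply: continuous_in_subspaceT => r; rewrite inE/= in_itv/= => /andP[h _].
  by apply: cpow; exact: lt_le_trans h.
- split.
  + move=> r; rewrite in_itv/= => /andP[h _].
    by have [] := dG r (lt_trans (F0 n) h).
  + apply: cvg_at_right_filter; apply: differentiable_continuous; apply/derivable1_diffP.
    by have [] := dG _ (F0 n).
  + apply: cvg_at_left_filter; apply: differentiable_continuous; apply/derivable1_diffP.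
    by have [] := dG _ x0.
- move=> r; rewrite in_itv/= => /andP[h _]; rewrite derive1E.
  by have [_ ->] := dG r (lt_trans (F0 n) h).
Qed.

Lemma ker_mass_lty x : ker_mass x < +oo.
Proof.
have [x0|x0] := leP 0%R x; first by rewrite (le_lt_trans (ker_mass_le x0))// ltry.
by rewrite /ker_mass set_itv_ge ?integral_set0// bnd_simp -ltNge.
Qed.

Lemma ker_mass_nd x y : (x <= y)%R -> ker_mass x <= ker_mass y.
Proof.
move=> xy; apply: ge0_subset_integral => //.
- exact: measurable_funTS measurable_sqr_ker.
- by move=> r _; rewrite lee_fin sqr_ge0.
by move=> r; rewrite /= !in_itv/= => /andP[-> /le_trans]; apply.
Qed.

Lemma integral_sqr_ker (T t : R) : (t <= T)%R ->
  \int[mu]_(s in `[0%R, T]) (ker (t - s) ^+ 2)%:E = ker_mass t.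
Proof.
move=> tT; apply: (@integral_reflect_itv _ (fun r => (ker r ^+ 2)%:E)) => //.
- exact: measurable_sqr_ker.
- by move=> r; rewrite lee_fin sqr_ge0.
- by move=> r r0; rewrite ker_neg// expr0n.
Qed.

Lemma measurable_ker_shift (t : R) : measurable_fun setT (fun s : R => ker (t - s)%R).
Proof. by apply: measurableT_comp; [exact: measurable_ker|exact: measurable_funB]. Qed.

(** For r < s the values p = ker (t - r) and q = ker (s - r) satisfy 0 <= p <= q, so that (p - q)^2
    + p^2 <= q^2; for r >= s the second kernel vanishes. Integration gives the left-hand side plus
    the mass at t on one side, and the mass at s plus twice the mass at t - s on the other. The mass
    at s is at most the mass at t, which is finite and cancels. *)
Lemma integral_sqr_kerB (T s t : R) : (0 <= s)%R -> (s <= t)%R -> (t <= T)%R ->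
  \int[mu]_(r in `[0%R, T]) ((ker (t - r) - ker (s - r)) ^+ 2)%:E <=
  2%:E * ker_mass (t - s)%R.
Proof.
move=> s0 st tT.
set A := (X in X <= _).
have mk (u : R) : measurable_fun setT (fun r : R => (ker (u - r) ^+ 2)%:E).
  by apply: measurable_sqr_EFin => //; exact: measurable_ker_shift.
have mD : measurable_fun setT (fun r : R => ((ker (t - r) - ker (s - r)) ^+ 2)%:E).
  by apply: measurable_sqr_EFin => //; apply: measurable_funB; exact: measurable_ker_shift.
have k0 (u r : R) : 0 <= (ker (u - r) ^+ 2)%:E by rewrite lee_fin sqr_ge0.
pose h := (fun r : R => (ker (t - r) ^+ 2)%:E) \_ `[s, T].
have mh : measurable_fun setT h.
  by apply/(measurable_restrictT _ _).1 => //; exact: measurable_funTS.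
have h0 r : 0 <= h r by rewrite /h patchE; case: ifP.
have : A + ker_mass t <= ker_mass s + 2%:E * ker_mass (t - s)%R.
  rewrite -(integral_sqr_ker tT) -ge0_integralD; [|by []|by move=> r _; rewrite lee_fin sqr_ge0|
    exact: measurable_funTS|by []|by apply: measurable_funTS; exact: mk].
  apply: (@le_trans _ _ (\int[mu]_(r in `[0%R, T]) ((ker (s - r) ^+ 2)%:E + 2%:E * h r))).
    apply: ge0_le_integral => //.
    - by move=> r _; rewrite adde_ge0// lee_fin sqr_ge0.
    - by apply: measurable_funTS; apply: emeasurable_funD => //; exact: mk.
    - by apply: measurable_funTS; apply: emeasurable_funD; [exact: mk|exact: measurable_funeM].
    move=> r; rewrite /= in_itv/= => /andP[r0 rT].
    rewrite /h patchE mem_setE/= in_itv/= rT andbT; case: ifPn => [sr|].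
      rewrite (@ker_neg (s - r)%R) ?subr_le0// subr0 expr0n add0e -EFinD -EFinM lee_fin; lra.
    rewrite -ltNge => rs; rewrite mule0 adde0 -EFinD lee_fin.
    have : (ker (t - r) <= ker (s - r))%R by apply: ker_nincr; lra.
    by have := ker_ge0 (t - r); rewrite !expr2; nra.
  rewrite ge0_integralD; [|by []|by []|by apply: measurable_funTS; exact: mk|
    by move=> r _; rewrite mule_ge0|
    by apply: measurable_funTS; exact: measurable_funeM].
  rewrite (integral_sqr_ker (le_trans st tT)) leeD2l// ge0_integralZl//; last first.
    exact: measurable_funTS.
  rewrite lee_wpmul2l// /h -integral_mkcondr.
  rewrite (_ : _ `&` _ = `[s, T]%classic); last first.
    apply/seteqP; split => r; rewrite /= !in_itv/=; first by move=> [].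
    by move=> /andP[sr rT]; split; apply/andP; split; lra.
  apply: (@integral_reflect_itv_ge _ (fun r => (ker r ^+ 2)%:E)) => //.
  - exact: measurable_sqr_ker.
  - by move=> r; rewrite lee_fin sqr_ge0.
  - by move=> r r0; rewrite ker_neg// expr0n.
have tfin : ker_mass t \is a fin_num by rewrite ge0_fin_numE ?ker_mass_ge0// ker_mass_lty.
move=> H; have := le_trans H (leeD (ker_mass_nd st) (lexx _)).
by rewrite addeC leeD2lE.
Qed.

End kernel.

Section gronwall.
Local Open Scope ereal_scope.
Context {R : realType}.
Local Notation mu := (@lebesgue_measure R).
Variable alpha : R.
Hypothesis alpha_itv : (2^-1 < alpha < 1)%R.
Local Notation ker := (ker alpha).

Definition damped_ker (l r : R) : \bar R := (ker r ^+ 2 * expR (- l * r))%:E.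

Lemma measurable_damped_ker l : measurable_fun setT (damped_ker l).
Proof.
apply/measurable_EFinP; apply: measurable_funM.
  by apply: measurable_funX; exact: measurable_ker.
by apply: measurableT_comp => //; exact: measurable_funM.
Qed.

Lemma damped_ker_ge0 l r : 0 <= damped_ker l r.
Proof. by rewrite lee_fin mulr_ge0 ?sqr_ge0// expR_ge0. Qed.

Lemma damped_ker_neg l r : (r <= 0)%R -> damped_ker l r = 0.
Proof. by move=> r0; rewrite /damped_ker ker_neg// expr0n mul0r. Qed.

(* The weight exp (- l t) turns the Volterra operator into a contraction. *)
Lemma damping (A T : R) : (0 <= A)%R -> exists2 l : R, (0 <= l)%R &
  A%:E * \int[mu]_(r in `[0%R, T]) damped_ker l r <= (4^-1)%:E.
Proof.
move=> A0.
have ik : mu.-integrable `[0%R, T] (fun r => (ker r ^+ 2)%:E).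
  apply/integrableP; split; first exact: measurable_funTS (measurable_sqr_ker _).
  under eq_integral do rewrite gee0_abs ?lee_fin ?sqr_ge0//.
  exact: ker_mass_lty.
(* As l runs through the integers, the damped kernel tends to 0 pointwise and is dominated by the
   integrable square of [ker]; any n far enough in the sequence is a suitable l. *)
have [] := @dominated_convergence _ _ _ mu `[0%R, T]%classic _
  (fun n => damped_ker n%:R) (cst 0) (fun r => (ker r ^+ 2)%:E) _ _ _ ik _.
- exact: measurable_itv.
- by move=> n; exact: measurable_funTS (measurable_damped_ker _).
- exact: measurable_cst.
- apply: aeW => r; rewrite /= in_itv/= => /andP[r0 _].
  move: r0; rewrite le_eqVlt => /predU1P[<-|r0].
    under eq_fun do rewrite damped_ker_neg//; exact: cvg_cst.
  rewrite [X in _ --> X](_ : 0 = (ker r ^+ 2 * 0)%:E); last by rewrite mulr0.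
  apply: cvgn_EFin; apply: cvgM; first exact: cvg_cst.
  under eq_fun do rewrite mulNr -mulrN expRM_natl.
  by apply: cvg_expr; rewrite ger0_norm ?expR_ge0// expR_lt1 oppr_lt0.
- apply: aeW => r n; rewrite /= in_itv/= => /andP[r0 _].
  have k2 : (0 <= ker r ^+ 2)%R by exact: sqr_ge0.
  have e1 : (expR (- n%:R * r) <= 1)%R by rewrite -expR0 ler_expR mulNr oppr_le0 mulr_ge0.
  rewrite /damped_ker /= lee_fin ger0_norm; last by rewrite mulr_ge0 ?expR_ge0.
  by rewrite -[leRHS]mulr1 ler_wpM2l.
move=> _ _; rewrite integral0 => cv.
have /fine_cvgP[cfin cv'] := cv.
have cA : (A * fine (\int[mu]_(r in `[0%R, T]) damped_ker n%:R r))%R @[n --> \oo] --> (A * 0)%R.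
  by apply: cvgM => //; exact: cvg_cst.
move: cA; rewrite mulr0 => /cvgrPdist_le/(_ 4^-1%R).
move=> /(_ ltac:(by rewrite invr_gt0)) near4.
have [n [nfin n4]] : exists n, \int[mu]_(r in `[0%R, T]) damped_ker n%:R r \is a fin_num /\
   (`|0 - A * fine (\int[mu]_(r in `[0%R, T]) damped_ker n%:R r)| <= 4^-1)%R.
  have [N _ HN] := filterI cfin near4.
  by exists N; have := HN N (leqnn N).
exists n%:R => //; rewrite -(fineK nfin) -EFinM lee_fin.
by apply: le_trans n4; rewrite sub0r normrN ler_norm.
Qed.

Definition vconv (T : R) (v : R -> \bar R) (t : R) : \bar R :=
  \int[mu]_(s in `[0%R, T]) ((ker (t - s) ^+ 2)%:E * v s).

Lemma measurable_ker2 : measurable_fun setT (fun p : R * R => (ker (p.1 - p.2) ^+ 2)%:E).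
Proof.
apply: measurable_sqr_EFin => //.
apply: (@measurableT_comp _ _ _ _ _ _ ker _ (fun p : R * R => p.1 - p.2)%R).
  exact: measurable_ker.
by apply: measurable_funB; [exact: measurable_fst|exact: measurable_snd].
Qed.

Lemma measurable_ker_sqr_shift (t : R) : measurable_fun setT (fun s : R => (ker (t - s) ^+ 2)%:E).
Proof. by apply: measurable_sqr_EFin => //; exact: measurable_ker_shift. Qed.

Section fixed_T.
Variable T : R.

Lemma vconv_ge0 v t : (forall s, 0 <= v s) -> 0 <= vconv T v t.
Proof. by move=> v0; apply: integral_ge0 => s _; rewrite mule_ge0// lee_fin sqr_ge0. Qed.

Lemma measurable_vconv v : measurable_fun setT v -> (forall s, 0 <= v s) ->
  measurable_fun setT (vconv T v).
Proof.
move=> mv v0.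
apply: (@measurable_fun_integral_dom _ _ _ _ _ mu _ _
   (fun p : R * R => (ker (p.1 - p.2) ^+ 2)%:E * v p.2)) => //.
- by apply: emeasurable_funM; [exact: measurable_ker2|apply: measurableT_comp].
- by move=> p; rewrite mule_ge0// lee_fin sqr_ge0.
Qed.

Lemma le_vconv v w t : measurable_fun setT v -> measurable_fun setT w ->
  (forall s, 0 <= v s) -> (forall s, (0 <= s)%R -> (s <= T)%R -> v s <= w s) ->
  vconv T v t <= vconv T w t.
Proof.
move=> mv mw v0 vw; apply: ge0_le_integral => //.
- by move=> s _; rewrite mule_ge0// lee_fin sqr_ge0.
- apply: measurable_funTS; apply: emeasurable_funM => //; exact: measurable_ker_sqr_shift.
- apply: measurable_funTS; apply: emeasurable_funM => //; exact: measurable_ker_sqr_shift.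
- move=> s; rewrite /= in_itv/= => /andP[s0 sT].
  by rewrite lee_wpmul2l ?lee_fin ?sqr_ge0//; exact: vw.
Qed.

Lemma vconvD v w t : measurable_fun setT v -> measurable_fun setT w ->
  (forall s, 0 <= v s) -> (forall s, 0 <= w s) ->
  vconv T (fun s => v s + w s) t = vconv T v t + vconv T w t.
Proof.
move=> mv mw v0 w0; rewrite /vconv -ge0_integralD//.
- by apply: eq_integral => s _; rewrite ge0_muleDr.
- by move=> s _; rewrite mule_ge0// lee_fin sqr_ge0.
- apply: measurable_funTS; apply: emeasurable_funM => //; exact: measurable_ker_sqr_shift.
- by move=> s _; rewrite mule_ge0// lee_fin sqr_ge0.
- apply: measurable_funTS; apply: emeasurable_funM => //; exact: measurable_ker_sqr_shift.
Qed.

Lemma vconvZ (k : R) v t : (0 <= k)%R -> measurable_fun setT v -> (forall s, 0 <= v s) ->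
  vconv T (fun s => k%:E * v s) t = k%:E * vconv T v t.
Proof.
move=> k0 mv v0; rewrite /vconv -ge0_integralZl//.
- by apply: eq_integral => s _; rewrite muleCA.
- apply: measurable_funTS; apply: emeasurable_funM => //; exact: measurable_ker_sqr_shift.
- by move=> s _; rewrite mule_ge0// lee_fin sqr_ge0.
Qed.

Lemma vconv_cst (k : R) t : (0 <= k)%R -> (t <= T)%R ->
  vconv T (fun _ => k%:E) t = k%:E * ker_mass alpha t.
Proof.
move=> k0 tT; rewrite -(integral_sqr_ker alpha tT) -ge0_integralZl//.
- by apply: eq_integral => s _; rewrite muleC.
- apply: measurable_funTS; exact: measurable_ker_sqr_shift.
- by move=> s _; rewrite lee_fin sqr_ge0.
Qed.

(** Since exp (l s) = exp (l t) exp (- l (t - s)), the convolution equals exp (l t) times an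
    integral of the damped kernel. *)
Lemma vconv_exp (A l t : R) : (0 <= A)%R -> (t <= T)%R ->
  A%:E * \int[mu]_(r in `[0%R, T]) damped_ker l r <= (4^-1)%:E ->
  A%:E * vconv T (fun s => (expR (l * s))%:E) t <= (4^-1 * expR (l * t))%:E.
Proof.
move=> A0 tT HA.
have -> : vconv T (fun s => (expR (l * s))%:E) t =
    (expR (l * t))%:E * \int[mu]_(s in `[0%R, T]) damped_ker l (t - s)%R.
  rewrite -ge0_integralZl//.
  - apply: eq_integral => s _; rewrite /damped_ker -!EFinM; congr EFin.
    rewrite mulrCA -expRD; congr (_ * expR _)%R; lra.
  - apply: measurable_funTS; apply: measurableT_comp; first exact: measurable_damped_ker.
    exact: measurable_funB.
  - by move=> s _; exact: damped_ker_ge0.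
rewrite muleCA [leRHS]EFinM [leRHS]muleC lee_wpmul2l ?lee_fin ?expR_ge0//.
apply: le_trans HA; rewrite lee_wpmul2l ?lee_fin//.
rewrite integral_reflect_itv//.
- apply: ge0_subset_integral => //.
  + exact: measurable_funTS (measurable_damped_ker _).
  + by move=> s _; exact: damped_ker_ge0.
  + by move=> s; rewrite /= !in_itv/= => /andP[-> /le_trans]; apply.
- exact: measurable_damped_ker.
- by move=> s; exact: damped_ker_ge0.
- by move=> s; exact: damped_ker_neg.
Qed.

(** Contraction by 1/4 in the weighted L1 norm: after Tonelli, the weight at t splits into the
    weight at s and exp (- l (t - s)), and the latter damps the kernel. *)
Lemma integral_vconv_exp (A l : R) v : (0 <= A)%R ->
  measurable_fun setT v -> (forall s, 0 <= v s) ->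
  A%:E * \int[mu]_(r in `[0%R, T]) damped_ker l r <= (4^-1)%:E ->
  \int[mu]_(t in `[0%R, T]) ((expR (- l * t))%:E * (A%:E * vconv T v t)) <=
  (4^-1)%:E * \int[mu]_(s in `[0%R, T]) ((expR (- l * s))%:E * v s).
Proof.
move=> A0 mv v0 HA.
have me : measurable_fun setT (fun t : R => (expR (- l * t))%:E).
  by apply/measurable_EFinP; apply: measurableT_comp => //; exact: measurable_funM.
have e0 t : 0 <= (expR (- l * t))%:E :> \bar R by rewrite lee_fin expR_ge0.
pose f (p : R * R) := (expR (- l * p.1))%:E * (A%:E * ((ker (p.1 - p.2) ^+ 2)%:E * v p.2)).
have mf : measurable_fun setT f.
  apply: emeasurable_funM; first by apply: (measurableT_comp me); exact: measurable_fst.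
  apply: measurable_funeM; apply: emeasurable_funM; [exact: measurable_ker2|exact: measurableT_comp].
have f0 p : 0 <= f p by rewrite !mule_ge0// lee_fin ?sqr_ge0.
have mks t : measurable_fun setT (fun s : R => (ker (t - s) ^+ 2)%:E * v s).
  by apply: emeasurable_funM => //; exact: measurable_ker_sqr_shift.
have ks0 t s : 0 <= (ker (t - s) ^+ 2)%:E * v s by rewrite mule_ge0// lee_fin sqr_ge0.
rewrite [leLHS](_ : _ = \int[mu]_(t in `[0%R, T]) \int[mu]_(s in `[0%R, T]) f (t, s)); last first.
  apply: eq_integral => t _; rewrite /f /= /vconv.
  rewrite -ge0_integralZl//; last by apply: measurable_funTS; exact: mks.
  rewrite -ge0_integralZl//.
  - by apply: measurable_funTS; apply: measurable_funeM; exact: mks.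
  - by move=> s _; rewrite mule_ge0.
rewrite (@domain_tonelli _ _ _ _ _ mu mu)// -ge0_integralZl//; first last.
- by move=> s _; rewrite mule_ge0.
- by apply: measurable_funTS; exact: emeasurable_funM.
have mfs s : measurable_fun setT (fun t : R => damped_ker l (t - s)%R).
  apply: measurableT_comp; first exact: measurable_damped_ker.
  exact: measurable_funB.
apply: ge0_le_integral => //.
- by move=> s _; apply: integral_ge0 => t _; exact: f0.
- apply: measurable_funTS.
  apply: (@measurable_fun_integral_dom _ _ _ _ _ mu _ _ (fun p : R * R => f (p.2, p.1))) => //.
  by apply: measurableT_comp => //; exact: measurable_swap.
- by apply: measurable_funTS; apply: measurable_funeM; exact: emeasurable_funM.
move=> s; rewrite /= in_itv/= => /andP[s0 sT].
have -> : \int[mu]_(t in `[0%R, T]) f (t, s) =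
    ((expR (- l * s))%:E * v s) * (A%:E * \int[mu]_(t in `[0%R, T]) damped_ker l (t - s)%R).
  rewrite -!ge0_integralZl//.
  - apply: eq_integral => t _; rewrite /f /damped_ker /=.
    rewrite (_ : expR (- l * t) = expR (- l * s) * expR (- l * (t - s)))%R; last first.
      by rewrite -expRD; congr expR; lra.
    rewrite !(EFinM _ (expR _)) -!muleA; congr (_ * _); rewrite muleCA [RHS]muleCA; congr (_ * _).
    by rewrite muleCA [RHS]muleCA; congr (_ * _); exact: muleC.
  - by apply: measurable_funTS; apply: measurable_funeM; exact: mfs.
  - by move=> t _; rewrite mule_ge0// damped_ker_ge0.
  - by rewrite mule_ge0.
  - by apply: measurable_funTS; exact: mfs.
  - by move=> t _; rewrite damped_ker_ge0.
rewrite muleC lee_wpmul2r ?mule_ge0//; apply: le_trans HA; rewrite lee_wpmul2l ?lee_fin//.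
apply: integral_shift_itv => //.
- exact: measurable_damped_ker.
- by move=> r; exact: damped_ker_ge0.
- by move=> r; exact: damped_ker_neg.
Qed.

(** In the weighted L1 norm the inequality reads I <= I / 4 + H, whence I <= 2 H because I is
    finite. The factor exp (l T) undoes the weight. The constant is fixed before [v] and [h], so it
    can serve all paths of a process at once. *)
Lemma gronwall_integral (A : R) : (0 <= A)%R -> (0 <= T)%R ->
  exists2 C : R, (0 <= C)%R & forall v h : R -> \bar R,
    measurable_fun setT v -> (forall s, 0 <= v s) ->
    measurable_fun setT h -> (forall s, 0 <= h s) ->
    \int[mu]_(t in `[0%R, T]) v t < +oo ->
    (forall t, (0 <= t)%R -> (t <= T)%R -> v t <= A%:E * vconv T v t + h t) ->
    \int[mu]_(t in `[0%R, T]) v t <= C%:E * \int[mu]_(t in `[0%R, T]) h t.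
Proof.
move=> A0 T0; have [l l0 HA] := damping T A0.
exists (2 * expR (l * T))%R; first by rewrite mulr_ge0// expR_ge0.
move=> v h mv v0 mh h0 vfin vh.
have me : measurable_fun setT (fun t : R => (expR (- l * t))%:E).
  by apply/measurable_EFinP; apply: measurableT_comp => //; exact: measurable_funM.
have e0 t : 0 <= (expR (- l * t))%:E :> \bar R by rewrite lee_fin expR_ge0.
have e1 t : (0 <= t)%R -> (expR (- l * t))%:E <= 1 :> \bar R.
  by move=> t0; rewrite lee_fin -expR0 ler_expR mulNr oppr_le0 mulr_ge0.
pose I := \int[mu]_(t in `[0%R, T]) ((expR (- l * t))%:E * v t).
pose H := \int[mu]_(t in `[0%R, T]) ((expR (- l * t))%:E * h t).
have le_w (f : R -> \bar R) : measurable_fun setT f -> (forall s, 0 <= f s) ->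
    \int[mu]_(t in `[0%R, T]) ((expR (- l * t))%:E * f t) <= \int[mu]_(t in `[0%R, T]) f t.
  move=> mf f0; apply: ge0_le_integral => //.
  - by move=> t _; rewrite mule_ge0.
  - by apply: measurable_funTS; exact: emeasurable_funM.
  - exact: measurable_funTS.
  - by move=> t; rewrite /= in_itv/= => /andP[t0 _]; rewrite gee_pMl ?e1// ge0_fin_numE.
have I0 : 0 <= I by apply: integral_ge0 => t _; rewrite mule_ge0.
have Ifin : I \is a fin_num by rewrite ge0_fin_numE//; apply: le_lt_trans vfin; exact: le_w.
have mc := measurable_vconv mv v0.
have c0 t := vconv_ge0 t v0.
have IH : I <= (4^-1)%:E * I + H.
  apply: (@le_trans _ _ (\int[mu]_(t in `[0%R, T])
     ((expR (- l * t))%:E * (A%:E * vconv T v t) + (expR (- l * t))%:E * h t))).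
    apply: ge0_le_integral => //.
    - by move=> t _; rewrite mule_ge0.
    - by apply: measurable_funTS; exact: emeasurable_funM.
    - apply: measurable_funTS; apply: emeasurable_funD; apply: emeasurable_funM => //.
      exact: measurable_funeM.
    - move=> t; rewrite /= in_itv/= => /andP[t0 tT].
      rewrite -ge0_muleDr// ?mule_ge0// lee_wpmul2l//; exact: vh.
  rewrite ge0_integralD//.
  - by rewrite leeD2r//; exact: integral_vconv_exp.
  - by move=> t _; rewrite !mule_ge0.
  - apply: measurable_funTS; apply: emeasurable_funM => //; exact: measurable_funeM.
  - by move=> t _; rewrite mule_ge0.
  - by apply: measurable_funTS; exact: emeasurable_funM.
have I2H : I <= 2%:E * H.
  have H0 : 0 <= H by apply: integral_ge0 => t _; rewrite mule_ge0.
  move: IH; rewrite -(fineK Ifin); move: H0; case: H => [x| |]//; last by rewrite mulry gtr0_sg// mul1e leey.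
  rewrite -!EFinM -!EFinD !lee_fin; move: I0; rewrite -(fineK Ifin) lee_fin; lra.
rewrite EFinM muleAC; apply: (@le_trans _ _ ((expR (l * T))%:E * I)).
  rewrite /I -ge0_integralZl//.
  - apply: ge0_le_integral => //.
    + exact: measurable_funTS.
    + by apply: measurable_funTS; apply: measurable_funeM; exact: emeasurable_funM.
    + move=> t; rewrite /= in_itv/= => /andP[t0 tT]; rewrite muleA lee_pemull//.
      by rewrite -EFinM lee_fin -expRD -expR0 ler_expR mulNr subr_ge0 ler_wpM2l.
  - by apply: measurable_funTS; exact: emeasurable_funM.
  - by move=> t _; rewrite mule_ge0.
rewrite muleC; apply: lee_wpmul2r; first by rewrite lee_fin expR_ge0.
by apply: (le_trans I2H); rewrite lee_wpmul2l ?lee_fin//; exact: le_w.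
Qed.

(** The excess D of [v] over a supersolution V satisfies D <= A * vconv D, so its integral vanishes
    by [gronwall_integral] with zero forcing. Although D is thereby null only almost everywhere, its
    convolution vanishes at every t, which yields v <= V at every t. *)
Lemma gronwall_sup (A : R) : (0 <= A)%R -> (0 <= T)%R ->
  exists2 C : R, (0 <= C)%R & forall (v : R -> \bar R) (a : R), (0 <= a)%R ->
    measurable_fun setT v -> (forall s, 0 <= v s) ->
    \int[mu]_(t in `[0%R, T]) v t < +oo ->
    (forall t, (0 <= t)%R -> (t <= T)%R -> v t <= A%:E * vconv T v t + a%:E) ->
    forall t, (0 <= t)%R -> (t <= T)%R -> v t <= (C * a)%:E.
Proof.
move=> A0 T0; have [l l0 HA] := damping T A0.
have [C C0 HC] := gronwall_integral A0 T0.
exists (2 * expR (l * T))%R; first by rewrite mulr_ge0// expR_ge0.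
move=> v a a0 mv v0 vfin va t t0 tT.
(* A supersolution: the operator maps V to at most V / 4, which is a exp (l s) / 2, and a + a exp (l
   s) / 2 stays below 2 a exp (l s) because the exponential is at least 1. *)
pose V s := (2 * a * expR (l * s))%:E : \bar R.
have mV : measurable_fun setT V.
  apply/measurable_EFinP; apply: measurable_funM => //; exact: measurableT_comp.
have V0 s : 0 <= V s by rewrite lee_fin !mulr_ge0// expR_ge0.
have HV s : (0 <= s)%R -> (s <= T)%R -> a%:E + A%:E * vconv T V s <= V s.
  move=> s0 sT.
  have -> : vconv T V s = (2 * a)%:E * vconv T (fun s => (expR (l * s))%:E) s.
    rewrite -vconvZ ?mulr_ge0//.
      by apply/measurable_EFinP; apply: measurableT_comp => //; exact: measurable_funM.
  rewrite muleCA; apply: (le_trans (leeD2l _ (lee_wpmul2l _ (vconv_exp A0 sT HA)))).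
    by rewrite lee_fin mulr_ge0.
  rewrite -EFinM -EFinD lee_fin.
  have : (1 <= expR (l * s))%R by rewrite -expR0 ler_expR mulr_ge0.
  nra.
pose D s := maxe (v s - V s) 0.
have mD : measurable_fun setT D.
  by apply: measurable_maxe => //; apply: emeasurable_funB.
have D0 s : 0 <= D s by rewrite /D le_max lexx orbT.
have Dv s : D s <= v s by rewrite /D ge_max v0 andbT leeBlDr// leeDl.
have vDV s : v s <= D s + V s by rewrite -leeBlDr// /D le_max lexx.
have key s : (0 <= s)%R -> (s <= T)%R -> v s <= A%:E * vconv T D s + V s.
  move=> s0 sT; apply: (le_trans (va s s0 sT)).
  apply: (@le_trans _ _ (A%:E * (vconv T D s + vconv T V s) + a%:E)).
    rewrite leeD2r// lee_wpmul2l ?lee_fin// -vconvD//.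
    by apply: le_vconv => //; exact: emeasurable_funD.
  rewrite ge0_muleDr ?vconv_ge0// -addeA leeD2l// addeC; exact: HV.
have Dint : \int[mu]_(s in `[0%R, T]) D s = 0.
  apply/eqP; rewrite eq_le integral_ge0// andbT.
  apply: (le_trans (HC D (cst 0) mD D0 _ _ _ _)) => //.
  - apply: le_lt_trans vfin; apply: ge0_le_integral => //; exact: measurable_funTS.
  - move=> s s0 sT; rewrite adde0 /D ge_max mule_ge0 ?vconv_ge0 ?lee_fin// andbT.
    by rewrite leeBlDr//; exact: key.
  - by rewrite integral0 mule0.
have cD : vconv T D t = 0.
  apply/eqP; rewrite eq_le vconv_ge0// andbT.
  have /ae_eq_integral_abs : \int[mu]_(s in `[0%R, T]) `|D s| = 0.
    by under eq_integral do rewrite gee0_abs//.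
  move=> /(_ _ _)/= Dae.
  rewrite /vconv (ae_eq_integral (cst 0))//; first by rewrite integral0.
  - apply: measurable_funTS; apply: emeasurable_funM => //; exact: measurable_ker_sqr_shift.
  - have {}Dae := Dae ltac:(exact: measurable_itv) ltac:(exact: measurable_funTS).
    by apply: filterS Dae => s h /h /= ->; rewrite mule0.
apply: (le_trans (key t t0 tT)); rewrite cD mule0 add0e lee_fin.
by rewrite [leRHS]mulrAC ler_wpM2l ?mulr_ge0// ler_expR ler_wpM2l.
Qed.

End fixed_T.
End gronwall.

(** * Brownian increments and the elementary isometry *)

Section layer_cake.
Local Open Scope ereal_scope.
Context {R : realType} (d : measure_display) (T : measurableType d).
Local Notation mu := (@lebesgue_measure R).

(* Reduces integrals against normal_prob, which is given by its values on sets,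
   to integrals against its density. *)
Lemma layer_cake (m : {sigma_finite_measure set T -> \bar R}) (f : T -> R) :
  measurable_fun setT f -> (forall x, (0 <= f x)%R) ->
  \int[m]_x (f x)%:E = \int[mu]_(y in `[0%R, +oo[) m [set x | (y < f x)%R].
Proof.
move=> mf f0.
pose h (p : T * R) : \bar R := if (p.2 < f p.1)%R then 1 else 0.
have mh : measurable_fun setT h.
  apply: measurable_fun_ifT => //; apply: measurable_fun_ltr => //.
  by apply: (measurableT_comp mf); exact: measurable_fst.
have h0 p : 0 <= h p by rewrite /h; case: ifP.
transitivity (\int[m]_x \int[mu]_(y in `[0%R, +oo[) h (x, y)).
  apply: eq_integral => x _.
  rewrite [RHS](_ : _ = \int[mu]_(y in `[0%R, f x[) (cst 1 y)).
    rewrite integral_cst// mul1e /= lebesgue_measure_itv/= lte_fin; case: ltP => [_|fx0].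
      by rewrite oppr0 addr0.
    by congr EFin; apply/eqP; rewrite eq_le f0 andbT.
  rewrite [LHS]integral_mkcond [RHS]integral_mkcond; apply: eq_integral => y _.
  rewrite !patchE !mem_setE /h/= !in_itv/= andbT.
  by case: (0 <= y)%R => //=; case: ifP.
rewrite (@domain_tonelli _ _ _ _ _ m mu)//; apply: eq_integral => y _.
rewrite -[X in _ = m X]setIT -integral_indic//; last first.
  have := measurable_fun_ltr (measurable_cst y) mf => /(_ measurableT [set true]).
  by rewrite setTI; apply.
apply: eq_integral => x _; rewrite /h/= indicE.
by case: (boolP (y < f x)%R) => yf; [rewrite mem_set|rewrite memNset//; exact/negP].
Qed.

End layer_cake.

Section normal_moments.
Local Open Scope ereal_scope.
Context {R : realType}.
Local Notation mu := (@lebesgue_measure R).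

(** The layer cake formula evaluates the law only on superlevel sets of [f], where it is the
    integral of the density; Tonelli then integrates out the level. *)
Lemma ge0_integral_normal_prob (m s : R) (f : R -> R) :
  measurable_fun setT f -> (forall x, (0 <= f x)%R) ->
  \int[normal_prob m s]_x (f x)%:E = \int[mu]_x (f x * normal_pdf m s x)%:E.
Proof.
move=> mf f0; rewrite layer_cake//.
pose h (p : R * R) : \bar R := if (p.1 < f p.2)%R then (normal_pdf m s p.2)%:E else 0.
have mpdf : measurable_fun setT (fun x => (normal_pdf m s x)%:E).
  by apply/measurable_EFinP; exact: measurable_normal_pdf.
have mh : measurable_fun setT h.
  apply: measurable_fun_ifT => //.
  - by apply: measurable_fun_ltr => //; apply: (measurableT_comp mf); exact: measurable_snd.
  - by apply: (measurableT_comp mpdf); exact: measurable_snd.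
have h0 p : 0 <= h p by rewrite /h; case: ifP => // _; rewrite lee_fin normal_pdf_ge0.
transitivity (\int[mu]_(y in `[0%R, +oo[) \int[mu]_x h (y, x)).
  apply: eq_integral => y _; rewrite /= /normal_prob [LHS]integral_mkcond.
  apply: eq_integral => x _; rewrite patchE /h/=.
  by case: (boolP (y < f x)%R) => yf; [rewrite mem_set|rewrite memNset//; exact/negP].
rewrite (@domain_tonelli _ _ _ _ _ mu mu)//; apply: eq_integral => x _.
rewrite [LHS](_ : _ = \int[mu]_(y in `[0%R, f x[) cst (normal_pdf m s x)%:E y).
  rewrite integral_cst//= lebesgue_measure_itv/= lte_fin; case: ltP => [_|fx0].
    by rewrite oppr0 addr0 -EFinM mulrC.
  have -> : f x = 0%R by apply/eqP; rewrite eq_le fx0 f0.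
  by rewrite mule0 mul0r.
rewrite [LHS]integral_mkcond [RHS]integral_mkcond; apply: eq_integral => y _.
rewrite !patchE !mem_setE /h/= !in_itv/= andbT.
by case: (0 <= y)%R => //=; case: ifP.
Qed.

(** Integration by parts: G (x) = - s^2 x pdf (x) has the derivative (x^2 - s^2) pdf (x). On growing
    symmetric intervals the second moment is therefore s^2 times the mass plus a boundary term that
    tends to 0. *)
Lemma integral_sqr_normal_prob (s : R) : (0 < s)%R ->
  \int[normal_prob 0 s]_x (x ^+ 2)%:E = (s ^+ 2)%:E.
Proof.
move=> s0; have sn0 : s != 0%R by rewrite gt_eqF.
have mpdf := @measurable_normal_pdf R 0 s.
rewrite (@ge0_integral_normal_prob 0 s (fun x => x ^+ 2)%R); last 2 first.
- exact: measurable_funX.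
- by move=> x; exact: sqr_ge0.
pose G (x : R) : R := (- (s ^+ 2 * x) * normal_pdf 0 s x)%R.
pose g (x : R) : R := ((x ^+ 2 - s ^+ 2) * normal_pdf 0 s x)%R.
have dG (x : R) : is_derive x (1%R : R) G (g x).
  rewrite /G /g /normal_pdf (negbTE sn0) /normal_fun.
  set c := normal_peak s.
  apply: is_derive_eq.
  rewrite !scaler0 ?addr0 /GRing.scale/= ?subr0.
  field.
  by [].
have cG : continuous G by move=> x; apply: differentiable_continuous; apply/derivable1_diffP; have [] := dG x.
have cpdf : continuous (@normal_pdf R 0 s) by exact: continuous_normal_pdf.
have cg : continuous g.
  move=> x; rewrite /g; apply: cvgM; last exact: cpdf.
  by apply: cvgB; [exact: sqr_continuous|exact: cvg_cst].
pose F n : set R := `[(- n.+1%:R)%R, n.+1%:R]%classic.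
have F01 n : (- n.+1%:R < n.+1%:R :> R)%R by rewrite (@lt_trans _ _ 0%R)// oppr_lt0.
have mF n : measurable (F n) by exact: measurable_itv.
have ndF : nondecreasing_seq F.
  move=> a b ab; apply/subsetPset => x; rewrite /F /= !in_itv/= => /andP[xa xb].
  have ab' : (a.+1%:R <= b.+1%:R :> R)%R by rewrite ler_nat ltnS.
  by rewrite (le_trans xb)// (le_trans _ xa)// lerN2.
have FT : \bigcup_n F n = setT.
  apply/seteqP; split => // x _; exists (Num.truncn `|x|) => //.
  by rewrite /F /= in_itv/= -ler_norml ltW// truncnS_gt.
have int_n n : \int[mu]_(x in F n) (x ^+ 2 * normal_pdf 0 s x)%:E =
    (s ^+ 2)%:E * \int[mu]_(x in F n) (normal_pdf 0 s x)%:E +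
    (- (2 * s ^+ 2 * n.+1%:R * normal_pdf 0 s n.+1%:R))%:E.
  have Hg : \int[mu]_(x in F n) (g x)%:E = (- (2 * s ^+ 2 * n.+1%:R * normal_pdf 0 s n.+1%:R))%:E.
    rewrite (@continuous_FTC2 _ g G)//.
    - rewrite /G -EFinB; congr EFin.
      have -> : normal_pdf 0 s (- n.+1%:R) = normal_pdf 0 s n.+1%:R :> R.
        by rewrite /normal_pdf (negbTE sn0) /normal_fun !subr0 sqrrN.
      by ring.
    - exact: continuous_subspaceT.
    - split => [x _||].
      + by have [] := dG x.
      + by apply: cvg_at_right_filter; exact: cG.
      + by apply: cvg_at_left_filter; exact: cG.
    - by move=> x _; rewrite derive1E; have [_ ->] := dG x.
  have i1 : mu.-integrable (F n) (fun x => (normal_pdf 0 s x)%:E).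
    by apply: continuous_compact_integrable; [exact: segment_compact|exact: continuous_subspaceT].
  have i2 : mu.-integrable (F n) (fun x => (g x)%:E).
    by apply: continuous_compact_integrable; [exact: segment_compact|exact: continuous_subspaceT].
  have mF' : measurable (F n : set (measurableTypeR R)) by exact: measurable_itv.
  rewrite -Hg -(integralZl mF' i1); apply: etrans (integralD mF' (integrableZl mF' (s ^+ 2)%R i1) i2).
  by apply: eq_integral => x _; rewrite -EFinM -EFinD /g; congr EFin; ring.
have cv1 : \int[mu]_(x in F n) (x ^+ 2 * normal_pdf 0 s x)%:E @[n --> \oo] -->
    \int[mu]_x (x ^+ 2 * normal_pdf 0 s x)%:E.
  rewrite -FT; apply: ge0_nondecreasing_set_cvg_integral => //.
  - by move=> n; apply/measurable_EFinP; apply: measurable_funTS; apply: measurable_funM.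
  - by move=> n x _; rewrite lee_fin mulr_ge0 ?sqr_ge0// normal_pdf_ge0.
have cv2 : \int[mu]_(x in F n) (normal_pdf 0 s x)%:E @[n --> \oo] --> 1.
  rewrite -(integral_normal_pdf 0 s) -FT; apply: ge0_nondecreasing_set_cvg_integral => //.
  - by move=> n; apply/measurable_EFinP; exact: measurable_funTS.
  - by move=> n x _; rewrite lee_fin normal_pdf_ge0.
have cv3 : (- (2 * s ^+ 2 * n.+1%:R * normal_pdf 0 s n.+1%:R))%R @[n --> \oo] --> (0 : R)%R.
  rewrite -[X in _ --> X]oppr0; apply: cvgN.
  (* From exp (- y) <= 1 / y with y = N^2 / (2 s^2), the boundary term 2 s^2 N pdf (N) is at most 4
     s^4 / N times the peak. *)
  pose K : R := (4 * s ^+ 4 * normal_peak s)%R.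
  apply: (@squeeze_cvgr _ _ _ _ (fun=> 0%R) (fun n => K * harmonic n)%R).
  - apply: nearW => n; rewrite !mulr_ge0 ?normal_pdf_ge0 ?(ltW s0)//=.
    rewrite /normal_pdf (negbTE sn0) /normal_fun subr0 /K /harmonic/=.
    set N : R := n.+1%:R; have N0 : (0 < N)%R by rewrite /N.
    set y := (N ^+ 2 / (s ^+ 2 *+ 2))%R.
    have y0 : (0 < y)%R by rewrite divr_gt0// ?exprn_gt0// mulrn_wgt0// exprn_gt0.
    have ey : (expR (- y) <= y^-1)%R.
      by rewrite expRN lef_pV2 ?posrE ?expR_gt0// (le_trans _ (expR_ge1Dx y))// lerDr.
    rewrite mulNr -/y.
    apply: (@le_trans _ _ (2 * s ^+ 2 * N * (normal_peak s * y^-1)))%R.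
      apply: ler_wpM2l; first by rewrite !mulr_ge0 ?(ltW N0) ?(ltW s0).
      by apply: ler_wpM2l => //; exact: normal_peak_ge0.
    rewrite le_eqVlt; apply/orP; left; apply/eqP; rewrite /y -mulr_natr.
    field; by rewrite sn0 gt_eqF.
  - exact: cvg_cst.
  - rewrite -(mulr0 K); apply: cvgM; [exact: cvg_cst|exact: cvg_harmonic].
have cv4 : \int[mu]_(x in F n) (x ^+ 2 * normal_pdf 0 s x)%:E @[n --> \oo] --> (s ^+ 2)%:E * 1 + 0%:E.
  under eq_fun do rewrite int_n.
  apply: cvgeD => //; first by apply: cvgeZl.
  exact: cvgn_EFin.
rewrite -(cvg_lim _ cv1)// (cvg_lim _ cv4)//.
by rewrite mule1 adde0.
Qed.

(** Integrability follows from |x| <= 1 + x^2. The density is even, so the positive and the negative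
    part have the same finite integral. *)
Lemma integral_normal_prob_id (s : R) : (0 < s)%R ->
  (normal_prob 0 s).-integrable setT (fun x : R => x%:E) /\
  \int[normal_prob 0 s]_x x%:E = 0.
Proof.
move=> s0; have sn0 : s != 0%R by rewrite gt_eqF.
have intn : (normal_prob 0 s).-integrable setT (fun x : R => x%:E).
  apply/integrableP; split; first exact/measurable_EFinP.
  apply: (@le_lt_trans _ _ (\int[normal_prob 0 s]_x (1 + (x ^+ 2)%:E))).
    apply: ge0_le_integral => //.
    - by apply: measurableT_comp => //; exact/measurable_EFinP.
    - apply: emeasurable_funD => //; apply: measurable_sqr_EFin => //.
    - move=> x _; rewrite /= -EFinD lee_fin ler_norml.
      have := sqr_ge0 (x - 1); have := sqr_ge0 (x + 1); rewrite !expr2; nra.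
  rewrite ge0_integralD//.
  - by rewrite integral_sqr_normal_prob// integral_cst//= probability_setT mul1e -EFinD ltry.
  - by move=> x _; rewrite lee_fin sqr_ge0.
  - exact: measurable_sqr_EFin.
split => //.
rewrite integralE.
have H (f : R -> R) : measurable_fun setT f -> (forall x, (0 <= f x)%R) ->
    \int[normal_prob 0 s]_x (f x)%:E = \int[normal_prob 0 s]_x (f (- x))%:E.
  move=> mf f0; rewrite !ge0_integral_normal_prob//; last exact: measurableT_comp.
  rewrite -(@integral_reflect _ 0 (fun x => (f x * normal_pdf 0 s x)%:E)).
  - apply: eq_integral => x _; rewrite sub0r; congr (_ * _)%:E.
    by rewrite /normal_pdf (negbTE sn0) /normal_fun !subr0 sqrrN.
  - by apply/measurable_EFinP; apply: measurable_funM => //; exact: measurable_normal_pdf.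
  - by move=> x; rewrite lee_fin mulr_ge0// normal_pdf_ge0.
rewrite (_ : \int[_]_x _ = \int[normal_prob 0 s]_x ((fun x : R => x%:E)^\- x)).
  rewrite subee// integrable_neg_fin_num//.
transitivity (\int[normal_prob 0 s]_x (Num.max x 0)%:E).
  by apply: eq_integral => x _; rewrite funeposE -EFin_max.
rewrite H//; last 2 first.
- by apply: measurable_maxr.
- by move=> x; rewrite le_max lexx orbT.
by apply: eq_integral => x _; rewrite funenegE -EFin_max.
Qed.

End normal_moments.

(** * Measurability with respect to a sub-sigma-algebra, and independence *)

Section measurable_wrt_theory.
Context (T : pointedType) (G : set (set T)).
Hypothesis sG : sigma_algebra setT G.

(** Passing to the same set equipped with the sigma-algebra [G] makes the closure properties of
    ordinary measurable functions available. *)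
Lemma measurable_wrtP (dd : measure_display) (S : measurableType dd) (f : T -> S) :
  measurable_wrt G f <-> measurable_fun setT (f : g_sigma_algebraType G -> S).
Proof.
have GE : <<s G >> = G := sigma_algebra_id sG.
split=> [Gf _ B mB|mf B mB].
  by rewrite setTI /measurable/= GE; exact: Gf.
by have := mf measurableT B mB; rewrite setTI /measurable/= GE.
Qed.

Lemma measurable_wrt_comp (d1 d2 : measure_display) (S1 : measurableType d1)
    (S2 : measurableType d2) (g : S1 -> S2) (f : T -> S1) :
  measurable_fun setT g -> measurable_wrt G f -> measurable_wrt G (g \o f).
Proof. by move=> mg /measurable_wrtP mf; apply/measurable_wrtP; exact: measurableT_comp. Qed.

Context (R : realType).
Implicit Types f g : T -> R.

Lemma measurable_wrt_cst (r : R) : measurable_wrt G (fun _ => r).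
Proof. by apply/measurable_wrtP; exact: measurable_cst. Qed.

Lemma measurable_wrtM f g : measurable_wrt G f -> measurable_wrt G g ->
  measurable_wrt G (fun w => f w * g w).
Proof. by move=> /measurable_wrtP mf /measurable_wrtP mg; apply/measurable_wrtP; exact: measurable_funM. Qed.

Lemma measurable_wrtD f g : measurable_wrt G f -> measurable_wrt G g ->
  measurable_wrt G (fun w => f w + g w).
Proof. by move=> /measurable_wrtP mf /measurable_wrtP mg; apply/measurable_wrtP; exact: measurable_funD. Qed.

Lemma measurable_wrtB f g : measurable_wrt G f -> measurable_wrt G g ->
  measurable_wrt G (fun w => f w - g w).
Proof. by move=> /measurable_wrtP mf /measurable_wrtP mg; apply/measurable_wrtP; exact: measurable_funB. Qed.

Lemma measurable_wrt_sum (I : Type) (r : seq I) (f : I -> T -> R) :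
  (forall i, measurable_wrt G (f i)) -> measurable_wrt G (fun w => \sum_(i <- r) f i w).
Proof.
by move=> mf; apply/measurable_wrtP; apply: measurable_sum => i; apply/measurable_wrtP.
Qed.

Lemma measurable_wrt_pointwise_lim (X : nat -> T -> R) :
  (forall k, measurable_wrt G (X k)) -> measurable_wrt G (pointwise_lim X).
Proof.
move=> mX; apply/measurable_wrtP.
by apply: (@measurable_pointwise_lim _ (g_sigma_algebraType G) R X) => k; apply/measurable_wrtP.
Qed.

End measurable_wrt_theory.

Lemma measurable_wrt_sub (T : Type) (G H : set (set T)) (dd : measure_display)
    (S : measurableType dd) (f : T -> S) :
  G `<=` H -> measurable_wrt G f -> measurable_wrt H f.
Proof. by move=> GH Gf B mB; apply: GH; exact: Gf. Qed.

Lemma measurable_wrt_fun d (T : measurableType d) (G : set (set T)) (dd : measure_display)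
    (S : measurableType dd) (f : T -> S) :
  G `<=` measurable -> measurable_wrt G f -> measurable_fun setT f.
Proof. by move=> GH Gf _ B mB; rewrite setTI; apply: GH; exact: Gf. Qed.

Section independence.
Local Open Scope ereal_scope.
Context d (T : measurableType d) (R : realType) (P : probability T R).
Variables (nu : probability (measurableTypeR R) R) (X : T -> R) (Y : T -> measurableTypeR R).
Hypotheses (mX : measurable_fun setT X) (mY : measurable_fun setT Y).
Hypothesis XY : forall (A : set R) (B : set (measurableTypeR R)), measurable A -> measurable B ->
  P (X @^-1` A `&` Y @^-1` B) = P (X @^-1` A) * nu B.

Let mX_mixin := isMeasurableFun.Build _ _ _ _ _ mX.
Let X' : {mfun _ >-> _} := HB.pack X mX_mixin.
Let mXY : measurable_fun setT (fun w => (X w, Y w)).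
Proof. exact: measurable_fun_pair. Qed.
Let mXY_mixin := isMeasurableFun.Build _ _ _ _ _ mXY.
Let XY' : {mfun _ >-> _} := HB.pack (fun w => (X w, Y w)) mXY_mixin.

(** The product formula on rectangles determines the joint law, by uniqueness of product
    measures. *)
Lemma product_law A : measurable A ->
  (distribution P X' \x nu) A = distribution P XY' A.
Proof.
by apply: product_measure_unique => // B C mB mC; rewrite /distribution /pushforward/= -XY.
Qed.

(** Fubini's theorem for the joint law. The law [nu] is kept separate from [Y], so that the
    integrals of [g] are computed directly against the normal law. *)
Lemma independent_product (g : measurableTypeR R -> R) : measurable_fun setT g ->
  P.-integrable setT (fun w => (X w)%:E) -> nu.-integrable setT (fun x => (g x)%:E) ->
  P.-integrable setT (fun w => (X w * g (Y w))%:E) /\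
  \int[P]_w (X w * g (Y w))%:E = (\int[P]_w (X w)%:E) * (\int[nu]_x (g x)%:E).
Proof.
move=> mg iX ig.
pose f (p : R * measurableTypeR R) : \bar R := (p.1 * g p.2)%:E.
have mf : measurable_fun setT f.
  apply/measurable_EFinP; apply: measurable_funM => //.
  by apply: (measurableT_comp mg); exact: measurable_snd.
have absX : \int[distribution P X']_x `|x%:E| < +oo.
  have /integrableP[_] := iX; apply: le_lt_trans.
  by rewrite ge0_integral_distribution//; apply: measurableT_comp => //; exact/measurable_EFinP.
have absg : \int[nu]_x `|(g x)%:E| < +oo by have /integrableP[] := ig.
have if' : (distribution P X' \x nu).-integrable setT f.
  apply/integrable12ltyP => //.
  rewrite (eq_integral (fun x : R => `|x%:E| * \int[nu]_y `|(g y)%:E|)).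
    rewrite ge0_integralZr//.
    - by rewrite lte_mul_pinfty//; [exact: integral_ge0|rewrite ge0_fin_numE//; exact: integral_ge0].
    - by apply: measurableT_comp => //; exact/measurable_EFinP.
    - exact: integral_ge0.
  move=> x _; rewrite -ge0_integralZl//.
  - by apply: eq_integral => y _; rewrite /f/= normrM.
  - by apply: measurableT_comp => //; exact/measurable_EFinP.
have mE : forall A, measurable A -> A `<=` setT -> (distribution P X' \x nu) A = distribution P XY' A.
  by move=> A mA _; exact: product_law.
have iXY : P.-integrable setT (f \o XY').
  have /integrableP[_ H] := if'; apply/integrableP; split; first exact: measurableT_comp.
  rewrite -(@ge0_integral_distribution _ _ _ _ _ P XY' (fun p => `|f p|))//.
    by rewrite -(eq_measure_integral _ mE).
  exact: measurableT_comp.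
split; first exact: iXY.
transitivity (\int[distribution P XY']_p f p).
  by rewrite integral_distribution.
rewrite -(eq_measure_integral _ mE) -integral12_prod_meas1//.
rewrite /fubini_F (eq_integral (fun x : R => x%:E * \int[nu]_y (g y)%:E)); last first.
  by move=> x _; rewrite -integralZl.
have gfin : \int[nu]_y (g y)%:E \is a fin_num by exact: integrable_fin_num.
rewrite -(fineK gfin) integralZr//; last first.
  by apply/integrableP; split => //; exact/measurable_EFinP.
by congr (_ * _); rewrite integral_distribution//; exact/measurable_EFinP.
Qed.

End independence.

Section has_integral.
Local Open Scope ereal_scope.
Context d (T : measurableType d) (R : realType) (m : {measure set T -> \bar R}).
Variables (D : set T) (mD : measurable D).
Implicit Types f g : T -> R.

(** Integrability and value travel together, so that finite linear combinations can be integrated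
    without separate side conditions. *)
Definition has_integral f (r : R) :=
  m.-integrable D (fun x => (f x)%:E) /\ \int[m]_(x in D) (f x)%:E = r%:E.

Lemma has_integral_ext f g r s : f =1 g -> r = s -> has_integral f r -> has_integral g s.
Proof. by move=> fg -> [i e]; rewrite (_ : g = f)//; apply/funext => x; rewrite fg. Qed.

Lemma has_integralD f g r s : has_integral f r -> has_integral g s ->
  has_integral (fun x => f x + g x)%R (r + s).
Proof.
move=> [if' ef] [ig eg]; split; first exact: (integrableD mD if' ig).
under eq_integral do rewrite EFinD.
by rewrite integralD// ef eg -EFinD.
Qed.

Lemma has_integralZ f r (k : R) : has_integral f r -> has_integral (fun x => k * f x)%R (k * r).
Proof.
move=> [if' ef]; split; first exact: (integrableZl mD k if').
by under eq_integral do rewrite EFinM; rewrite integralZl// ef -EFinM.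
Qed.

Lemma has_integral0 : has_integral (fun=> 0%R) 0.
Proof. by split; [exact: integrable0|rewrite integral0]. Qed.

Lemma has_integral_sum (I : Type) (s : seq I) (f : I -> T -> R) (r : I -> R) :
  (forall i, has_integral (f i) (r i)) ->
  has_integral (fun x => \sum_(i <- s) f i x)%R (\sum_(i <- s) r i)%R.
Proof.
move=> fr; elim: s => [|i s IH].
  by apply: has_integral_ext has_integral0 => [x|]; rewrite big_nil.
by apply: has_integral_ext (has_integralD (fr i) IH) => [x|]; rewrite big_cons.
Qed.

Lemma integrable_has_integral f : m.-integrable D (fun x => (f x)%:E) ->
  has_integral f (fine (\int[m]_(x in D) (f x)%:E)).
Proof. by move=> if'; split => //; rewrite fineK//; exact: integrable_fin_num. Qed.

End has_integral.

Section brownian_increments.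
Local Open Scope ereal_scope.
Context (dd : measure_display) (Omega : measurableType dd) (R : realType)
  (P : probability Omega R) (F : R -> set (set Omega)) (W : R -> Omega -> R).
Hypotheses (HF : complete_filtration P F) (HW : brownian_motion P F W).
Local Notation mean := (@has_integral _ _ _ P setT).
Local Notation inc s t w := (W t w - W s w)%R.

Definition bounded_fun (f : Omega -> R) := exists M : R, forall w, (`|f w| <= M)%R.

Lemma bounded_funM f g : bounded_fun f -> bounded_fun g -> bounded_fun (fun w => f w * g w)%R.
Proof.
move=> [M HM] [N HN]; exists (M * N)%R => w; rewrite normrM.
by apply: ler_pM.
Qed.

Lemma filtration_wrt_le s t (X : Omega -> R) : (0 <= s)%R -> (s <= t)%R ->
  measurable_wrt (F s) X -> measurable_wrt (F t) X.
Proof. by move=> s0 st; apply: measurable_wrt_sub; exact: (filtration_nondecreasing HF). Qed.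

Lemma filtration_fun s (X : Omega -> R) : (0 <= s)%R ->
  measurable_wrt (F s) X -> measurable_fun setT X.
Proof. by move=> s0; apply: measurable_wrt_fun; exact: (filtration_measurable HF). Qed.

Lemma measurable_inc_wrt s t : (0 <= s)%R -> (s <= t)%R ->
  measurable_wrt (F t) (fun w => inc s t w).
Proof.
move=> s0 st; apply: measurable_wrtB.
- exact: (filtration_sigma_algebra HF (le_trans s0 st)).
- exact: (brownian_adapted HW (le_trans s0 st)).
- exact: filtration_wrt_le (brownian_adapted HW s0).
Qed.

Lemma measurable_inc s t : (0 <= s)%R -> (s <= t)%R ->
  measurable_fun setT (fun w => inc s t w).
Proof.
by move=> s0 st; apply: (filtration_fun (le_trans s0 st)); exact: measurable_inc_wrt.
Qed.

Lemma bounded_integrable f : measurable_fun setT f -> bounded_fun f ->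
  P.-integrable setT (fun w => (f w)%:E).
Proof.
move=> mf [M HM]; apply: measurable_bounded_integrable => //.
  by rewrite /= probability_setT ltry.
exists M; split; first exact: num_real.
by move=> x Mx w _ /=; rewrite (le_trans (HM w))// ltW.
Qed.

Lemma bounded_integrableM f g : measurable_fun setT f -> bounded_fun f ->
  P.-integrable setT (fun w => (g w)%:E) ->
  P.-integrable setT (fun w => (f w * g w)%:E).
Proof.
move=> mf [M HM] ig; have mg : measurable_fun setT g by apply/measurable_EFinP; exact: measurable_int ig.
apply: (@le_integrable _ _ _ P setT measurableT _ (fun w => M%:E * (g w)%:E)).
- by apply/measurable_EFinP; exact: measurable_funM.
- move=> w _; rewrite -EFinM /= lee_fin !normrM ler_wpM2r// (le_trans (HM w))//.
  exact: ler_norm.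
- exact: integrableZl.
Qed.

Lemma increment_law s t A B : (0 <= s)%R -> (s < t)%R -> F s A -> measurable B ->
  P (A `&` (fun w => inc s t w) @^-1` B) = P A * normal_prob 0 (Num.sqrt (t - s)) B.
Proof.
move=> s0 st FA mB; rewrite (brownian_indep HW s0 st FA mB).
by rewrite (brownian_normal HW s0 st mB).
Qed.

(** What is known at time s is independent of the later increment, which has mean 0. The case s = t
    is treated apart because the law of an increment is prescribed for s < t only. *)
Lemma mean_mul_inc s t (Y : Omega -> R) : (0 <= s)%R -> (s <= t)%R ->
  measurable_wrt (F s) Y -> P.-integrable setT (fun w => (Y w)%:E) ->
  mean (fun w => Y w * inc s t w)%R 0.
Proof.
move=> s0; rewrite le_eqVlt => /predU1P[<- _ _|st FY iY].
  by apply: has_integral_ext (has_integral0 _ _) => // w; rewrite subrr mulr0.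
have sg : (0 < Num.sqrt (t - s))%R by rewrite sqrtr_gt0 subr_gt0.
have [in1 n1] := integral_normal_prob_id sg.
have [] := @independent_product _ _ _ P (normal_prob 0 (Num.sqrt (t - s))) Y
  (fun w => inc s t w) _ _ _ idfun _ iY in1.
- exact: filtration_fun FY.
- exact: measurable_inc (ltW st).
- by move=> A B mA mB; apply: increment_law => //; exact: FY.
- exact: measurable_id.
by move=> i e; split => //; rewrite e n1 mule0.
Qed.

Lemma mean_mul_sqr_inc s t (Y : Omega -> R) r : (0 <= s)%R -> (s <= t)%R ->
  measurable_wrt (F s) Y -> mean Y r ->
  mean (fun w => Y w * inc s t w ^+ 2)%R (r * (t - s)).
Proof.
move=> s0; rewrite le_eqVlt => /predU1P[<- _ _|st FY [iY eY]].
  by apply: has_integral_ext (has_integral0 _ _) => // [w|]; rewrite subrr ?expr0n mulr0.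
have sg : (0 < Num.sqrt (t - s))%R by rewrite sqrtr_gt0 subr_gt0.
have n2 := integral_sqr_normal_prob sg.
have in2 : (normal_prob 0 (Num.sqrt (t - s))).-integrable setT (fun x : R => (x ^+ 2)%:E).
  apply/integrableP; split; first by apply: measurable_sqr_EFin.
  by under eq_integral do rewrite gee0_abs ?lee_fin ?sqr_ge0//; rewrite n2 ltry.
have [] := @independent_product _ _ _ P (normal_prob 0 (Num.sqrt (t - s))) Y
  (fun w => inc s t w) _ _ _ (fun x => x ^+ 2)%R _ iY in2.
- exact: filtration_fun FY.
- exact: measurable_inc (ltW st).
- by move=> A B mA mB; apply: increment_law => //; exact: FY.
- exact: measurable_funX.
move=> i e; split => //; rewrite e n2 eY sqr_sqrtr -?EFinM//.
by rewrite subr_ge0 ltW.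
Qed.

Lemma integrable_inc s t : (0 <= s)%R -> (s <= t)%R ->
  P.-integrable setT (fun w => (inc s t w)%:E).
Proof.
move=> s0 st.
have [] // := @mean_mul_inc s t (fun=> 1%R) s0 st _ _.
- by apply: measurable_wrt_cst; exact: (filtration_sigma_algebra HF).
- by apply: bounded_integrable => //; exists 1%R => w; rewrite normr1.
- by move=> i _; apply: eq_integrable i => // w _; rewrite mul1r.
Qed.

(** The length of the intersection of ]a, b] and ]c, d], that is, the covariance of the two Brownian
    increments. *)
Definition overlap (a b c d : R) : R := Num.max 0%R (Num.min b d - Num.max a c)%R.

Definition elementary (a b : R) (xi : Omega -> R) :=
  [/\ (0 <= a)%R, (a <= b)%R, measurable_wrt (F a) xi & bounded_fun xi].

Lemma wrtM t (f g : Omega -> R) : (0 <= t)%R -> measurable_wrt (F t) f ->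
  measurable_wrt (F t) g -> measurable_wrt (F t) (fun w => f w * g w)%R.
Proof. by move=> t0; apply: measurable_wrtM; exact: (filtration_sigma_algebra HF). Qed.

(** The longer increment is split at b: the first piece produces the square of the common increment,
    the second is orthogonal to everything known at time b. *)
Lemma mean_common_start c b d (Y : Omega -> R) r :
  (0 <= c)%R -> (c <= b)%R -> (b <= d)%R ->
  measurable_wrt (F c) Y -> bounded_fun Y -> mean Y r ->
  mean (fun w => Y w * inc c b w * inc c d w)%R (r * (b - c)).
Proof.
move=> c0 cb bd FY bY Yr.
have H1 := mean_mul_sqr_inc c0 cb FY Yr.
have H2 : mean (fun w => (Y w * inc c b w) * inc b d w)%R 0.
  apply: mean_mul_inc => //; first exact: le_trans cb.
    apply: wrtM; first exact: le_trans cb.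
      exact: filtration_wrt_le FY.
    exact: measurable_inc_wrt.
  apply: bounded_integrableM => //; first exact: filtration_fun FY.
  exact: integrable_inc.
apply: has_integral_ext (has_integralD measurableT H1 H2) => [w|]; last by rewrite addr0.
by ring.
Qed.

(** The increment over ]a, b] is cut at c. Its part before c is known at time c and hence orthogonal
    to the increment over ]c, d]; the remaining part, if any, starts at c as the other increment
    does. *)
Lemma mean_elementary_le a b xi c d zeta r : (a <= c)%R ->
  elementary a b xi -> elementary c d zeta -> mean (fun w => xi w * zeta w)%R r ->
  mean (fun w => (xi w * inc a b w) * (zeta w * inc c d w))%R (r * overlap a b c d).
Proof.
move=> ac [a0 ab Fxi bxi] [c0 cd Fz bz] Er.
have Fxc : measurable_wrt (F c) xi by exact: filtration_wrt_le Fxi.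
have Fxz : measurable_wrt (F c) (fun w => xi w * zeta w)%R by exact: wrtM.
have bxz := bounded_funM bxi bz.
have mxz : measurable_fun setT (fun w => xi w * zeta w)%R by exact: filtration_fun Fxz.
have disj b' : (a <= b')%R -> (b' <= c)%R ->
    mean (fun w => xi w * zeta w * inc a b' w * inc c d w)%R 0.
  move=> ab' b'c; apply: mean_mul_inc => //.
    apply: wrtM => //; apply: (filtration_wrt_le _ b'c); first exact: le_trans ab'.
    exact: measurable_inc_wrt.
  by apply: bounded_integrableM => //; exact: integrable_inc.
have [bc|cb] := leP b c.
  have ov0 : overlap a b c d = 0%R.
    rewrite /overlap (max_r ac); apply/max_idPl.
    by rewrite subr_le0 (le_trans _ bc)// ge_min lexx.
  apply: has_integral_ext (disj b ab bc) => [w|]; last by rewrite ov0 mulr0.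
  by ring.
have H1 := disj c ac (lexx c).
have H2 : mean (fun w => xi w * zeta w * inc c b w * inc c d w)%R (r * overlap a b c d).
  rewrite /overlap (max_r ac).
  have [bd|db] := leP b d.
    rewrite max_r ?subr_ge0 ?(ltW cb)//.
    by apply: mean_common_start => //; exact: ltW.
  rewrite max_r ?subr_ge0//.
  apply: has_integral_ext (mean_common_start c0 cd (ltW db) Fxz bxz Er) => // w.
  by ring.
apply: has_integral_ext (has_integralD measurableT H1 H2) => [w|]; last by rewrite add0r.
by ring.
Qed.

Lemma mean_elementary a b xi c d zeta r :
  elementary a b xi -> elementary c d zeta -> mean (fun w => xi w * zeta w)%R r ->
  mean (fun w => (xi w * inc a b w) * (zeta w * inc c d w))%R (r * overlap a b c d).
Proof.
move=> h1 h2 Er; have [ac|ca] := leP a c; first exact: mean_elementary_le.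
have -> : overlap a b c d = overlap c d a b by rewrite /overlap minC (maxC a).
apply: has_integral_ext (mean_elementary_le (ltW ca) h2 h1 _) => // [w|]; first by rewrite mulrC.
by apply: has_integral_ext Er => // w; rewrite mulrC.
Qed.

Lemma has_integral_overlap T a b c d : (0 <= a)%R -> (b <= T)%R ->
  @has_integral _ _ _ (@lebesgue_measure R) `[0%R, T]
    (fun s => \1_(`]a, b]%classic) s * \1_(`]c, d]%classic) s)%R (overlap a b c d).
Proof.
move=> a0 bT.
have E (s : R) : (\1_(`]a, b]%classic) s * \1_(`]c, d]%classic) s =
    \1_(`](Num.max a c), (Num.min b d)]%classic) s :> R)%R.
  rewrite !indicE -natrM mulnb -in_setI; congr (_ \in _)%:R; apply/seteqP; split => x; rewrite /= !in_itv/= gt_max le_min.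
    by move=> [/andP[-> ->] /andP[-> ->]].
  by move=> /andP[/andP[-> ->] /andP[-> ->]].
have I : \int[lebesgue_measure]_(s in `[0%R, T])
    (\1_(`](Num.max a c), (Num.min b d)]%classic) s)%:E = (overlap a b c d)%:E.
  rewrite integral_indic//= setIidl; last first.
    move=> x; rewrite /= !in_itv/= gt_max le_min => /andP[/andP[ax _] /andP[xb _]].
    by rewrite (ltW (le_lt_trans a0 ax)) (le_trans xb).
  rewrite lebesgue_measure_itv/= lte_fin /overlap; case: ltP => h.
    have h' : (0 <= Num.min b d - Num.max a c)%R by rewrite subr_ge0 ltW.
    by rewrite -EFinB (max_r h').
  have h' : (Num.min b d - Num.max a c <= 0)%R by rewrite subr_le0.
  by rewrite (max_l h').
split; last by under eq_integral do rewrite E.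
apply/integrableP; split.
  by apply/measurable_EFinP; apply: measurable_funM; exact: measurable_indic.
under eq_integral do rewrite E gee0_abs ?lee_fin//.
by rewrite I ltry.
Qed.

(** Both sides expand into the double sum of E (xi_i xi_j) times the overlap of the two intervals.
    The intervals may overlap arbitrarily, so that families coming from different grids can be
    combined. *)
Lemma elementary_isometry (I : finType) (T : R) (a b : I -> R) (xi : I -> Omega -> R) :
  (forall i, elementary (a i) (b i) (xi i)) -> (forall i, (b i <= T)%R) ->
  \int[P]_w ((\sum_i xi i w * inc (a i) (b i) w) ^+ 2)%:E =
  \int[P]_w \int[lebesgue_measure]_(s in `[0%R, T])
    ((\sum_i xi i w * \1_(`]a i, b i]%classic) s) ^+ 2)%:E.
Proof.
move=> h bT.
pose e i j : R := fine (\int[P]_w (xi i w * xi j w)%:E).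
have a0 i : (0 <= a i)%R by have [] := h i.
have He i j : mean (fun w => xi i w * xi j w)%R (e i j).
  have [_ _ Fi bi] := h i; have [_ _ Fj bj] := h j.
  apply: integrable_has_integral => //; apply: bounded_integrable; last exact: bounded_funM.
  by apply: measurable_funM; [exact: filtration_fun (a0 i) Fi|exact: filtration_fun (a0 j) Fj].
pose o i j := overlap (a i) (b i) (a j) (b j).
have sq (f : I -> R) : ((\sum_i f i) ^+ 2 = \sum_i \sum_j f i * f j)%R.
  by rewrite expr2 big_distrlr.
transitivity (\sum_i \sum_j e i j * o i j)%:E.
  have [_] : mean (fun w => (\sum_i xi i w * inc (a i) (b i) w) ^+ 2)%R (\sum_i \sum_j e i j * o i j)%R; last by [].
  apply: has_integral_ext (has_integral_sum measurableT _ (fun i => has_integral_sum measurableT _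
     (fun j => mean_elementary (h i) (h j) (He i j)))) => // w.
  by rewrite sq.
have Hw w : @has_integral _ _ _ (@lebesgue_measure R) `[0%R, T]
    (fun s => (\sum_i xi i w * \1_(`]a i, b i]%classic) s) ^+ 2)%R
    (\sum_i \sum_j (xi i w * xi j w) * o i j)%R.
  have mT : measurable (`[0%R, T]%classic : set (measurableTypeR R)) by exact: measurable_itv.
  apply: has_integral_ext (has_integral_sum mT _ (fun i => has_integral_sum mT _
     (fun j => has_integralZ mT (xi i w * xi j w)%R
        (@has_integral_overlap T (a i) (b i) (a j) (b j) (a0 i) (bT i))))) => // s.
  by rewrite sq; apply: eq_bigr => i _; apply: eq_bigr => j _; ring.
have [_ <-] : mean (fun w => \sum_i \sum_j (xi i w * xi j w) * o i j)%R (\sum_i \sum_j e i j * o i j)%R.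
  apply: has_integral_sum => // i; apply: has_integral_sum => // j.
  by apply: has_integral_ext (has_integralZ measurableT (o i j) (He i j)) => [w|]; rewrite mulrC.
by apply: eq_integral => w _; have [_ ->] := Hw w.
Qed.

Lemma simple_process_elementary T H : simple_process_on F T H ->
  forall i : 'I_(sp_size H), elementary (sp_time H i) (sp_time H i.+1) (sp_coef H i) /\
    (sp_time H i.+1 <= T)%R.
Proof.
move=> [[t0 tT] tnd Fxi] i.
have t_ge0 j : (j <= sp_size H)%N -> (0 <= sp_time H j)%R.
  elim: j => // j IH jn; apply: (le_trans (IH (ltnW jn))); exact: tnd.
have t_le j k : (j + k <= sp_size H)%N -> (sp_time H j <= sp_time H (j + k)%N)%R.
  elim: k => [|k IH]; first by rewrite addn0.
  by rewrite addnS => jk; apply: (le_trans (IH (ltnW jk))); exact: tnd.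
split.
  have [? ?] := Fxi i (ltn_ord i); split => //; [exact/t_ge0/ltnW|exact: tnd].
have := t_le i.+1 (sp_size H - i.+1)%N; rewrite (subnKC (ltn_ord i)) => t_le'.
exact: le_trans (t_le' _) tT.
Qed.

(** The difference of the two processes is one family of terms indexed by the disjoint sum of their
    index sets, which avoids a common refinement of the grids. *)
Lemma simple_process_isometry T H K :
  simple_process_on F T H -> simple_process_on F T K ->
  \int[P]_w ((sp_integral W H w - sp_integral W K w) ^+ 2)%:E =
  \int[P]_w \int[lebesgue_measure]_(s in `[0%R, T]) ((sp_eval H s w - sp_eval K s w) ^+ 2)%:E.
Proof.
move=> /simple_process_elementary sH /simple_process_elementary sK.
pose I := ('I_(sp_size H) + 'I_(sp_size K))%type.
pose a (i : I) := match i with inl i => sp_time H i | inr j => sp_time K j end.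
pose b (i : I) := match i with inl i => sp_time H i.+1 | inr j => sp_time K j.+1 end.
pose xi (i : I) w := match i with inl i => sp_coef H i w | inr j => (- sp_coef K j w)%R end.
have := @elementary_isometry I T a b xi.
move=> /(_ _ _) iso.
rewrite [LHS](_ : _ = \int[P]_w ((\sum_i xi i w * inc (a i) (b i) w) ^+ 2)%:E).
  rewrite iso.
  - apply: eq_integral => w _; apply: eq_integral => s _; congr (_ ^+ 2)%:E.
    rewrite big_sumType/= /sp_eval -sumrN; congr (_ + _)%R; apply: eq_bigr => j _.
    by rewrite mulNr.
  - move=> [i|j]; first by have [] := sH i.
    have [[? ? ? [M HM]] _] := sK j; split => //; last by exists M => w /=; rewrite normrN.
    rewrite /xi/= -[X in measurable_wrt _ X]/(-%R \o sp_coef K j).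
    by apply: measurable_wrt_comp => //; exact: (filtration_sigma_algebra HF).
  - by move=> [i|j]; [have [] := sH i|have [] := sK j].
apply: eq_integral => w _; congr (_ ^+ 2)%:E.
rewrite big_sumType/= /sp_integral -sumrN; congr (_ + _)%R; apply: eq_bigr => j _.
by rewrite mulNr.
Qed.

End brownian_increments.

(** * Density of simple processes *)

Lemma cvge0_near_lt (R : realType) (u : nat -> \bar R) (e : R) : (0 < e)%R ->
  (u n @[n --> \oo] --> 0)%E -> \forall n \near \oo, (u n < e%:E)%E.
Proof.
move=> e0 /fine_cvgP[fu /cvgrPdist_lt/(_ e e0) h]; near=> n.
have fn : u n \is a fin_num by near: n.
rewrite -(fineK fn) lte_fin; apply: le_lt_trans (ler_norm _) _.
by rewrite -[fine _]opprK normrN -[X in `|X|]add0r; near: n.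
Unshelve. all: by end_near. Qed.

Section time_outcome.
Local Open Scope ereal_scope.
Context (dd : measure_display) (Omega : measurableType dd) (R : realType)
  (P : probability Omega R).
Local Notation mu := (@lebesgue_measure R).
Variables (D : set R) (mD : measurable D).

Lemma measurable_time_integral (g : R * Omega -> \bar R) :
  measurable_fun setT g -> (forall p, 0 <= g p) ->
  measurable_fun setT (fun w => \int[mu]_(s in D) g (s, w)).
Proof.
move=> mg g0.
apply: (@measurable_fun_integral_dom _ _ _ _ _ mu D mD (fun p : Omega * R => g (p.2, p.1))) => //.
by apply: measurableT_comp => //; exact: measurable_swap.
Qed.

Lemma measurable_mean (g : R * Omega -> \bar R) :
  measurable_fun setT g -> (forall p, 0 <= g p) ->
  measurable_fun setT (fun s : R => \int[P]_w g (s, w)).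
Proof. by move=> mg g0; exact: (@measurable_fun_integral_dom _ _ _ _ _ P setT measurableT g). Qed.

Lemma time_outcome_tonelli (g : R * Omega -> \bar R) :
  measurable_fun setT g -> (forall p, 0 <= g p) ->
  \int[P]_w \int[mu]_(s in D) g (s, w) = \int[mu]_(s in D) \int[P]_w g (s, w).
Proof.
move=> mg g0; apply/esym.
by rewrite (@domain_tonelli _ _ _ _ _ mu P D setT mD measurableT g).
Qed.

(** Dominated convergence used twice, in time along almost every path and then in the outcome; the
    exceptional set of times may depend on the path. *)
Lemma nested_dominated_convergence (g : nat -> R * Omega -> \bar R) (G : R * Omega -> \bar R) :
  (forall n, measurable_fun setT (g n)) -> (forall n p, 0 <= g n p) ->
  measurable_fun setT G -> (forall n p, g n p <= G p) ->
  \int[P]_w \int[mu]_(s in D) G (s, w) < +oo ->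
  (forall w, {ae mu, forall s, D s -> g n (s, w) @[n --> \oo] --> 0}) ->
  \int[P]_w \int[mu]_(s in D) g n (s, w) @[n --> \oo] --> 0.
Proof.
move=> mg g0 mG gG Gfin g_0.
have G0 p : 0 <= G p by exact: le_trans (g0 0%N p) (gG 0%N p).
have msec (h : R * Omega -> \bar R) w : measurable_fun setT h -> measurable_fun D (fun s : R => h (s, w)).
  by move=> mh; apply: measurable_funTS; apply: (measurableT_comp mh); exact: measurable_pair2.
have iG : P.-integrable setT (fun w => \int[mu]_(s in D) G (s, w)).
  apply/integrableP; split; first exact: measurable_time_integral.
  by under eq_integral do rewrite gee0_abs ?integral_ge0//.
have [] := @dominated_convergence _ _ _ P setT measurableT
  (fun n w => \int[mu]_(s in D) g n (s, w)) (cst 0) _ _ _ _ iG _.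
- by move=> n; exact: measurable_time_integral.
- exact: measurable_cst.
- have := integrable_ae measurableT iG; apply: filterS => w /(_ I) wfin _.
  have iGw : mu.-integrable D (fun s => G (s, w)).
    apply/integrableP; split; first exact: msec.
    under eq_integral do rewrite gee0_abs//.
    by rewrite -ge0_fin_numE ?integral_ge0.
  have [] := @dominated_convergence _ _ _ mu D mD (fun n s => g n (s, w)) (cst 0) _ _ _ _ iGw _.
  + by move=> n; exact: msec.
  + exact: measurable_cst.
  + exact: g_0.
  + by apply: aeW => s n _; rewrite gee0_abs.
  by move=> _ _; rewrite integral0.
- apply: aeW => w n _; rewrite gee0_abs ?integral_ge0//.
  by apply: ge0_le_integral => //; exact: msec.
by move=> _ _; rewrite integral0.
Qed.

Lemma mean_sqrB_le (f g h : R -> Omega -> R) :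
  measurable_fun setT (fun p : R * Omega => f p.1 p.2) ->
  measurable_fun setT (fun p : R * Omega => g p.1 p.2) ->
  measurable_fun setT (fun p : R * Omega => h p.1 p.2) ->
  \int[P]_w \int[mu]_(s in D) ((f s w - g s w) ^+ 2)%:E <=
  2%:E * \int[P]_w \int[mu]_(s in D) ((f s w - h s w) ^+ 2)%:E +
  2%:E * \int[P]_w \int[mu]_(s in D) ((h s w - g s w) ^+ 2)%:E.
Proof.
move=> mf mg mh.
have mB (a b : R -> Omega -> R) : measurable_fun setT (fun p : R * Omega => a p.1 p.2) ->
    measurable_fun setT (fun p : R * Omega => b p.1 p.2) ->
    measurable_fun setT (fun w => \int[mu]_(s in D) ((a s w - b s w) ^+ 2)%:E).
  move=> ma mb; apply: (@measurable_time_integral (fun p : R * Omega => ((a p.1 p.2 - b p.1 p.2) ^+ 2)%:E)).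
    by apply: measurable_sqr_EFin => //; exact: measurable_funB.
  by move=> p; rewrite lee_fin sqr_ge0.
have sec (a : R -> Omega -> R) w : measurable_fun setT (fun p : R * Omega => a p.1 p.2) ->
    measurable_fun D (a ^~ w).
  by move=> ma; apply: measurable_funTS; apply: (measurableT_comp ma (measurable_pair2 w)).
rewrite -!ge0_integralZl//; [|exact: mB|by move=> w _; exact: integral_sqr_ge0|
  exact: mB|by move=> w _; exact: integral_sqr_ge0].
rewrite -ge0_integralD//.
- apply: ge0_le_integral => //.
  + by move=> w _; exact: integral_sqr_ge0.
  + exact: mB.
  + by apply: emeasurable_funD; apply: measurable_funeM; exact: mB.
  + by move=> w _; apply: integral_sqrB_le => //; exact: sec.
- by move=> w _; rewrite mule_ge0// integral_sqr_ge0.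
- by apply: measurable_funeM; exact: mB.
- by move=> w _; rewrite mule_ge0// integral_sqr_ge0.
- by apply: measurable_funeM; exact: mB.
Qed.

End time_outcome.

Section left_average.
Local Open Scope ereal_scope.
Context {R : realType}.
Local Notation mu := (@lebesgue_measure R).

(** The window lies before [s] because an adapted approximation may look at past values only; the
    division by [de] is left to the users. *)
Definition left_osc (g : R -> R) (de s : R) : \bar R :=
  \int[mu]_(r in `[(s - de)%R, s[) ((g r - g s) ^+ 2)%:E.

Lemma left_osc_ge0 g de s : 0 <= left_osc g de s.
Proof. exact: integral_sqr_ge0. Qed.

Lemma left_osc_le (g : R -> R) (N de s : R) : measurable_fun setT g ->
  (forall r, (`|g r| <= N)%R) -> (0 <= de)%R -> left_osc g de s <= (4 * N ^+ 2 * de)%:E.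
Proof.
move=> mg gN de0.
apply: (@le_trans _ _ (\int[mu]_(r in `[(s - de)%R, s[) (cst (4 * N ^+ 2)%:E r))).
  apply: ge0_le_integral => //.
  - by move=> r _; rewrite lee_fin sqr_ge0.
  - by apply: measurable_funTS; apply: measurable_sqr_EFin => //; exact: measurable_funB.
  - move=> r _; rewrite lee_fin; have := gN r; have := gN s; rewrite !ler_norml.
    by move=> /andP[? ?] /andP[? ?]; rewrite !expr2; nra.
rewrite integral_cst//= lebesgue_measure_itv/= lte_fin; case: ifPn => _.
  by rewrite -EFinB -EFinM lee_fin; apply: ler_wpM2l; [rewrite mulr_ge0// sqr_ge0|lra].
rewrite mule0 lee_fin; apply: mulr_ge0 => //; apply: mulr_ge0 => //; exact: sqr_ge0.
Qed.

(** Lebesgue differentiation at almost every s, since (g r - g s)^2 <= 2 N |g r - g s|. The window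
    lies in the ball of radius 2 de, whose measure 4 de turns the factor 2 N into 8 N. *)
Lemma cvg_left_osc (g : R -> R) (N T : R) : (0 < T)%R -> measurable_fun setT g ->
  (forall r, (`|g r| <= N)%R) -> (forall r, ~~ (0 <= r <= T)%R -> g r = 0%R) ->
  {ae mu, forall s, (T / n.+1%:R)^-1%:E * left_osc g (T / n.+1%:R)%R s @[n --> \oo] --> 0}.
Proof.
move=> T0 mg gN gT.
have N0 : (0 <= N)%R by exact: le_trans (normr_ge0 _) (gN 0%R).
have gE : g = (g \_ `[0%R, T]%classic)%R.
  by apply/funext => r; rewrite patchE mem_setE/= in_itv/=; case: ifPn => // /gT.
have lg : locally_integrable setT g.
  rewrite gE; apply: integrable_locally => //.
  apply: measurable_bounded_integrable => //.
  - by rewrite /= lebesgue_measure_itv/= lte_fin T0 -EFinB ltry.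
  - exact: measurable_funTS.
  - by exists N; split; [exact: num_real|move=> x Nx r _ /=; rewrite (le_trans (gN r))// ltW].
have := lebesgue_differentiation lg.
apply: filterS; first exact: (ae_filter_ringOfSetsType mu).
move=> s ls.
pose de n : R := (T / n.+1%:R)%R.
have de0 n : (0 < de n)%R by rewrite divr_gt0.
have cde : (2 * de n)%R @[n --> \oo] --> (0%R : R)^'+.
  move=> A [e /= e0 HA]; near_simpl; near=> n; apply: HA => /=; last by rewrite mulr_gt0.
  rewrite sub0r normrN ger0_norm; last by rewrite mulr_ge0// ltW.
  rewrite /de mulrA ltr_pdivrMr// -ltr_pdivrMl//.
  by near: n; exists (Num.truncn (e^-1 * (2 * T))).+1 => // k /= hk;
     rewrite (lt_trans (truncnS_gt _))// ltr_nat ltnS.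
have cd : (8 * N)%:E * davg g s (2 * de n)%R @[n --> \oo] --> 0.
  rewrite -[X in _ --> X](mule0 (8 * N)%:E); apply: cvgeZl => //.
  apply: (cvg_comp (fun n => 2 * de n)%R (davg g s) cde); exact: ls.
apply: (@squeeze_cvge _ _ _ _ (cst 0) _ (fun n => (8 * N)%:E * davg g s (2 * de n)%R)) => //; last exact: cvg_cst.
apply: nearW => n; apply/andP; split.
  by rewrite /= mule_ge0 ?left_osc_ge0// lee_fin invr_ge0; exact: ltW (de0 n).
have mabs : measurable_fun setT (fun r => `|(center (g s) \o g) r|%:E).
  by apply/measurable_EFinP; apply: measurableT_comp => //; exact: measurable_funB.
have d2 : (0 <= 2 * de n)%R by apply: mulr_ge0 => //; exact: ltW (de0 n).
rewrite /davg /iavg lebesgue_measure_ball//.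
set J := \int[mu]_(y in ball s _) _.
have oJ : left_osc g (de n) s <= (2 * N)%:E * J.
  rewrite /J -ge0_integralZl//; last 3 first.
  - exact: measurable_ball.
  - exact: measurable_funTS.
  - by rewrite lee_fin mulr_ge0.
  apply: (@le_trans _ _ (\int[mu]_(r in `[(s - de n)%R, s[) ((2 * N)%:E * `|(center (g s) \o g) r|%:E))).
    apply: ge0_le_integral => //.
    - by move=> r _; rewrite lee_fin sqr_ge0.
    - by apply: measurable_funTS; apply: measurable_sqr_EFin => //; exact: measurable_funB.
    - by apply: measurable_funTS; exact: measurable_funeM.
    - move=> r _; rewrite -EFinM lee_fin /= -real_normK ?num_real// expr2 ler_wpM2r//.
      by rewrite (le_trans (ler_normB _ _))// mulr_natl mulr2n lerD.
  apply: ge0_subset_integral => //.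
  - exact: measurable_ball.
  - by apply: measurable_funTS; exact: measurable_funeM.
  - by move=> r _; rewrite -EFinM lee_fin !mulr_ge0.
  - move=> r; rewrite ball_itv /= !in_itv/= => /andP[h1 h2].
    by move: (de0 n) h1 h2; set d := de n => d0 h1 h2; apply/andP; split; lra.
rewrite inver mulrn_eq0/= mulf_eq0 !gt_eqF//=.
have dn0 : 0 <= ((de n)^-1)%R%:E by rewrite lee_fin invr_ge0 ltW.
apply: (le_trans (lee_wpmul2l dn0 oJ)); rewrite !muleA -!EFinM.
suff -> : ((de n)^-1 * (2 * N) = 8 * N / (2 * de n *+ 2))%R by [].
move: (de0 n); set d := de n => d0; rewrite -mulr_natr.
by field; rewrite gt_eqF.
Unshelve. all: by end_near. Qed.

End left_average.

Section shifted_grid.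
Local Open Scope ereal_scope.
Context {R : realType}.
Local Notation mu := (@lebesgue_measure R).

Lemma sum_disjoint_cells_le1 (de x : R) n : (0 < de)%R ->
  (\sum_(i < n) (\1_(`[(i%:R * de - de)%R, (i%:R * de)%R[%classic) x : R) <= 1)%R.
Proof.
move=> de0; have [[i hi]|hn] := pselect (exists i : 'I_n, (i%:R * de - de <= x < i%:R * de)%R).
  rewrite (bigD1 i)//= big1 ?addr0; first by rewrite indicE; case: (_ \in _).
  move=> j ji; rewrite indicE memNset// /= in_itv/= => hj.
  move: hi hj => /andP[h1 h2] /andP[h3 h4].
  have ij : (i%:R * de < j%:R * de + de)%R by lra.
  have ij' : (j%:R * de < i%:R * de + de)%R by lra.
  have lt_nat (a b : nat) : (a%:R * de < b%:R * de + de)%R -> (a <= b)%N.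
    by rewrite -[X in (_ < _ + X)%R]mul1r -mulrDl natr1 ltr_pM2r// ltr_nat ltnS.
  by move: ji; rewrite -val_eqE/= eqn_leq (lt_nat _ _ ij) (lt_nat _ _ ij').
rewrite big1// => i _; rewrite indicE memNset// /= in_itv/= => hi.
by apply: hn; exists i.
Qed.

(* Averaging over the offset of a grid: the cells of width de tile the line. *)
Lemma integral_shifted_grid_le (h : R -> \bar R) (de : R) n : (0 < de)%R ->
  measurable_fun setT h -> (forall x, 0 <= h x) ->
  \int[mu]_(th in `[0%R, de[) \sum_(i < n) h (i%:R * de - de + th)%R <= \int[mu]_x h x.
Proof.
move=> de0 mh h0.
have mhs (c : R) : measurable_fun setT (fun th : R => h (c + th)%R).
  by apply: measurableT_comp => //; exact: measurable_funD.
rewrite ge0_integral_sum//; last by move=> i; exact: measurable_funTS (mhs _).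
pose ind (i : nat) (x : R) : \bar R := (\1_(`[(i%:R * de - de)%R, (i%:R * de)%R[%classic) x)%:E.
have mind i : measurable_fun setT (ind i) by exact/measurable_EFinP/measurable_indic.
have ind0 i x : 0 <= ind i x by rewrite lee_fin.
have E (i : 'I_n) : \int[mu]_(th in `[0%R, de[) h (i%:R * de - de + th)%R =
    \int[mu]_x (ind i x * h x).
  rewrite -(@integral_shift _ (i%:R * de - de)%R (fun x => ind i x * h x)).
  - rewrite integral_mkcond; apply: eq_integral => x _; rewrite patchE mem_setE/= in_itv/=.
    rewrite /ind indicE mem_setE/= in_itv/= addrC.
    have -> : (i%:R * de - de <= x + (i%:R * de - de) < i%:R * de)%R = (0 <= x < de)%R.
      by apply/idP/idP => /andP[? ?]; apply/andP; split; lra.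
    by case: ifPn => _; rewrite ?mul1e ?mul0e.
  - exact: emeasurable_funM.
  - by move=> x; rewrite mule_ge0.
rewrite (eq_bigr _ (fun i _ => E i)) -ge0_integral_sum//; last 2 first.
- by move=> i; apply: emeasurable_funM; [exact: mind|exact: mh].
- by move=> i x _; rewrite mule_ge0.
apply: ge0_le_integral => //.
- by move=> x _; apply: sume_ge0 => i _; rewrite mule_ge0.
- by apply: emeasurable_sum => i; apply: emeasurable_funM; [exact: mind|exact: mh].
move=> x _; rewrite -ge0_sume_distrl; last by move=> i _; exact: ind0.
rewrite -[leRHS]mul1e lee_wpmul2r// sumEFin lee_fin.
exact: sum_disjoint_cells_le1.
Qed.

End shifted_grid.

Section density.
Local Open Scope ereal_scope.
Context (dd : measure_display) (Omega : measurableType dd) (R : realType)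
  (P : probability Omega R) (F : R -> set (set Omega)).
Hypothesis HF : complete_filtration P F.
Local Notation mu := (@lebesgue_measure R).

(* f is only measurable and adapted, so its values at fixed grid points need not
   represent it; a good offset th of the grid is found by averaging. *)
Definition grid_process (f : R -> Omega -> R) (T : R) (n : nat) (th : R) :
    simple_process R Omega :=
  SimpleProcess n.+1 (fun j => Num.min (j%:R * (T / n.+1%:R) + th) T)%R
    (fun j w => f (j%:R * (T / n.+1%:R) + th)%R w).

Lemma measurable_sp_eval T H : simple_process_on F T H ->
  measurable_fun setT (fun p : R * Omega => sp_eval H p.1 p.2).
Proof.
move=> sH; have el := simple_process_elementary sH.
apply: measurable_sum => i; apply: measurable_funM.
  have [[t0 _ Fx _] _] := el i.
  by apply: (measurableT_comp (filtration_fun HF t0 Fx)); exact: measurable_snd.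
have mi : measurable_fun setT (\1_(`]sp_time H i, sp_time H i.+1]%classic) : R -> R).
  by apply: measurable_indic; exact: measurable_itv.
by apply: (measurableT_comp mi); exact: measurable_fst.
Qed.

Section bounded.
Variables (f : R -> Omega -> R) (T N : R).
Hypotheses (T0 : (0 < T)%R).
Hypothesis mf : measurable_fun setT (fun p : R * Omega => f p.1 p.2).
Hypothesis af : forall s, (0 <= s)%R -> (s <= T)%R -> measurable_wrt (F s) (f s).
Hypothesis fN : forall s w, (`|f s w| <= N)%R.
Hypothesis fT : forall s w, ~~ (0 <= s <= T)%R -> f s w = 0%R.

Local Notation de n := (T / n.+1%:R)%R.

Let de0 n : (0 < de n)%R. Proof. by rewrite divr_gt0. Qed.

Let deT n : (n.+1%:R * de n = T)%R.
Proof. by rewrite mulrC divfK. Qed.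

Lemma grid_process_on n th : (0 <= th < de n)%R -> simple_process_on F T (grid_process f T n th).
Proof.
move=> /andP[th0 th1].
have jT j : (j < n.+1)%N -> (j%:R * de n + th <= T)%R.
  move=> jn; apply: (@le_trans _ _ (j.+1%:R * de n)%R).
    by rewrite -[j.+1%:R]natr1 mulrDl mul1r lerD2l ltW.
  by rewrite -[leRHS](deT n) ler_pM2r// ler_nat.
split => /=.
- split; last by rewrite ge_min lexx orbT.
  by rewrite le_min mul0r add0r th0 ltW.
- move=> j jn; rewrite le_min ge_min ge_min lexx orbT andbT.
  by rewrite lerD2r ler_pM2r// ler_nat leqnSn.
- move=> j jn; rewrite min_l ?jT//; split; last by exists N.
  by apply: af; [rewrite addr_ge0// mulr_ge0// ltW|exact: jT].
Qed.

(** The value at s is that of [f] at the last grid point before s. For s <= th there is none and the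
    process vanishes; the index i = 0 then stands for the point th - de < 0, where [f] is 0. This
    explains the shift by de and the n + 2 indices. *)
Lemma grid_process_eval n th s w : (0 <= th < de n)%R -> (0 < s <= T)%R ->
  exists2 i : 'I_n.+2, (s - de n <= i%:R * de n - de n + th < s)%R &
    sp_eval (grid_process f T n th) s w = f (i%:R * de n - de n + th) w.
Proof.
move=> /andP[th0 th1] /andP[s0 sT].
pose p (i : nat) := (s <= i%:R * de n + th)%R.
have ex_p : exists i, p i by exists n.+1; rewrite /p deT (le_trans sT)// lerDl.
have [i pi mini] := ex_minnP ex_p.
have in2 : (i < n.+2)%N by rewrite ltnS; apply: mini; rewrite /p deT (le_trans sT)// lerDl.
have lt_s : (i%:R * de n - de n + th < s)%R.
  case: i pi mini in2 => [|i] pi mini in2; first by rewrite mul0r sub0r addrC; apply: lt_trans s0; rewrite subr_lt0.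
  have : ~~ p i by apply/negP => /mini; rewrite ltnn.
  by rewrite /p -ltNge -[i.+1%:R]natr1 mulrDl mul1r addrK.
exists (Ordinal in2) => /=.
  by apply/andP; split => //; move: pi; rewrite /p; move: (i%:R * de n)%R (de n) => a b; lra.
have notin (u v : R) : ((s <= u) || (v < s))%R -> \1_(`]u, v]%classic) s = 0%R :> R.
  move=> huv; rewrite indicE memNset//= in_itv/= => /andP[us sv].
  by move: huv; rewrite leNgt us/= ltNge sv.
case: i pi mini in2 lt_s => [|i] pi mini in2 lt_s.
  rewrite /sp_eval big1 => [|j _].
    rewrite mul0r sub0r fT//; apply/negP => /andP[h _].
    by move: h th1; move: (de n) => d; lra.
  rewrite /= notin ?mulr0// le_min sT andbT; apply/orP; left.
  move: pi; rewrite /p mul0r add0r => h; apply: (le_trans h); rewrite lerDr; apply: mulr_ge0 => //; exact: ltW (de0 n).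
have in1 : (i < n.+1)%N by [].
rewrite /sp_eval (bigD1 (Ordinal in1))//= big1 => [|j ji].
  rewrite addr0 indicE mem_set; first by rewrite mulr1 -[i.+1%:R]natr1 mulrDl mul1r addrK.
  rewrite /= in_itv/= le_min sT andbT; apply/andP; split => //.
  by rewrite gt_min; apply/orP; left; move: lt_s; rewrite -[i.+1%:R]natr1 mulrDl mul1r addrK.
rewrite notin ?mulr0//; have [ij|ij] := ltnP i j.
  apply/orP; left; rewrite le_min sT andbT (le_trans pi)// lerD2r ler_pM2r// ler_nat.
  by [].
have {}ij : (j < i)%N by rewrite ltn_neqAle ij andbT.
apply/orP; right; rewrite gt_min; apply/orP; left; apply: le_lt_trans lt_s.
by rewrite -[i.+1%:R]natr1 mulrDl mul1r addrK lerD2r ler_pM2r// ler_nat.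
Qed.

(** The index of the cell containing s depends on s and th. Summing over all indices, with the
    indicator of the window to select the right one, gives a bound whose dependence on th is visibly
    measurable. *)
Lemma grid_process_sqr_le n th s w : (0 <= th < de n)%R -> (0 < s <= T)%R ->
  ((f s w - sp_eval (grid_process f T n th) s w) ^+ 2)%:E <=
  \sum_(i < n.+2) ((\1_(`[(s - de n)%R, s[%classic) (i%:R * de n - de n + th) *
     (f (i%:R * de n - de n + th) w - f s w) ^+ 2)%R)%:E.
Proof.
move=> hth hs; have [i hi ->] := grid_process_eval w hth hs.
rewrite (bigD1 i)//= -[leLHS]adde0; apply: leeD.
  by rewrite indicE mem_set/= ?in_itv// mul1r -sqrrN opprB.
by apply: sume_ge0 => j _; rewrite lee_fin mulr_ge0// sqr_ge0.
Qed.

Let osc de (x : (R * Omega) * R) : \bar R :=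
  (\1_(`[(x.1.1 - de)%R, x.1.1[%classic) x.2 * (f x.2 x.1.2 - f x.1.1 x.1.2) ^+ 2)%:E.

Let osc0 d x : 0 <= osc d x.
Proof. by rewrite lee_fin mulr_ge0// sqr_ge0. Qed.

Let mosc d : measurable_fun setT (osc d).
Proof.
have m11 : measurable_fun setT (fun x : (R * Omega) * R => x.1.1).
  by apply: measurableT_comp; [exact: measurable_fst|exact: measurable_fst].
have m12 : measurable_fun setT (fun x : (R * Omega) * R => x.1.2).
  by apply: measurableT_comp; [exact: measurable_snd|exact: measurable_fst].
have m2 : measurable_fun setT (fun x : (R * Omega) * R => x.2) by exact: measurable_snd.
apply/measurable_EFinP; apply: measurable_funM.
  pose b (x : (R * Omega) * R) := ((x.1.1 - d <= x.2) && (x.2 < x.1.1))%R.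
  rewrite (_ : (fun x => _) = (fun x => if b x then 1%R else 0%R)); last first.
    by apply/funext => x; rewrite indicE mem_setE/= in_itv/= /b; case: (_ && _).
  apply: measurable_fun_ifT => //; apply: measurable_and.
    by apply: measurable_fun_ler => //; exact: measurable_funB.
  exact: measurable_fun_ltr.
apply: measurable_funX; apply: measurable_funB.
  exact: (measurableT_comp mf (measurable_fun_pair m2 m12)).
exact: (measurableT_comp mf (measurable_fun_pair m11 m12)).
Qed.

Let left_oscE d s w : \int[mu]_r osc d ((s, w), r) = left_osc (f ^~ w) d s.
Proof.
rewrite /left_osc [RHS]integral_mkcond; apply: eq_integral => r _.
rewrite patchE mem_setE/= in_itv/= /osc/= indicE mem_setE/= in_itv/=.
by case: ifPn => _; rewrite ?mul1r ?mul0r.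
Qed.

(** The normalised oscillation is bounded by 4 N^2, which carries the convergence along each path
    over to the double integral. *)
Lemma cvg_mean_left_osc :
  \int[P]_w \int[mu]_(s in `[0%R, T]) ((de n)^-1%:E * left_osc (f ^~ w) (de n) s) @[n --> \oo] --> 0.
Proof.
pose g n (p : R * Omega) := (de n)^-1%:E * left_osc (f ^~ p.2) (de n) p.1.
have idn n : (0 <= (de n)^-1)%R by rewrite invr_ge0 ltW.
have mfw w : measurable_fun setT (f ^~ w).
  exact: (measurableT_comp mf (measurable_pair2 w)).
have g0 n p : 0 <= g n p by rewrite mule_ge0 ?lee_fin ?left_osc_ge0.
apply: (@nested_dominated_convergence _ _ _ P _ _ g (cst (4 * N ^+ 2)%:E)) => //.
- move=> n; apply: measurable_funeM.
  rewrite (_ : (fun p => _) = (fun p : R * Omega => \int[mu]_r osc (de n) (p, r))).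
    by apply: (@measurable_fun_integral_dom _ _ _ _ _ mu setT measurableT (osc (de n))); [exact: mosc|exact: osc0].
  by apply/funext => -[s w]; rewrite left_oscE.
- move=> n p; have idn' : 0 <= ((de n)^-1)%:E by rewrite lee_fin.
  have := lee_wpmul2l idn' (@left_osc_le _ _ N (de n) p.1 (mfw p.2) (fun r => fN r p.2) (ltW (de0 n))).
  move=> /le_trans; apply; rewrite -EFinM lee_fin /= mulrCA mulVf ?mulr1//.
  by rewrite gt_eqF.
- rewrite (eq_integral (cst (4 * N ^+ 2 * T)%:E)).
    by rewrite integral_cst//= probability_setT mule1 ltry.
  move=> w _; rewrite integral_cst//= lebesgue_measure_itv/= lte_fin T0.
  by rewrite -EFinB -EFinM subr0.
- move=> w; have := @cvg_left_osc _ (f ^~ w) N T T0 (mfw w) (fun s => fN s w) (fun s => @fT s w).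
  apply: filterS; first exact: (ae_filter_ringOfSetsType mu).
  by move=> s cs _; exact: cs.
Qed.

Let grid_osc n (x : (R * Omega) * R) : \bar R :=
  \sum_(i < n.+2) osc (de n) ((x.2, x.1.2), (i%:R * de n - de n + x.1.1)%R).

Let mgrid_osc n : measurable_fun setT (grid_osc n).
Proof.
apply: emeasurable_sum => i.
have m11 : measurable_fun setT (fun x : (R * Omega) * R => x.1.1).
  by apply: measurableT_comp; [exact: measurable_fst|exact: measurable_fst].
have m12 : measurable_fun setT (fun x : (R * Omega) * R => x.1.2).
  by apply: measurableT_comp; [exact: measurable_snd|exact: measurable_fst].
have m2 : measurable_fun setT (fun x : (R * Omega) * R => x.2) by exact: measurable_snd.
have m3 : measurable_fun setT (fun x : (R * Omega) * R => i%:R * de n - de n + x.1.1)%R.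
  exact: measurable_funD.
exact: (measurableT_comp (mosc (de n)) (measurable_fun_pair (measurable_fun_pair m2 m12) m3)).
Qed.

Let grid_osc0 n x : 0 <= grid_osc n x.
Proof. by apply: sume_ge0 => i _; exact: osc0. Qed.

(** With s and w fixed and th integrated first, [integral_shifted_grid_le] applies to the
    oscillation in the window before s. *)
Lemma mean_grid_osc_le n :
  \int[mu]_(th in `[0%R, de n[) \int[P]_w \int[mu]_(s in `[0%R, T]) grid_osc n ((th, w), s) <=
  (de n)%:E * \int[P]_w \int[mu]_(s in `[0%R, T]) ((de n)^-1%:E * left_osc (f ^~ w) (de n) s).
Proof.
have mg1 : measurable_fun setT (fun p : R * Omega => \int[mu]_(s in `[0%R, T]) grid_osc n (p, s)).
  by apply: (@measurable_fun_integral_dom _ _ _ _ _ mu _ _ (grid_osc n)); [exact: measurable_itv|exact: mgrid_osc|exact: grid_osc0].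
have mlo : measurable_fun setT (fun p : R * Omega => left_osc (f ^~ p.2) (de n) p.1).
  rewrite (_ : (fun p => _) = (fun p : R * Omega => \int[mu]_r osc (de n) (p, r))).
    by apply: (@measurable_fun_integral_dom _ _ _ _ _ mu setT measurableT (osc (de n))); [exact: mosc|exact: osc0].
  by apply/funext => -[s w]; rewrite left_oscE.
have mlow w : measurable_fun setT (fun s : R => left_osc (f ^~ w) (de n) s).
  exact: (measurableT_comp mlo (measurable_pair2 w)).
rewrite (@domain_tonelli _ _ _ _ _ mu P _ setT _ measurableT
   (fun p : R * Omega => \int[mu]_(s in `[0%R, T]) grid_osc n (p, s))) => [|//|//|p]; last first.
  by apply: integral_ge0 => s _; exact: grid_osc0.
have mT2 : measurable_fun setT (fun w => \int[mu]_(s in `[0%R, T]) ((de n)^-1%:E * left_osc (f ^~ w) (de n) s)).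
  apply: (@measurable_time_integral _ _ _ _ _ (fun p : R * Omega => (de n)^-1%:E * left_osc (f ^~ p.2) (de n) p.1)) => //.
  + exact: measurable_funeM.
  + by move=> p; rewrite mule_ge0 ?lee_fin ?invr_ge0 ?left_osc_ge0// ltW.
have i0 w s : 0 <= (de n)^-1%:E * left_osc (f ^~ w) (de n) s.
  by rewrite mule_ge0 ?lee_fin ?invr_ge0 ?left_osc_ge0// ltW.
rewrite -ge0_integralZl//; last 2 first.
- by move=> w _; apply: integral_ge0 => s _.
- by rewrite lee_fin ltW.
apply: ge0_le_integral => //.
- by move=> w _; apply: integral_ge0 => th _; apply: integral_ge0 => s _; exact: grid_osc0.
- apply: (@measurable_time_integral _ _ _ _ _ (fun p : R * Omega => \int[mu]_(s in `[0%R, T]) grid_osc n (p, s))) => //.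
  by move=> p; apply: integral_ge0 => s _; exact: grid_osc0.
- exact: measurable_funeM.
move=> w _.
have mgw : measurable_fun setT (fun q : R * R => grid_osc n ((q.1, w), q.2)).
  have m1 : measurable_fun setT (fun q : R * R => q.1) by exact: measurable_fst.
  have m2 : measurable_fun setT (fun q : R * R => q.2) by exact: measurable_snd.
  have mw : measurable_fun setT (fun q : R * R => w) by exact: measurable_cst.
  exact: (measurableT_comp (mgrid_osc n) (measurable_fun_pair (measurable_fun_pair m1 mw) m2)).
rewrite (@domain_tonelli _ _ _ _ _ mu mu _ _ _ _
  (fun q : R * R => grid_osc n ((q.1, w), q.2)))//.
rewrite -ge0_integralZl//; last 2 first.
- by apply: measurable_funTS; apply: measurable_funeM; exact: mlow.
- by rewrite lee_fin ltW.
apply: ge0_le_integral => //.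
- by move=> s _; apply: integral_ge0 => th _; exact: grid_osc0.
- apply: measurable_funTS.
  apply: (@measurable_fun_integral_dom _ _ _ _ _ mu _ _ (fun q : R * R => grid_osc n ((q.2, w), q.1))) => //.
  have m1 : measurable_fun setT (fun q : R * R => q.1) by exact: measurable_fst.
  have m2 : measurable_fun setT (fun q : R * R => q.2) by exact: measurable_snd.
  have mw : measurable_fun setT (fun q : R * R => w) by exact: measurable_cst.
  exact: (measurableT_comp (mgrid_osc n) (measurable_fun_pair (measurable_fun_pair m2 mw) m1)).
- by apply: measurable_funTS; do 2 apply: measurable_funeM; exact: mlow.
move=> s _; rewrite muleA -EFinM divff ?mul1e ?gt_eqF// -left_oscE.
apply: (@integral_shifted_grid_le _ (fun r => osc (de n) ((s, w), r))) => //.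
exact: (measurableT_comp (mosc _) (measurable_pair1 (s, w))).
Qed.

(** If every offset in [0, de[ had an error above e, the integral over the offsets would be at least
    de * e, against [mean_grid_osc_le] for a sufficiently fine grid. *)
Lemma bounded_density (e : R) : (0 < e)%R -> exists2 H, simple_process_on F T H &
  \int[P]_w \int[mu]_(s in `[0%R, T]) ((f s w - sp_eval H s w) ^+ 2)%:E <= e%:E.
Proof.
move=> e0; have := cvg_mean_left_osc.
move=> /(cvge0_near_lt e0)[n _ /(_ n (leqnn n)) /=].
set A := \int[P]_w _ => An.
have mD : measurable_fun setT (fun th : R => \int[P]_w \int[mu]_(s in `[0%R, T]) grid_osc n ((th, w), s)).
  apply: (@measurable_mean _ _ _ P (fun p : R * Omega => \int[mu]_(s in `[0%R, T]) grid_osc n (p, s))).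
    by apply: (@measurable_fun_integral_dom _ _ _ _ _ mu _ _ (grid_osc n)); [exact: measurable_itv|exact: mgrid_osc|exact: grid_osc0].
  by move=> p; apply: integral_ge0 => s _; exact: grid_osc0.
have [th hth Dth] : exists2 th : R, (0 <= th < de n)%R &
    \int[P]_w \int[mu]_(s in `[0%R, T]) grid_osc n ((th, w), s) <= e%:E.
  apply: contrapT => H.
  have big th : (0 <= th < de n)%R -> e%:E <= \int[P]_w \int[mu]_(s in `[0%R, T]) grid_osc n ((th, w), s).
    by move=> hth; rewrite leNgt; apply/negP => h; apply: H; exists th; [exact: hth|exact: ltW].
  have : (de n * e)%:E <= (de n)%:E * A.
    apply: le_trans (mean_grid_osc_le n).
    apply: (@le_trans _ _ (\int[mu]_(th in `[0%R, de n[) cst e%:E th)).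
      rewrite integral_cst//= lebesgue_measure_itv/= lte_fin de0 -EFinB subr0 -EFinM.
      by rewrite lee_fin mulrC.
    apply: ge0_le_integral => //.
    - by move=> th _; rewrite lee_fin ltW.
    - exact: measurable_funTS mD.
  rewrite EFinM lee_pmul2l ?lte_fin//.
  by rewrite leNgt An.
have sg := grid_process_on hth.
exists (grid_process f T n th); first exact: sg.
apply: le_trans Dth.
have md : measurable_fun setT (fun p : R * Omega => ((f p.1 p.2 - sp_eval (grid_process f T n th) p.1 p.2) ^+ 2)%:E).
  by apply: measurable_sqr_EFin => //; apply: measurable_funB => //; exact: measurable_sp_eval sg.
have mgt : measurable_fun setT (fun p : R * Omega => grid_osc n ((th, p.2), p.1)).
  have m1 : measurable_fun setT (fun q : R * Omega => q.1) by exact: measurable_fst.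
  have m2 : measurable_fun setT (fun q : R * Omega => q.2) by exact: measurable_snd.
  have mth : measurable_fun setT (fun q : R * Omega => th) by exact: measurable_cst.
  exact: (measurableT_comp (mgrid_osc n) (measurable_fun_pair (measurable_fun_pair mth m2) m1)).
have mdw w := measurableT_comp md (measurable_pair2 w).
have mgw w := measurableT_comp mgt (measurable_pair2 w).
apply: ge0_le_integral => //.
- by move=> w _; exact: integral_sqr_ge0.
- apply: (@measurable_time_integral _ _ _ _ _ _ md) => //.
  by move=> p; rewrite lee_fin sqr_ge0.
- exact: (@measurable_time_integral _ _ _ _ _ _ mgt).
(* The single time s = 0 is dropped: the estimate on the grid holds for s > 0. *)
move=> w _; rewrite -integral_itv_obnd_cbnd; last exact: measurable_funTS (mdw w).
apply: (@le_trans _ _ (\int[mu]_(s in `]0%R, T]) grid_osc n ((th, w), s))).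
  apply: ge0_le_integral => //.
  - by move=> s _; rewrite lee_fin sqr_ge0.
  - exact: measurable_funTS (mdw w).
  - exact: measurable_funTS (mgw w).
  - by move=> s; rewrite /= in_itv/= => hs; exact: grid_process_sqr_le.
apply: ge0_subset_integral => //.
- exact: measurable_funTS (mgw w).
- by move=> s; rewrite /= !in_itv/= => /andP[/ltW -> ->].
Qed.

End bounded.

(** Truncation at the levels -n and n reduces the claim to bounded integrands: each truncated value
    is eventually the original one, and the error is dominated by the square of the integrand. The
    case T = 0 is separate since a grid needs a positive mesh. *)
Lemma simple_process_density (f : R -> Omega -> R) (T e : R) : (0 <= T)%R ->
  measurable_fun setT (fun p : R * Omega => f p.1 p.2) ->
  (forall s, (0 <= s)%R -> (s <= T)%R -> measurable_wrt (F s) (f s)) ->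
  \int[P]_w \int[mu]_(s in `[0%R, T]) (f s w ^+ 2)%:E < +oo ->
  (0 < e)%R -> exists2 H, simple_process_on F T H &
  \int[P]_w \int[mu]_(s in `[0%R, T]) ((f s w - sp_eval H s w) ^+ 2)%:E <= e%:E.
Proof.
rewrite le_eqVlt => /predU1P[<- mf af ffin e0|T0 mf af ffin e0].
  exists (SimpleProcess 0 (fun=> 0%R) (fun _ _ => 0%R)).
    by split => //=; rewrite lexx.
  under eq_integral do rewrite set_itv1 integral_set1.
  by rewrite integral0 lee_fin ltW.
pose f' s w := if (0 <= s <= T)%R then f s w else 0%R.
have mif : measurable_fun setT (fun p : R * Omega => (0 <= p.1 <= T)%R).
  by apply: measurable_and; apply: measurable_fun_ler => //; exact: measurable_fst.
have mf' : measurable_fun setT (fun p : R * Omega => f' p.1 p.2) by exact: measurable_fun_ifT.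
pose tr (n : nat) s w := Num.max (- n%:R)%R (Num.min (f' s w) n%:R%R).
have mtr n : measurable_fun setT (fun p : R * Omega => tr n p.1 p.2).
  by apply: measurable_maxr => //; exact: measurable_minr.
have trE n s w : tr n s w = f' s w \/ (n%:R < `|f' s w|)%R.
  rewrite /tr; have [h|h] := leP `|f' s w|%R n%:R; [left|by right].
  by move: h; rewrite ler_norml => /andP[h1 h2]; rewrite min_l// max_r.
have trle n s w : ((f' s w - tr n s w) ^+ 2 <= f' s w ^+ 2)%R.
  rewrite /tr; have n0 : (0 <= n%:R :> R)%R by [].
  by case: (leP (f' s w) n%:R) => h; case: (leP (- n%:R)%R _) => h'; rewrite !expr2; nra.
have msq (g : R * Omega -> R) : measurable_fun setT g -> measurable_fun setT (fun p => (g p ^+ 2)%:E).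
  by move=> mg; exact: measurable_sqr_EFin.
have f'E w s : (`[0%R, T]%classic s) -> f' s w = f s w.
  by rewrite /f' /= in_itv/= => ->.
have cv : \int[P]_w \int[mu]_(s in `[0%R, T]) ((f' s w - tr n s w) ^+ 2)%:E @[n --> \oo] --> 0.
  apply: (@nested_dominated_convergence _ _ _ P _ _
    (fun n (p : R * Omega) => ((f' p.1 p.2 - tr n p.1 p.2) ^+ 2)%:E)
    (fun p : R * Omega => (f' p.1 p.2 ^+ 2)%:E)).
  - exact: measurable_itv.
  - by move=> n; apply: msq; exact: measurable_funB.
  - by move=> n p; rewrite lee_fin sqr_ge0.
  - exact: msq.
  - by move=> n p; rewrite lee_fin; exact: trle.
  - apply: le_lt_trans ffin; rewrite le_eqVlt; apply/orP; left; apply/eqP.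
    by apply: eq_integral => w _; apply: eq_integral => s; rewrite inE => sT; rewrite f'E.
  - move=> w; apply: aeW => s _ /=.
    apply: (@cvgn_EFin _ _ 0%R); apply/cvgrPdist_lt => ep ep0; near=> n.
    have [->|] := trE n s w; first by rewrite subrr expr0n subrr normr0.
    rewrite ltNge => /negP; elim; near: n.
    exists (Num.truncn `|f' s w|).+1 => // n /= hn.
    by rewrite ltW// (lt_le_trans (truncnS_gt _))// ler_nat.
(* Truncation and discretisation may each cost e / 4, as the square of their sum doubles both. *)
have e4 : (0 < e / 4)%R by rewrite divr_gt0.
have [n _ /(_ n (leqnn n)) /= trn] := cvge0_near_lt e4 cv.
have [|||H sH HH] := @bounded_density (tr n) T n%:R T0 (mtr n) _ _ _ (e / 4) e4.
- move=> s s0 sT; rewrite /tr /f' s0 sT/=.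
  have sg := filtration_sigma_algebra HF s0.
  have /measurable_wrtP mfs := af s s0 sT.
  by apply/measurable_wrtP => //; apply: measurable_maxr => //; apply: measurable_minr => //; apply: mfs.
- move=> s w; rewrite /tr ler_norml; have n0 : (0 <= n%:R :> R)%R by [].
  rewrite le_max lexx/= ge_max ge_min lexx orbT andbT; lra.
- by move=> s w sT; rewrite /tr /f' (negbTE sT) min_l// max_r// oppr_le0.
exists H => //.
have mH := measurable_sp_eval sH.
rewrite (_ : \int[P]_w _ = \int[P]_w \int[mu]_(s in `[0%R, T]) ((f' s w - sp_eval H s w) ^+ 2)%:E); last first.
  by apply: eq_integral => w _; apply: eq_integral => s; rewrite inE => sT; rewrite f'E.
apply: (le_trans (@mean_sqrB_le _ _ _ P _ _ f' (fun s w => sp_eval H s w) (tr n) _ _ _)) => //.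
have h2 : 0 <= (2 : R)%:E by rewrite lee_fin.
apply: (le_trans (leeD (lee_wpmul2l h2 (ltW trn)) (lee_wpmul2l h2 HH))).
by rewrite -!EFinM -EFinD lee_fin; lra.
Unshelve. all: by end_near. Qed.

End density.

(** * The Ito integral *)

Section ito.
Local Open Scope ereal_scope.
Context (dd : measure_display) (Omega : measurableType dd) (R : realType)
  (P : probability Omega R) (F : R -> set (set Omega)) (W : R -> Omega -> R).
Hypotheses (HF : complete_filtration P F) (HW : brownian_motion P F W).
Local Notation mu := (@lebesgue_measure R).

Definition jointly_measurable (f : R -> Omega -> R) :=
  measurable_fun setT (fun p : R * Omega => f p.1 p.2).

(** Integrands up to different times become comparable on one interval [0, T]. *)
Definition cut (t : R) (f : R -> Omega -> R) (s : R) (w : Omega) : R :=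
  if (0 <= s <= t)%R then f s w else 0%R.

Lemma cut_jointly_measurable t f :
  measurable_fun ((`[0%R, t]%classic : set R) `*` [set: Omega]) (fun p : R * Omega => f p.1 p.2) ->
  jointly_measurable (cut t f).
Proof.
move=> mf; have mD : measurable ((`[0%R, t]%classic : set R) `*` [set: Omega]).
  by apply: measurableX => //; exact: measurable_itv.
have := (measurable_restrictT _ mD).1 mf; congr measurable_fun.
by apply/funext => p; rewrite patchE in_setX mem_setE/= in_itv/= in_setT andbT.
Qed.

Lemma integral_cut_sqr t T f w : (t <= T)%R ->
  \int[mu]_(s in `[0%R, T]) (cut t f s w ^+ 2)%:E = \int[mu]_(s in `[0%R, t]) (f s w ^+ 2)%:E.
Proof.
move=> tT; rewrite integral_mkcond [RHS]integral_mkcond; apply: eq_integral => s _.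
rewrite !patchE !mem_setE/= !in_itv/= /cut; have [s0|_] := leP 0%R s => //=.
have [st|_] := leP s t; first by rewrite (le_trans st tT).
by rewrite expr0n; case: ifP.
Qed.

Lemma simple_process_on_le t T H : (t <= T)%R ->
  simple_process_on F t H -> simple_process_on F T H.
Proof. by move=> tT [[h0 ht] h2 h3]; split => //; split => //; exact: le_trans tT. Qed.

Lemma sp_eval_out t H s w : simple_process_on F t H -> ~~ (0 <= s <= t)%R -> sp_eval H s w = 0%R.
Proof.
move=> sH hs; rewrite /sp_eval big1// => i _.
have [[a0 _ _ _] bt] := simple_process_elementary sH i.
rewrite indicE memNset ?mulr0//= in_itv/= => /andP[h1 h2].
by move: hs; rewrite (le_trans a0 (ltW h1)) (le_trans h2 bt).
Qed.

Lemma integral_cut_sp_eval t T f H w : (t <= T)%R -> simple_process_on F t H ->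
  \int[mu]_(s in `[0%R, T]) ((cut t f s w - sp_eval H s w) ^+ 2)%:E =
  \int[mu]_(s in `[0%R, t]) ((f s w - sp_eval H s w) ^+ 2)%:E.
Proof.
move=> tT sH; rewrite -(@integral_cut_sqr t T (fun s w => f s w - sp_eval H s w)%R)//.
apply: eq_integral => s _; congr (_ ^+ 2)%:E; rewrite /cut; case: ifPn => // hs.
by rewrite (sp_eval_out _ sH hs) subrr.
Qed.

Lemma measurable_sp_integral T H : simple_process_on F T H ->
  measurable_fun setT (sp_integral W H).
Proof.
move=> sH; apply: measurable_sum => i.
have [[a0 ab Fx _] _] := simple_process_elementary sH i.
apply: measurable_funM; first exact: (filtration_fun HF a0 Fx).
exact: (measurable_inc HF HW a0 ab).
Qed.

Lemma sp_integral_wrt T H : (0 <= T)%R -> simple_process_on F T H ->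
  measurable_wrt (F T) (sp_integral W H).
Proof.
move=> T0 sH; have sg := filtration_sigma_algebra HF T0.
apply: measurable_wrt_sum => // i.
have [[a0 ab Fx _] bT] := simple_process_elementary sH i.
apply: measurable_wrtM => //.
  by apply: (filtration_wrt_le HF a0 _ Fx); exact: le_trans bT.
by apply: (filtration_wrt_le HF _ bT); [exact: le_trans ab|exact: (measurable_inc_wrt HF HW a0 ab)].
Qed.

(* The isometry is only needed up to a constant; 16 = 2^4 comes from four nested
   uses of (x + y)^2 <= 2 x^2 + 2 y^2. *)
Lemma ito_isometry_le t t' T f f' I I' : (0 <= t)%R -> (t <= T)%R -> (0 <= t')%R -> (t' <= T)%R ->
  is_ito_integral P F W t f I -> is_ito_integral P F W t' f' I' ->
  \int[P]_w ((I w - I' w) ^+ 2)%:E <=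
  16%:E * \int[P]_w \int[mu]_(s in `[0%R, T]) ((cut t f s w - cut t' f' s w) ^+ 2)%:E.
Proof.
move=> t0 tT t0' tT' [[mf af ffin] mI [H [sH cfH cIH]]] [[mf' af' ffin'] mI' [H' [sH' cfH' cIH']]].
have mcf := cut_jointly_measurable mf; have mcf' := cut_jointly_measurable mf'.
have {}mI := filtration_fun HF t0 mI; have {}mI' := filtration_fun HF t0' mI'.
set X := \int[P]_w \int[mu]_(s in `[0%R, T]) ((cut t f s w - cut t' f' s w) ^+ 2)%:E.
apply/lee_addgt0Pr => e e0.
(* The four approximation errors enter with total weight 30, so that e / 32 for each suffices. *)
have e32 : (0 < e / 32)%R by rewrite divr_gt0.
have := filterI (filterI (cvge0_near_lt e32 cfH) (cvge0_near_lt e32 cIH))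
  (filterI (cvge0_near_lt e32 cfH') (cvge0_near_lt e32 cIH')).
move=> [n _ /(_ n (leqnn n)) /= [[b a] [b' a']]].
have sHT := simple_process_on_le tT (sH n); have sHT' := simple_process_on_le tT' (sH' n).
have msH := measurable_sp_integral sHT; have msH' := measurable_sp_integral sHT'.
have meH := measurable_sp_eval HF sHT; have meH' := measurable_sp_eval HF sHT'.
have h2 : 0 <= (2 : R)%:E by rewrite lee_fin.
have iso := simple_process_isometry HF HW sHT sHT'.
have E1 : \int[P]_w \int[mu]_(s in `[0%R, T]) ((sp_eval (H n) s w - sp_eval (H' n) s w) ^+ 2)%:E <=
    2%:E * (e / 32)%:E + 2%:E * (2%:E * X + 2%:E * (e / 32)%:E).
  apply: (le_trans (@mean_sqrB_le _ _ _ P _ (measurable_itv _) (fun s w => sp_eval (H n) s w)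
    (fun s w => sp_eval (H' n) s w) (cut t f) meH meH' mcf)).
  apply: leeD; apply: lee_wpmul2l => //.
    apply: le_trans (ltW b); rewrite le_eqVlt; apply/orP; left; apply/eqP.
    apply: eq_integral => w _; rewrite integral_sqrN; exact: integral_cut_sp_eval.
  apply: (le_trans (@mean_sqrB_le _ _ _ P _ (measurable_itv _) (cut t f)
    (fun s w => sp_eval (H' n) s w) (cut t' f') mcf meH' mcf')).
  rewrite leeD2l// lee_wpmul2l//.
  apply: le_trans (ltW b'); rewrite le_eqVlt; apply/orP; left; apply/eqP.
  apply: eq_integral => w _; exact: integral_cut_sp_eval.
apply: (le_trans (@integral_sqrB_le _ _ _ P _ measurableT _ _ _ mI mI' msH)).
apply: (@le_trans _ _ (2%:E * (e / 32)%:E + 2%:E * (2%:E * (2%:E * (e / 32)%:E +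
    2%:E * (2%:E * X + 2%:E * (e / 32)%:E)) + 2%:E * (e / 32)%:E))).
  apply: leeD; apply: lee_wpmul2l => //; first exact: ltW.
  apply: (le_trans (@integral_sqrB_le _ _ _ P _ measurableT _ _ _ msH mI' msH')).
  apply: leeD; apply: lee_wpmul2l => //; first by rewrite iso.
  by rewrite integral_sqrN; exact: ltW.
have X0 : 0 <= X by apply: integral_ge0 => w _; exact: integral_sqr_ge0.
case: X X0 {E1} => [x| |]// _; last first.
  by rewrite [leRHS](_ : _ = +oo) ?leey// mulry gtr0_sg// mul1e addye.
do 6 rewrite -?EFinM -?EFinD; rewrite lee_fin.
lra.
Qed.

Lemma cvg_geometric_bound (u : nat -> \bar R) (C : R) :
  (forall k, 0 <= u k) -> (forall k, u k <= (C * 4^-1 ^+ k)%:E) -> u k @[k --> \oo] --> 0.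
Proof.
move=> u0 uC; apply: (@squeeze_cvge _ _ _ _ (cst 0) _ (fun k => (C * 4^-1 ^+ k)%:E)).
- by apply: nearW => k; rewrite u0 uC.
- exact: cvg_cst.
- rewrite -[X in _ --> X]/(0%R%:E) -[0%R](mulr0 C); apply: cvgn_EFin.
  apply: cvgM; first exact: cvg_cst.
  by apply: cvg_expr; rewrite ger0_norm; lra.
Qed.

(** The errors follow the rate demanded by the L2 limit lemmas; the factor 1 puts the bound into
    their format. *)
Lemma density_sequence (f : R -> Omega -> R) t : (0 <= t)%R -> jointly_measurable f ->
  (forall s, (0 <= s)%R -> (s <= t)%R -> measurable_wrt (F s) (f s)) ->
  \int[P]_w \int[mu]_(s in `[0%R, t]) (f s w ^+ 2)%:E < +oo ->
  exists H : nat -> simple_process R Omega, forall n, simple_process_on F t (H n) /\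
    \int[P]_w \int[mu]_(s in `[0%R, t]) ((f s w - sp_eval (H n) s w) ^+ 2)%:E <= (1 * 4^-1 ^+ n)%:E.
Proof.
move=> t0 mf af ffin.
have H n : exists h, simple_process_on F t h /\
    \int[P]_w \int[mu]_(s in `[0%R, t]) ((f s w - sp_eval h s w) ^+ 2)%:E <= (1 * 4^-1 ^+ n)%:E.
  have e0 : (0 < 1 * 4^-1 ^+ n :> R)%R by rewrite mul1r exprn_gt0// invr_gt0.
  by have [h h1 h2] := simple_process_density HF t0 mf af ffin e0; exists h.
by have [h hh] := choice H; exists h.
Qed.

(** By the isometry, the elementary integrals of the approximations have increments of order 4^-k in
    mean square. Taking their pointwise upper limit as the integral makes it measurable with respect
    to [F t] itself. *)
Lemma ito_exists (f : R -> Omega -> R) t : (0 <= t)%R -> jointly_measurable f ->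
  (forall s, (0 <= s)%R -> (s <= t)%R -> measurable_wrt (F s) (f s)) ->
  \int[P]_w \int[mu]_(s in `[0%R, t]) (f s w ^+ 2)%:E < +oo ->
  exists I, is_ito_integral P F W t f I.
Proof.
move=> t0 mf af ffin; have [H HH] := density_sequence t0 mf af ffin.
have sH n : simple_process_on F t (H n) by have [] := HH n.
have fH n : \int[P]_w \int[mu]_(s in `[0%R, t]) ((f s w - sp_eval (H n) s w) ^+ 2)%:E <= (1 * 4^-1 ^+ n)%:E.
  by have [] := HH n.
pose J n := sp_integral W (H n).
have mJ n : measurable_fun setT (J n) by exact: measurable_sp_integral (sH n).
have JC k : \int[P]_w ((J k.+1 w - J k w) ^+ 2)%:E <= (4 * 4^-1 ^+ k)%:E.
  rewrite (simple_process_isometry HF HW (sH k.+1) (sH k)).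
  apply: (le_trans (@mean_sqrB_le _ _ _ P _ (measurable_itv _) (fun s w => sp_eval (H k.+1) s w)
    (fun s w => sp_eval (H k) s w) f (measurable_sp_eval HF (sH k.+1)) (measurable_sp_eval HF (sH k)) mf)).
  have h2 : 0 <= (2 : R)%:E by rewrite lee_fin.
  apply: (@le_trans _ _ (2%:E * (1 * 4^-1 ^+ k.+1)%:E + 2%:E * (1 * 4^-1 ^+ k)%:E)).
    apply: leeD; apply: lee_wpmul2l => //.
    by apply: le_trans (fH k.+1); under eq_integral do rewrite integral_sqrN.
  rewrite -!EFinM -EFinD lee_fin exprS.
  have : (0 <= 4^-1 ^+ k :> R)%R by rewrite exprn_ge0// invr_ge0.
  by set z := (_ ^+ k)%R; lra.
have c4 : (0 <= 4 :> R)%R by [].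
exists (pointwise_lim J); split.
- by split => //; exact: measurable_funTS.
- apply: measurable_wrt_pointwise_lim; first exact: (filtration_sigma_algebra HF t0).
  by move=> n; exact: sp_integral_wrt.
- exists H; split => //.
  + apply: (cvg_geometric_bound (C := 1)) => // n.
    by apply: integral_ge0 => w _; exact: integral_sqr_ge0.
  + apply: (cvg_geometric_bound (C := 4 * 4)) => n; first exact: integral_sqr_ge0.
    exact: (L2_cvg_pointwise_lim mJ c4 JC).
Qed.

End ito.

Lemma integrable_mul_sqr d (T : measurableType d) (R : realType) (m : {measure set T -> \bar R})
    (D : set T) (mD : measurable D) (f g : T -> R) :
  measurable_fun D f -> measurable_fun D g ->
  (\int[m]_(x in D) (f x ^+ 2)%:E < +oo -> \int[m]_(x in D) (g x ^+ 2)%:E < +oo ->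
  m.-integrable D (fun x => (f x * g x)%:E))%E.
Proof.
move=> mf mg f2 g2; apply/integrableP; split; first exact/measurable_EFinP/measurable_funM.
apply: (@le_lt_trans _ _ (\int[m]_(x in D) ((f x ^+ 2)%:E + (g x ^+ 2)%:E))%E).
  apply: ge0_le_integral => //.
  - by apply/measurableT_comp => //; exact/measurable_EFinP/measurable_funM.
  - by apply: emeasurable_funD; exact: measurable_sqr_EFin.
  - move=> x _; rewrite -EFinD /= lee_fin normrM -[leRHS](_ : `|f x| ^+ 2 + `|g x| ^+ 2 = _).
      have := mulr_ge0 (normr_ge0 (f x)) (normr_ge0 (g x)); have := sqr_ge0 (`|f x| - `|g x|).
      by move: (`|f x|) (`|g x|) => p q; rewrite !expr2; lra.
    by rewrite !real_normK// num_real.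
rewrite ge0_integralD//; first by rewrite lte_add_pinfty.
- by move=> x _; rewrite lee_fin sqr_ge0.
- exact: measurable_sqr_EFin.
- by move=> x _; rewrite lee_fin sqr_ge0.
- exact: measurable_sqr_EFin.
Qed.

Lemma ae_eq_integral_sqr d (T : measurableType d) (R : realType) (m : {measure set T -> \bar R})
    (f g : T -> R) : measurable_fun setT f -> measurable_fun setT g ->
  (\int[m]_x ((f x - g x) ^+ 2)%:E <= 0)%E -> {ae m, forall x, f x = g x}.
Proof.
move=> mf mg i0.
have m2 : measurable_fun setT (fun x => ((f x - g x) ^+ 2)%:E).
  by apply: measurable_sqr_EFin; exact: measurable_funB.
have : (\int[m]_x `|((f x - g x) ^+ 2)%:E| = 0)%E.
  apply/eqP; rewrite eq_le integral_ge0// andbT; apply: le_trans i0.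
  by under eq_integral do rewrite gee0_abs ?lee_fin ?sqr_ge0//.
move/(ae_eq_integral_abs _ measurableT m2).1; apply: filterS => x /(_ I) [].
by move=> /eqP; rewrite sqrf_eq0 subr_eq0 => /eqP.
Qed.

Lemma ae_eq_pointwise_lim d (T : measurableType d) (R : realType) (m : {measure set T -> \bar R})
    (X : nat -> T -> R) (Y : T -> R) (C : R) : (0 <= C) ->
  (forall k, measurable_fun setT (X k)) -> measurable_fun setT Y ->
  (forall k, \int[m]_x ((Y x - X k x) ^+ 2)%:E <= (C * 4^-1 ^+ k)%:E)%E ->
  {ae m, forall x, pointwise_lim X x = Y x}.
Proof.
move=> C0 mX mY YC; have h2 : (0 <= (2 : R)%:E)%E by rewrite lee_fin.
have XC k : (\int[m]_x ((X k.+1 x - X k x) ^+ 2)%:E <= (4 * C * 4^-1 ^+ k)%:E)%E.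
  apply: (le_trans (@integral_sqrB_le _ _ _ m _ measurableT _ _ _ (mX k.+1) (mX k) mY)).
  apply: (@le_trans _ _ (2%:E * (C * 4^-1 ^+ k.+1)%:E + 2%:E * (C * 4^-1 ^+ k)%:E)%E).
    by apply: leeD; apply: lee_wpmul2l => //; rewrite integral_sqrN.
  rewrite -!EFinM -EFinD lee_fin exprS.
  have : 0 <= C * 4^-1 ^+ k by rewrite mulr_ge0// exprn_ge0// invr_ge0.
  by move: (4^-1 ^+ k) => z; lra.
have C4 : 0 <= 4 * C by rewrite mulr_ge0.
apply: ae_eq_integral_sqr => //; first exact: measurable_pointwise_lim.
apply: (@le0_geometric _ _ (2 * (4 * (4 * C)) + 2 * C)) => n.
apply: (le_trans (@integral_sqrB_le _ _ _ m _ measurableT _ _ _ _ mY (mX n))).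
  exact: measurable_pointwise_lim.
apply: (@le_trans _ _ (2%:E * (4 * (4 * C) * 4^-1 ^+ n)%:E + 2%:E * (C * 4^-1 ^+ n)%:E)%E).
  apply: leeD; apply: lee_wpmul2l => //; first exact: L2_cvg_pointwise_lim.
  by rewrite integral_sqrN.
by rewrite -!EFinM -EFinD lee_fin le_eqVlt; apply/orP; left; apply/eqP; ring.
Qed.

(** * Adaptedness of time integrals *)

Section time_integral.
Local Open Scope ereal_scope.
Context (dd : measure_display) (Omega : measurableType dd) (R : realType)
  (P : probability Omega R) (F : R -> set (set Omega)).
Hypotheses (HF : complete_filtration P F).
Local Notation mu := (@lebesgue_measure R).

(** The preimages under [f] and [g] differ only inside a null set, all of whose subsets belong to
    [F t]. *)
Lemma measurable_wrt_ae t d (S : measurableType d) (f g : Omega -> S) : (0 <= t)%R ->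
  {ae P, forall w, f w = g w} -> measurable_wrt (F t) f -> measurable_wrt (F t) g.
Proof.
move=> t0 fg mf; have [F0 FC FU] := filtration_sigma_algebra HF t0.
move=> B mB; pose N := [set w | f w <> g w].
have nN A : A `<=` N -> F t A.
  move=> AN; apply: (filtration_complete HF t0); apply: negligibleS fg => w /AN h.
  by move=> /= e.
have sU A C : F t A -> F t C -> F t (A `|` C).
  by move=> FA FB; rewrite -bigcup2E; apply: FU => -[|[|n]].
have sC A : F t A -> F t (~` A) by move=> FA; rewrite -setTD; exact: FC.
have sI A C : F t A -> F t C -> F t (A `&` C).
  by move=> FA FB; rewrite -[A `&` C]setCK setCI; apply: (sC); apply: sU; exact: sC.
rewrite (_ : g @^-1` B = (f @^-1` B `&` ~` N) `|` (g @^-1` B `&` N)).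
  by apply: sU; [apply: sI; [exact: mf|apply: sC; exact: nN]|apply: nN => w []].
apply/seteqP; split => [w gB|w [[/= fB nw]|[]//]].
  by have [h|h] := pselect (f w = g w); [left; split => //=; rewrite h|right].
by have [<-|h] := pselect (f w = g w).
Qed.

Lemma measurable_time_Rintegral (D : set R) (g : R -> Omega -> R) : measurable D ->
  jointly_measurable g ->
  measurable_fun setT (fun w => (\int[mu]_(s in D) g s w)%R).
Proof.
move=> mD mg; rewrite /Rintegral.
under eq_fun do rewrite integralE.
apply: measurableT_comp; first exact: fine_measurable.
have me : measurable_fun setT (fun p : R * Omega => (g p.1 p.2)%:E) by exact/measurable_EFinP.
apply: emeasurable_funB.
  apply: (measurable_time_integral mD (g := fun p => (fun s => (g s p.2)%:E)^\+ p.1)) => //.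
  by rewrite unlock; apply: measurable_maxe.
apply: (measurable_time_integral mD (g := fun p => (fun s => (g s p.2)%:E)^\- p.1)) => //.
by rewrite unlock; apply: measurable_maxe => //; exact: measurableT_comp.
Qed.

(* Adaptedness of a time integral without progressive measurability: it is an
   L2 limit of the integrals of simple processes, and F t is complete. *)
Lemma time_integral_wrt (k : R -> R) (f : R -> Omega -> R) t : (0 <= t)%R ->
  jointly_measurable f -> measurable_fun setT k ->
  (forall s, (0 <= s)%R -> (s <= t)%R -> measurable_wrt (F s) (f s)) ->
  \int[P]_w \int[mu]_(s in `[0%R, t]) (f s w ^+ 2)%:E < +oo ->
  \int[mu]_(s in `[0%R, t]) (k s ^+ 2)%:E < +oo ->
  measurable_wrt (F t) (fun w => (\int[mu]_(s in `[0%R, t]) (k s * f s w))%R).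
Proof.
move=> t0 mf mk af ffin kfin; have [H HH] := density_sequence HF t0 mf af ffin.
have sH n : simple_process_on F t (H n) by have [] := HH n.
have fH n : \int[P]_w \int[mu]_(s in `[0%R, t]) ((f s w - sp_eval (H n) s w) ^+ 2)%:E <= (1 * 4^-1 ^+ n)%:E.
  by have [] := HH n.
have sg := filtration_sigma_algebra HF t0.
have mD : measurable (`[0%R, t]%classic : set R) by exact: measurable_itv.
have mkD : measurable_fun (`[0%R, t]%classic : set R) k by exact: measurable_funTS.
have mh n : jointly_measurable (fun s w => sp_eval (H n) s w) := measurable_sp_eval HF (sH n).
have msec (g : R -> Omega -> R) w : jointly_measurable g -> measurable_fun (`[0%R, t]%classic : set R) (g ^~ w).
  by move=> mg; apply: measurable_funTS; exact: (measurableT_comp mg (measurable_pair2 w)).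
have [c c0 cE] : exists2 c : R, (0 <= c)%R & \int[mu]_(s in `[0%R, t]) (k s ^+ 2)%:E = c%:E.
  have i0 := integral_sqr_ge0 mu `[0%R, t]%classic k.
  by exists (fine (\int[mu]_(s in `[0%R, t]) (k s ^+ 2)%:E)); [exact: fine_ge0|rewrite fineK// ge0_fin_numE].
have [K1 _] : mu.-integrable `[0%R, t] (EFin \o k) /\ True.
  split => //; have := @integrable_mul_sqr _ _ _ mu _ mD (cst 1%R) k (@measurable_cst _ _ _ _ _ _) mkD _ kfin.
  rewrite (_ : (fun x => (cst 1%R x * k x)%:E) = EFin \o k); last by apply/funext => x /=; rewrite mul1r.
  apply; under eq_integral do rewrite /= expr1n.
  by rewrite integral_cst// mul1e /= lebesgue_measure_itv/=; case: ifP => // _; rewrite -EFinB ltry.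
pose I w := (\int[mu]_(s in `[0%R, t]) (k s * f s w))%R.
pose B n w := (\int[mu]_(s in `[0%R, t]) (k s * sp_eval (H n) s w))%R.
have mjk (g : R -> Omega -> R) : jointly_measurable g -> jointly_measurable (fun s w => k s * g s w)%R.
  by move=> mg; apply: measurable_funM => //; exact: (measurableT_comp mk measurable_fst).
have mI : measurable_fun setT I by apply: measurable_time_Rintegral => //; exact: mjk.
have mB n : measurable_fun setT (B n) by apply: measurable_time_Rintegral => //; exact: mjk.
have ki n i : mu.-integrable `[0%R, t]
   (fun s => (k s * \1_(`]sp_time (H n) i, sp_time (H n) i.+1]%classic) s)%:E).
  apply: le_integrable K1 => //.
    by apply/measurable_EFinP; apply: measurable_funM => //; apply: measurable_indic; exact: measurable_itv.
  move=> s _; rewrite /= lee_fin normrM indicE; case: (_ \in _); rewrite ?normr1 ?mulr1// normr0 mulr0.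
  exact: normr_ge0.
have sumi n w s : (k s * sp_eval (H n) s w)%:E = \sum_(i < sp_size (H n))
   (sp_coef (H n) i w)%:E * (k s * \1_(`]sp_time (H n) i, sp_time (H n) i.+1]%classic) s)%:E.
  rewrite /sp_eval mulr_sumr -sumEFin; apply: eq_bigr => i _; rewrite -EFinM; congr EFin; ring.
have hi n w : mu.-integrable `[0%R, t] (fun s => (k s * sp_eval (H n) s w)%:E).
  rewrite (funext (sumi n w)).
  apply: integrable_sum => // i _; exact: integrableZl.
have FB n : measurable_wrt (F t) (B n).
  have -> : B n = (fun w => \sum_(i < sp_size (H n)) sp_coef (H n) i w *
     (\int[mu]_(s in `[0%R, t]) (k s * \1_(`]sp_time (H n) i, sp_time (H n) i.+1]%classic) s)))%R.
    apply/funext => w; rewrite /B /Rintegral; rewrite (funext (sumi n w)).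
    rewrite integral_sum//; last by move=> i; exact: integrableZl.
    rewrite -sum_fine; last by move=> i _; apply: integrable_fin_num => //; exact: integrableZl.
    apply: eq_bigr => i _; rewrite integralZl// fineM//; exact: integrable_fin_num.
  apply: measurable_wrt_sum => // i.
  have [[a0 ab Fx _] bT] := simple_process_elementary (sH n) i.
  apply: measurable_wrtM => //; last exact: measurable_wrt_cst.
  by apply: (filtration_wrt_le HF a0 _ Fx); exact: le_trans bT.
(* Along almost every path [f] is square integrable, so that k * f is integrable and the integral of
   the difference splits; on the other paths [Rintegral] may carry its default value. *)
have fae : {ae P, forall w, \int[mu]_(s in `[0%R, t]) (f s w ^+ 2)%:E < +oo}.
  have mfi : measurable_fun setT (fun w => \int[mu]_(s in `[0%R, t]) (f s w ^+ 2)%:E).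
    apply: (measurable_time_integral mD (g := fun p => (f p.1 p.2 ^+ 2)%:E)); first exact: measurable_sqr_EFin.
    by move=> p; rewrite lee_fin sqr_ge0.
  have : P.-integrable setT (fun w => \int[mu]_(s in `[0%R, t]) (f s w ^+ 2)%:E).
    apply/integrableP; split => //; apply: le_lt_trans ffin.
    by under eq_integral do rewrite gee0_abs ?integral_sqr_ge0//.
  move=> /(integrable_ae measurableT); apply: filterS => w /(_ Logic.I).
  by rewrite ge0_fin_numE// integral_sqr_ge0.
(* Cauchy-Schwarz along the paths, with c the integral of k^2, transfers the rate of the integrands
   to their integrals. *)
have IB n : \int[P]_w ((I w - B n w) ^+ 2)%:E <= (c * 4^-1 ^+ n)%:E.
  have mfh : jointly_measurable (fun s w => f s w - sp_eval (H n) s w)%R.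
    by apply: measurable_funB => //; exact: mh.
  have mfi : measurable_fun setT (fun w => \int[mu]_(s in `[0%R, t]) ((f s w - sp_eval (H n) s w) ^+ 2)%:E).
    apply: (measurable_time_integral mD (g := fun p => ((f p.1 p.2 - sp_eval (H n) p.1 p.2) ^+ 2)%:E)).
      exact: measurable_sqr_EFin.
    by move=> p; rewrite lee_fin sqr_ge0.
  apply: (@le_trans _ _ (\int[P]_w (c%:E * \int[mu]_(s in `[0%R, t]) ((f s w - sp_eval (H n) s w) ^+ 2)%:E))).
    apply: ae_ge0_le_integral => //.
    - by move=> w _; rewrite lee_fin sqr_ge0.
    - by apply: measurable_sqr_EFin; exact: measurable_funB.
    - by move=> w _; rewrite mule_ge0// integral_sqr_ge0.
    - exact: measurable_funeM.
    - apply: filterS fae => w fw _; rewrite -cE.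
      have ikf : mu.-integrable `[0%R, t] (fun s => (k s * f s w)%:E).
        by apply: (@integrable_mul_sqr _ _ _ mu _ mD _ _ mkD (msec _ w mf)) => //; rewrite cE ltry.
      have := @sqr_Rintegral_le _ _ _ mu _ mD _ _ mkD (msec _ w mfh); apply: le_trans.
      rewrite lee_fin le_eqVlt; apply/orP; left; apply/eqP; congr (_ ^+ 2)%R.
      rewrite /I /B /Rintegral -fineB; [|exact: integrable_fin_num|exact: integrable_fin_num].
      congr fine; rewrite -integralB_EFin//; last exact: hi.
      by apply: eq_integral => s _; rewrite mulrBr EFinB.
  rewrite (@ge0_integralZl_EFin _ _ _ P _ measurableT (fun w => \int[mu]_(s in `[0%R, t]) ((f s w - sp_eval (H n) s w) ^+ 2)%:E))//; last by move=> ? _; exact: integral_sqr_ge0.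
  by rewrite EFinM lee_wpmul2l ?lee_fin//; have := fH n; rewrite mul1r.
apply: (@measurable_wrt_ae t _ _ (pointwise_lim B)) => //; last exact: measurable_wrt_pointwise_lim.
exact: (ae_eq_pointwise_lim c0).
Qed.

End time_integral.

(** * Random vectors and superposition operators *)

Section row_vectors.
Context {R : realType} {d : nat}.
Implicit Types x y : 'rV[R]_d.

Lemma measurable_row_coord (i : 'I_d) : measurable_fun setT (fun x => x ord0 i).
Proof.
move=> _ B mB; rewrite setTI; apply: sub_sigma_algebra.
by rewrite (bigD1 i)//=; left; exists B => //; rewrite setTI.
Qed.

Lemma measurable_fun_row dd (T : measurableType dd) (D : set T) (f : T -> 'rV[R]_d) :
  measurable D -> (forall i, measurable_fun D (fun t => f t ord0 i)) -> measurable_fun D f.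
Proof.
move=> mD mf; apply: (measurability (\big[setU/set0]_(i < d)
  preimage_set_system setT (@row_coord R d i) measurable)) => //.
move=> _ [A hA <-]; move: A hA.
apply: (big_ind (fun S : set (set 'rV[R]_d) => forall A, S A -> measurable (D `&` f @^-1` A))) => //.
  by move=> S1 S2 h1 h2 A [/h1|/h2].
by move=> i _ A [B mB <-]; rewrite setTI; exact: (mf i mD B mB).
Qed.

Lemma measurable_wrt_row (T : pointedType) (G : set (set T)) (f : T -> 'rV[R]_d) :
  sigma_algebra setT G -> (forall i, measurable_wrt G (fun t => f t ord0 i)) -> measurable_wrt G f.
Proof.
move=> sG mf; apply/measurable_wrtP => //; apply: measurable_fun_row => // i.
by apply/measurable_wrtP.
Qed.

Lemma measurable_wrt_coord (T : pointedType) (G : set (set T)) (f : T -> 'rV[R]_d) i :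
  measurable_wrt G f -> measurable_wrt G (fun t => f t ord0 i).
Proof.
move=> mf B mB; rewrite -[_ @^-1` _]/(f @^-1` ((fun x : 'rV[R]_d => x ord0 i) @^-1` B)).
by apply: mf; rewrite -[X in measurable X]setTI; exact: measurable_row_coord.
Qed.

(** The squared Euclidean norm. Being polynomial in the coordinates it splits into coordinatewise
    estimates without roots. *)
Definition sqn x : R := \sum_(i < d) x ord0 i ^+ 2.

Lemma sqn_ge0 x : 0 <= sqn x.
Proof. by apply: sumr_ge0 => i _; exact: sqr_ge0. Qed.

Lemma sqr_eucl_norm x : eucl_norm x ^+ 2 = sqn x.
Proof. by rewrite sqr_sqrtr// sqn_ge0. Qed.

Lemma eucl_norm_ge0 x : 0 <= eucl_norm x.
Proof. exact: sqrtr_ge0. Qed.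

Lemma coord_sqr_le x i : x ord0 i ^+ 2 <= sqn x.
Proof. by rewrite /sqn (bigD1 i)//= lerDl sumr_ge0// => j _; exact: sqr_ge0. Qed.

Lemma sqnN x : sqn (- x) = sqn x.
Proof. by apply: eq_bigr => i _; rewrite mxE sqrrN. Qed.

Lemma sqnD_le x y : sqn (x + y) <= 2 * sqn x + 2 * sqn y.
Proof.
rewrite /sqn !mulr_sumr -big_split/=; apply: ler_sum => i _; rewrite mxE.
by have := sqr_ge0 (x ord0 i - y ord0 i); rewrite !expr2; lra.
Qed.

Lemma sqnB_le x y z : sqn (x - y) <= 2 * sqn (x - z) + 2 * sqn (z - y).
Proof. by rewrite (_ : x - y = (x - z) + (z - y)) ?sqnD_le// addrA subrK. Qed.

Lemma measurable_sqn : measurable_fun setT sqn.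
Proof.
by apply: measurable_sum => i; apply: measurable_funX; exact: measurable_row_coord.
Qed.

End row_vectors.

Section nemytskii.
Context (dd : measure_display) (Omega : measurableType dd) (R : realType) (d : nat)
  (P : probability Omega R) (F : R -> set (set Omega)).
Hypothesis HF : complete_filtration P F.
Implicit Types (B : R -> 'rV[R]_d -> 'rV[R]_d) (X Y : R -> Omega -> 'rV[R]_d).

(* Superposition (Nemytskii) operator, extended by 0 to negative times. *)
Definition nem B X (i : 'I_d) (s : R) (w : Omega) : R :=
  if 0 <= s then B s (X s w) ord0 i else 0.

Definition timely_measurable X :=
  measurable_fun ((`[0, +oo[%classic : set R) `*` [set: Omega])
        (fun p : R * Omega => X p.1 p.2).

Definition state_measurable B :=
  measurable_fun ((`[0, +oo[%classic : set R) `*` [set: 'rV[R]_d])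
            (fun p : R * 'rV[R]_d => B p.1 p.2).

Let measurable_times (dd' : measure_display) (T : measurableType dd') :
  measurable ((`[0, +oo[%classic : set R) `*` [set: T]).
Proof. by apply: measurableX => //; exact: measurable_itv. Qed.

Lemma timely_restrict (g : R -> Omega -> R) :
  measurable_fun ((`[0, +oo[%classic : set R) `*` [set: Omega]) (fun p : R * Omega => g p.1 p.2) ->
  jointly_measurable (fun s w => if 0 <= s then g s w else 0).
Proof.
move=> mg; have := (measurable_restrictT _ (@measurable_times _ Omega)).1 mg; congr measurable_fun.
by apply/funext => p; rewrite patchE in_setX mem_setE/= in_itv/= in_setT !andbT.
Qed.

Lemma timely_coord X i : timely_measurable X ->
  measurable_fun ((`[0, +oo[%classic : set R) `*` [set: Omega]) (fun p : R * Omega => X p.1 p.2 ord0 i).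
Proof. by move=> mX; exact: (measurableT_comp (measurable_row_coord i) mX). Qed.

Lemma measurable_nem B X i : state_measurable B -> timely_measurable X ->
  jointly_measurable (nem B X i).
Proof.
move=> mB mX; apply: timely_restrict.
apply: (@measurableT_comp _ _ _ _ _ _ (fun x : 'rV[R]_d => x ord0 i) _
  (fun p : R * Omega => B p.1 (X p.1 p.2))); first exact: measurable_row_coord.
pose X0 (p : R * Omega) := if 0 <= p.1 then X p.1 p.2 else 0.
have mX0 : measurable_fun setT X0.
  apply: measurable_fun_row => // j; have := @timely_restrict (fun s w => X s w ord0 j) (timely_coord j mX).
  by congr measurable_fun; apply/funext => p; rewrite /X0; case: ifP => // _; rewrite mxE.
apply: (@eq_measurable_fun _ _ _ _ _ (fun p : R * Omega => B p.1 (X0 p))) => [p|].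
  by rewrite inE/= in_itv/= andbT /X0 => -[-> _].
apply: (@measurable_comp _ _ _ _ _ _ ((`[0, +oo[%classic : set R) `*` [set: 'rV[R]_d])
  (fun p : R * 'rV[R]_d => B p.1 p.2) _ (fun p : R * Omega => (p.1, X0 p))) => //.
- exact: measurable_times.
- by move=> _ [[s w] [/= s0 _] <-].
- by apply: measurable_funTS; apply: measurable_fun_pair.
Qed.

Lemma nem_wrt B X i s : state_measurable B -> 0 <= s -> measurable_wrt (F s) (X s) ->
  measurable_wrt (F s) (nem B X i s).
Proof.
move=> mB s0 mX; rewrite /nem s0.
apply: (measurable_wrt_comp (filtration_sigma_algebra HF s0) (g := fun x => B s x ord0 i)) => //.
apply: (measurableT_comp (measurable_row_coord i)).
apply: (@measurable_comp _ _ _ _ _ _ ((`[0, +oo[%classic : set R) `*` [set: 'rV[R]_d])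
  (fun p : R * 'rV[R]_d => B p.1 p.2) _ (fun x : 'rV[R]_d => (s, x))) => //.
- exact: measurable_times.
- by move=> _ [x _ <-]; split => //=; rewrite in_itv/= s0.
- exact: measurable_pair1.
Qed.

Definition sqdist X Y (s : R) (w : Omega) : R := if 0 <= s then sqn (X s w - Y s w) else 0.

Lemma sqdist_ge0 X Y s w : 0 <= sqdist X Y s w.
Proof. by rewrite /sqdist; case: ifP => // _; exact: sqn_ge0. Qed.

Lemma measurable_sqdist X Y : timely_measurable X -> timely_measurable Y ->
  jointly_measurable (sqdist X Y).
Proof.
move=> mX mY; apply: timely_restrict; apply: measurable_sum => i; apply: measurable_funX.
rewrite (_ : (fun p => _) = (fun p : R * Omega => X p.1 p.2 ord0 i - Y p.1 p.2 ord0 i)); last first.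
  by apply/funext => p; rewrite !mxE.
by apply: measurable_funB; exact: timely_coord.
Qed.

Lemma measurable_sqnB X Y (s : R) : 0 <= s -> measurable_wrt (F s) (X s) -> measurable_wrt (F s) (Y s) ->
  measurable_fun setT (fun w => sqn (X s w - Y s w)).
Proof.
move=> s0 mX mY; apply: measurable_sum => i; apply: measurable_funX.
rewrite (_ : (fun w => _) = (fun w => X s w ord0 i - Y s w ord0 i)); last first.
  by apply/funext => w; rewrite !mxE.
by apply: measurable_funB; apply: (filtration_fun HF s0); exact: measurable_wrt_coord.
Qed.

Lemma nem_lipschitz B X Y (L : R) s w : 0 <= L ->
  (forall x y (t : R), 0 <= t -> eucl_norm (B t x - B t y) <= L * eucl_norm (x - y)) ->
  \sum_i (nem B X i s w - nem B Y i s w) ^+ 2 <= L ^+ 2 * sqdist X Y s w.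
Proof.
move=> L0 HL; rewrite /nem /sqdist; case: ifPn => s0; last first.
  by rewrite mulr0 big1// => i _; rewrite subrr expr0n.
rewrite -sqr_eucl_norm -exprMn.
have := HL (X s w) (Y s w) s s0; rewrite -(@ler_pXn2r _ 2)// ?nnegrE ?mulr_ge0 ?eucl_norm_ge0//.
by apply: le_trans; rewrite sqr_eucl_norm le_eqVlt; apply/orP; left; apply/eqP; apply: eq_bigr => i _; rewrite !mxE.
Qed.

End nemytskii.

(** * The Volterra equation *)

Section cut_integrals.
Local Open Scope ereal_scope.
Context {R : realType}.
Local Notation mu := (@lebesgue_measure R).

Lemma patch_itv_cut (f : R -> \bar R) (t T : R) : (t <= T)%R ->
  (forall s, (t < s)%R -> f s = 0) ->
  f \_ (`[0%R, T]%classic) = f \_ (`[0%R, t]%classic).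
Proof.
move=> tT ft; apply/funext => s; rewrite !patchE !mem_setE/= !in_itv/=.
have [s0|_] := leP 0%R s => //=; have [st|ts] := leP s t; first by rewrite (le_trans st tT).
by rewrite ft// if_same.
Qed.

Lemma integral_itv_cut (f : R -> \bar R) (t T : R) : (t <= T)%R ->
  (forall s, (t < s)%R -> f s = 0) ->
  \int[mu]_(s in `[0%R, T]) f s = \int[mu]_(s in `[0%R, t]) f s.
Proof. by move=> tT ft; rewrite integral_mkcond (patch_itv_cut tT ft) -integral_mkcond. Qed.

Lemma integrable_itv_cut (f : R -> \bar R) (t T : R) : (t <= T)%R ->
  (forall s, (t < s)%R -> f s = 0) ->
  mu.-integrable `[0%R, T] f <-> mu.-integrable `[0%R, t] f.
Proof.
move=> tT ft; have mD x : measurable (`[0%R, x]%classic : set R) by exact: measurable_itv.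
have e := patch_itv_cut tT ft.
split => h; apply: (@integrable_mkcond _ _ _ mu _ f (mD _)).2;
  [rewrite -e|rewrite e]; exact: (@integrable_mkcond _ _ _ mu _ f (mD _)).1.
Qed.

End cut_integrals.


Section convolution_bounds.
Local Open Scope ereal_scope.
Context {R : realType}.
Variable alpha : R.
Hypothesis alpha_itv : (2^-1 < alpha < 1)%R.
Local Notation mu := (@lebesgue_measure R).
Local Notation ker := (ker alpha).

(** Young's inequality for convolutions: by Tonelli, each time s contributes at most the mass of the
    squared kernel on [0, T]. *)
Lemma integral_vconv_le (T : R) : exists2 C : R, (0 <= C)%R &
  forall v, measurable_fun setT v -> (forall s, 0 <= v s) ->
  \int[mu]_(t in `[0%R, T]) vconv alpha T v t <= C%:E * \int[mu]_(s in `[0%R, T]) v s.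
Proof.
have km := ker_mass_lty alpha_itv T; have k0 := ker_mass_ge0 alpha T.
have kE : (fine (ker_mass alpha T))%:E = ker_mass alpha T by rewrite fineK// ge0_fin_numE.
exists (fine (ker_mass alpha T)); first exact: fine_ge0.
move=> v mv v0; pose f (p : R * R) := (ker (p.1 - p.2) ^+ 2)%:E * v p.2.
have mf : measurable_fun setT f by apply: emeasurable_funM; [exact: measurable_ker2|exact: measurableT_comp].
have f0 p : 0 <= f p by rewrite /f mule_ge0// lee_fin sqr_ge0.
have mk (s : R) : measurable_fun setT (fun t : R => (ker (t - s) ^+ 2)%:E).
  apply: measurable_sqr_EFin => //; apply: measurableT_comp; first exact: measurable_ker.
  exact: measurable_funB.
rewrite /vconv (@domain_tonelli _ _ _ _ _ mu mu _ _ (measurable_itv _) (measurable_itv _) f)//.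
rewrite -ge0_integralZl//; [|exact: measurable_funTS|by rewrite kE].
apply: ge0_le_integral => //.
- by move=> s _; apply: integral_ge0 => t _; exact: f0.
- apply: measurable_funTS.
  apply: (@measurable_fun_integral_dom _ _ _ _ _ mu _ _ (fun p : R * R => f (p.2, p.1))) => //.
  by apply: measurableT_comp => //; exact: measurable_swap.
- by apply: measurable_funTS; exact: measurable_funeM.
move=> s; rewrite /= in_itv/= => /andP[s0 sT].
rewrite /f /= ge0_integralZr//; last 2 first.
- apply: measurable_funTS; exact: mk.
- by move=> t _; rewrite lee_fin sqr_ge0.
rewrite lee_wpmul2r// kE /ker_mass.
apply: (@integral_shift_itv _ (fun r => (ker r ^+ 2)%:E)) => //.
- exact: measurable_sqr_ker.
- by move=> r; rewrite lee_fin sqr_ge0.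
- by move=> r r0; rewrite ker_neg// expr0n.
Qed.

(* Cauchy-Schwarz with the factors |g|^(1/2) and ker * |g|^(1/2): only integrability
   of g is needed for the convolution to be square integrable in t. *)
Lemma sqr_conv_le (T t : R) (g : R -> R) : measurable_fun setT g ->
  ((\int[mu]_(s in `[0%R, T]) (ker (t - s) * g s))%R ^+ 2)%:E <=
  (\int[mu]_(s in `[0%R, T]) `|g s|%:E) * vconv alpha T (fun s => `|g s|%:E) t.
Proof.
move=> mg; have mD : measurable (`[0%R, T]%classic : set R) by exact: measurable_itv.
have mrt : measurable_fun setT (fun s : R => Num.sqrt `|g s|).
  apply: measurableT_comp; first exact: (continuous_measurable_fun (@sqrt_continuous R)).
  exact: measurableT_comp.
have mk : measurable_fun setT (fun s : R => ker (t - s)) by exact: measurable_ker_shift.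
pose h s := if (0 <= g s)%R then (ker (t - s) * Num.sqrt `|g s|)%R else (- (ker (t - s) * Num.sqrt `|g s|))%R.
have mh : measurable_fun setT h.
  apply: measurable_fun_ifT; first exact: measurable_fun_ler.
    exact: measurable_funM.
  by apply: measurableT_comp => //; exact: measurable_funM.
have := @sqr_Rintegral_le _ _ _ mu _ mD _ h (measurable_funTS mrt) (measurable_funTS mh).
rewrite (_ : \int[mu]_(x in `[0%R, T]) (h x ^+ 2)%:E = vconv alpha T (fun s => `|g s|%:E) t); last first.
  apply: eq_integral => s _; rewrite /h -EFinM; congr EFin.
  by case: ifP => _; rewrite ?sqrrN exprMn sqr_sqrtr.
rewrite (_ : \int[mu]_(x in `[0%R, T]) (Num.sqrt `|g x| ^+ 2)%:E = \int[mu]_(s in `[0%R, T]) `|g s|%:E); last first.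
  by apply: eq_integral => s _; rewrite sqr_sqrtr.
apply: le_trans; rewrite le_eqVlt; apply/orP; left; apply/eqP; congr (_ ^+ 2)%:E; congr fine.
apply: eq_integral => s _; congr EFin; rewrite /h.
have e : (Num.sqrt `|g s| * Num.sqrt `|g s| = `|g s|)%R by rewrite -expr2 sqr_sqrtr.
case: ifPn => g0; first by rewrite mulrCA e ger0_norm.
rewrite mulrN mulrCA e ltr0_norm ?mulrN ?opprK//.
by rewrite ltNge.
Qed.

(* Integrability of ker (T + 1 - s) * v s on [0, T + 1] is what the equation at
   time T + 1 provides; there the kernel is bounded below on [0, T]. *)
Lemma integral_le_ker_weight n (T : R) (v : R -> \bar R) : (0 <= T)%R ->
  measurable_fun setT v -> (forall s, 0 <= v s) ->
  \int[mu]_(s in `[0%R, T]) v s <=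
  ((ker (T + 1))^-1 ^+ n)%:E * \int[mu]_(s in `[0%R, (T + 1)%R]) ((ker (T + 1 - s) ^+ n)%:E * v s).
Proof.
move=> T0 mv v0.
have k0 : (0 < ker (T + 1))%R by apply: ker_gt0; lra.
have mk : measurable_fun setT (fun s : R => (ker (T + 1 - s) ^+ n)%:E * v s).
  by apply: emeasurable_funM => //; apply/measurable_EFinP; apply: measurable_funX; exact: measurable_ker_shift.
have kv0 s : 0 <= (ker (T + 1 - s) ^+ n)%:E * v s by rewrite mule_ge0// lee_fin exprn_ge0// ker_ge0.
have i0 : 0 <= ((ker (T + 1))^-1 ^+ n)%:E :> \bar R by rewrite lee_fin exprn_ge0// invr_ge0 ltW.
apply: (@le_trans _ _ (((ker (T + 1))^-1 ^+ n)%:E * \int[mu]_(s in `[0%R, T]) ((ker (T + 1 - s) ^+ n)%:E * v s))).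
  rewrite -ge0_integralZl//; last exact: measurable_funTS.
  apply: ge0_le_integral => //.
  - exact: measurable_funTS.
  - by apply: measurable_funTS; exact: measurable_funeM.
  - move=> s; rewrite /= in_itv/= => /andP[s0 sT]; rewrite muleA -EFinM -exprMn -[leLHS]mul1e.
    apply: lee_wpmul2r => //; rewrite lee_fin exprn_ege1// mulrC ler_pdivlMr// mul1r.
    by apply: ker_nincr => //; lra.
apply: lee_wpmul2l => //; apply: ge0_subset_integral => //.
- exact: measurable_funTS.
- by move=> s; rewrite /= !in_itv/= => /andP[-> sT] /=; lra.
Qed.

End convolution_bounds.

Section ito_basic.
Local Open Scope ereal_scope.
Context (dd : measure_display) (Omega : measurableType dd) (R : realType)
  (P : probability Omega R) (F : R -> set (set Omega)) (W : R -> Omega -> R).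
Hypotheses (HF : complete_filtration P F).
Local Notation mu := (@lebesgue_measure R).

Lemma ito_integral_ext t (f g : R -> Omega -> R) I :
  (forall s w, (0 <= s)%R -> (s <= t)%R -> f s w = g s w) ->
  is_ito_integral P F W t f I -> is_ito_integral P F W t g I.
Proof.
move=> fg [[mf af ff] mI [H [sH cfH cIH]]].
have ei (h : R -> Omega -> R) : \int[P]_w \int[mu]_(s in `[0%R, t]) ((f s w - h s w) ^+ 2)%:E =
    \int[P]_w \int[mu]_(s in `[0%R, t]) ((g s w - h s w) ^+ 2)%:E.
  apply: eq_integral => w _; apply: eq_integral => s; rewrite inE/= in_itv/= => /andP[s0 st].
  by rewrite fg.
split; [split|exact: mI|].
- apply: eq_measurable_fun mf => -[s w]; rewrite inE => -[/= + _].
  by rewrite in_itv/= => /andP[s0 st]; exact: fg.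
- move=> s s0 st; rewrite (_ : g s = f s); first exact: af.
  by apply/funext => w; rewrite fg.
- have := ei (fun _ _ => 0%R); under eq_integral do under eq_integral do rewrite subr0.
  under [X in _ = X -> _]eq_integral do under eq_integral do rewrite subr0.
  by move=> <-.
exists H; split; [exact: sH| |exact: cIH].
by under eq_fun do rewrite -ei.
Qed.

Lemma ito_integral0 t : (0 <= t)%R -> is_ito_integral P F W t (fun _ _ => 0%R) (fun=> 0%R).
Proof.
move=> t0; have sg := filtration_sigma_algebra HF.
have e0 (D : set R) : \int[P]_w \int[mu]_(s in D) (((0 : R) ^+ 2)%:E) = 0.
  by rewrite expr0n; apply: integral0_eq => w _; apply: integral0_eq.
split; first split.
- exact: measurable_cst.
- by move=> s s0 st; apply: measurable_wrt_cst; exact: sg.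
- by rewrite e0 ltry.
- by apply: measurable_wrt_cst; exact: sg.
exists (fun=> SimpleProcess 0 (fun=> 0%R) (fun _ _ => 0%R)); split.
- by move=> n; split.
- rewrite /sp_eval; under eq_fun do under eq_integral do under eq_integral do rewrite big_ord0 subr0.
  rewrite e0; exact: cvg_cst.
- rewrite /sp_integral; under eq_fun do under eq_integral do rewrite big_ord0 subr0 expr0n.
  by rewrite integral0_eq//; exact: cvg_cst.
Qed.

End ito_basic.

(** * Measurable adapted modifications *)

Section modification.
Local Open Scope ereal_scope.
Context (dd : measure_display) (Omega : measurableType dd) (R : realType)
  (P : probability Omega R) (F : R -> set (set Omega)).
Hypotheses (HF : complete_filtration P F).

(** The half-spaces of time decompose into countably many cells on which the grid index is constant,
    and there the process is a single random variable. Negative times fall into the cell of index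
    0. *)
Lemma measurable_grid (N : nat) (Z : R -> Omega -> R) :
  (forall t, (0 <= t)%R -> measurable_fun setT (Z t)) ->
  jointly_measurable (fun t w => Z ((Num.truncn (t * N.+1%:R))%:R / N.+1%:R)%R w).
Proof.
move=> mZ; pose E (j : nat) : set (R * Omega) := [set p | Num.truncn (p.1 * N.+1%:R)%R = j].
have mE j : measurable (E j).
  have -> : E j = ((fun t : R => (Num.truncn (t * N.+1%:R)%R)%:R : R) @^-1` [set j%:R]) `*` setT.
    apply/seteqP; split => [p /= ->|p [/= /eqP + _]]; first by [].
    by rewrite eqr_nat => /eqP.
  apply: measurableX => //; rewrite -[X in measurable X]setTI.
  have : measurable_fun setT (fun t : R => (Num.truncn (t * N.+1%:R)%R)%:R : R).
    apply: nondecreasing_measurable => //.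
    move=> x y xy; rewrite ler_nat; apply: le_truncn.
    by rewrite ler_wpM2r.
  by apply => //; exact: measurable_set1.
have ET : [set: R * Omega] = \bigcup_j E j.
  by apply/seteqP; split => // p _; exists (Num.truncn (p.1 * N.+1%:R)%R).
rewrite /jointly_measurable [X in measurable_fun X _]ET; apply/measurable_fun_bigcup => // j.
apply: (@eq_measurable_fun _ _ _ _ _ (fun p : R * Omega => Z (j%:R / N.+1%:R)%R p.2)).
  by move=> p; rewrite inE /E/= => ->.
apply: measurable_funTS; apply: measurableT_comp; last exact: measurable_snd.
by apply: mZ; rewrite divr_ge0.
Qed.

Lemma grid_mesh (b e : R) : (0 < b)%R -> (0 < e)%R ->
  exists N : nat, ((N.+1%:R^-1) `^ b <= e)%R.
Proof.
move=> b0 e0; pose x := (e `^ b^-1)%R.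
have x0 : (0 < x)%R by exact: powR_gt0.
exists (Num.truncn x^-1).
have xN : ((Num.truncn x^-1).+1%:R^-1 <= x)%R.
  rewrite invf_ple ?posrE//; apply: ltW; exact: truncnS_gt.
apply: (@le_trans _ _ (x `^ b)%R).
  by apply: ge0_ler_powR; rewrite ?nnegrE//; exact: ltW.
by rewrite /x -powRrM mulVf ?gt_eqF// powRr1// ltW.
Qed.

Lemma grid_itv (N : nat) (t : R) : (0 <= t)%R ->
  [/\ (0 <= (Num.truncn (t * N.+1%:R))%:R / N.+1%:R :> R)%R,
      ((Num.truncn (t * N.+1%:R))%:R / N.+1%:R <= t)%R &
      (t - (Num.truncn (t * N.+1%:R))%:R / N.+1%:R <= N.+1%:R^-1)%R].
Proof.
move=> t0; have N0 : (0 < N.+1%:R :> R)%R by [].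
have tN : (0 <= t * N.+1%:R)%R by rewrite mulr_ge0.
have /andP[h1 h2] := truncn_itv tN.
split; first by rewrite divr_ge0.
- by rewrite ler_pdivrMr.
- rewrite lerBlDr -[X in (_ <= X + _)%R]mul1r -mulrDl ler_pdivlMr//.
  by rewrite addrC natr1 ltW.
Qed.

(* The grid values [Z (floor (t * N) / N)] converge to [Z t] fast enough along
   a suitable sequence of meshes for their pointwise limit to exist. *)
Lemma measurable_adapted_modification (b : R) (Z : R -> Omega -> R) : (0 < b)%R ->
  (forall t, (0 <= t)%R -> measurable_wrt (F t) (Z t)) ->
  (forall T, (0 <= T)%R -> exists2 C : R, (0 <= C)%R &
    forall s t, (0 <= s)%R -> (s <= t)%R -> (t <= T)%R ->
      \int[P]_w ((Z t w - Z s w) ^+ 2)%:E <= (C * (t - s) `^ b)%:E) ->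
  exists X : R -> Omega -> R, jointly_measurable X /\
    forall t, (0 <= t)%R -> measurable_wrt (F t) (X t) /\ {ae P, forall w, X t w = Z t w}.
Proof.
move=> b0 aZ HZ.
have e4 k : (0 < 4^-1 ^+ k :> R)%R by rewrite exprn_gt0// invr_gt0.
(* Mesh sizes whose power b is at most 4^-k, the rate for almost sure convergence. The grid points
   lie to the left of t, which preserves adaptedness. *)
have [N HN] := choice (fun k => grid_mesh b0 (e4 k)).
pose g k (t : R) := ((Num.truncn (t * (N k).+1%:R))%:R / (N k).+1%:R : R)%R.
pose X k t w := Z (g k t) w.
have mZ t : (0 <= t)%R -> measurable_fun setT (Z t) by move=> t0; exact: (filtration_fun HF t0 (aZ t t0)).
have mX k : jointly_measurable (X k) by exact: measurable_grid.
have g0 k t : (0 <= t)%R -> (0 <= g k t)%R by move=> t0; have [] := grid_itv (N k) t0.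
have gt k t : (0 <= t)%R -> (g k t <= t)%R by move=> t0; have [] := grid_itv (N k) t0.
have close t : (0 <= t)%R -> exists2 C : R, (0 <= C)%R &
    forall k, \int[P]_w ((Z t w - X k t w) ^+ 2)%:E <= (C * 4^-1 ^+ k)%:E.
  move=> t0; have [C C0 HC] := HZ t t0; exists C => // k.
  apply: (le_trans (HC _ _ (g0 k t t0) (gt k t t0) (lexx t))).
  rewrite lee_fin ler_wpM2l//; apply: le_trans (HN k).
  have [_ _ h] := grid_itv (N k) t0.
  by apply: ge0_ler_powR; rewrite ?nnegrE ?subr_ge0 ?gt//; exact: ltW.
have mXt k t : (0 <= t)%R -> measurable_wrt (F t) (X k t).
  by move=> t0; apply: (filtration_wrt_le HF (g0 k t t0) (gt k t t0)); apply: aZ; exact: g0.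
have mXf k t : measurable_fun setT (X k t).
  exact: (measurableT_comp (mX k) (measurable_pair1 t)).
exists (fun t => pointwise_lim (fun k => X k t)); split.
  exact: (@measurable_pointwise_lim _ _ _ (fun k (p : R * Omega) => X k p.1 p.2)).
move=> t t0; split.
  by apply: measurable_wrt_pointwise_lim; [exact: (filtration_sigma_algebra HF t0)|move=> k; exact: mXt].
have [C C0 HC] := close t t0.
by apply: (ae_eq_pointwise_lim C0); [move=> k; exact: mXf|exact: mZ|exact: HC].
Qed.

End modification.

Section mean_sqn.
Local Open Scope ereal_scope.
Context (dd : measure_display) (Omega : measurableType dd) (R : realType)
  (P : probability Omega R) (d : nat).
Implicit Types Z : Omega -> 'rV[R]_d.

Definition mean_sqn (Z : Omega -> 'rV[R]_d) : \bar R := \int[P]_w (sqn (Z w))%:E.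

Lemma mean_sqn_ge0 Z : 0 <= mean_sqn Z.
Proof. by apply: integral_ge0 => w _; rewrite lee_fin sqn_ge0. Qed.

Lemma measurable_coord Z i : measurable_fun setT Z -> measurable_fun setT (fun w => Z w ord0 i).
Proof. by move=> mZ; exact: (measurableT_comp (measurable_row_coord i) mZ). Qed.

Lemma measurable_rowB Z Z' : measurable_fun setT Z -> measurable_fun setT Z' ->
  measurable_fun setT (fun w => Z w - Z' w)%R.
Proof.
move=> mZ mZ'; apply: measurable_fun_row => // i; under eq_fun do rewrite !mxE.
by apply: measurable_funB; exact: measurable_coord.
Qed.

Lemma measurable_sqn_EFin Z : measurable_fun setT Z -> measurable_fun setT (fun w => (sqn (Z w))%:E).
Proof. by move=> mZ; apply/measurable_EFinP; exact: measurableT_comp measurable_sqn mZ. Qed.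

Lemma mean_sqn_sum Z : measurable_fun setT Z ->
  mean_sqn Z = \sum_(i < d) \int[P]_w (Z w ord0 i ^+ 2)%:E.
Proof.
move=> mZ; rewrite -ge0_integral_sum//; last 2 first.
- by move=> i; apply: measurable_sqr_EFin => //; exact: measurable_coord.
- by move=> i w _; rewrite lee_fin sqr_ge0.
by apply: eq_integral => w _; rewrite sumEFin.
Qed.

Lemma mean_sqr_coord_le Z i : measurable_fun setT Z ->
  \int[P]_w (Z w ord0 i ^+ 2)%:E <= mean_sqn Z.
Proof.
move=> mZ; apply: ge0_le_integral => //.
- by move=> w _; rewrite lee_fin sqr_ge0.
- by apply: measurable_sqr_EFin => //; exact: measurable_coord.
- exact: measurable_sqn_EFin.
- by move=> w _; rewrite lee_fin coord_sqr_le.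
Qed.

Lemma mean_sqnB_le Z1 Z2 Z3 :
  measurable_fun setT Z1 -> measurable_fun setT Z2 -> measurable_fun setT Z3 ->
  mean_sqn (fun w => Z1 w - Z2 w)%R <=
  2%:E * mean_sqn (fun w => Z1 w - Z3 w)%R + 2%:E * mean_sqn (fun w => Z3 w - Z2 w)%R.
Proof.
move=> m1 m2 m3.
have m13 := measurable_sqn_EFin (measurable_rowB m1 m3).
have m32 := measurable_sqn_EFin (measurable_rowB m3 m2).
have m12 := measurable_sqn_EFin (measurable_rowB m1 m2).
have p0 Z w : 0 <= (sqn (Z w : 'rV[R]_d))%:E by rewrite lee_fin sqn_ge0.
have p2 : 0 <= (2 : R)%:E by rewrite lee_fin.
rewrite -!ge0_integralZl//; last 2 first.
- by move=> w _; exact: (p0 (fun w => Z3 w - Z2 w)%R).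
- by move=> w _; exact: (p0 (fun w => Z1 w - Z3 w)%R).
rewrite -ge0_integralD//; last 4 first.
- by move=> w _; rewrite mule_ge0// lee_fin sqn_ge0.
- exact: measurable_funeM.
- by move=> w _; rewrite mule_ge0// lee_fin sqn_ge0.
- exact: measurable_funeM.
apply: ge0_le_integral => //.
- by move=> w _; rewrite lee_fin sqn_ge0.
- by apply: emeasurable_funD; exact: measurable_funeM.
- by move=> w _; rewrite -!EFinM -EFinD lee_fin sqnB_le.
Qed.

Lemma mean_sqnN Z Z' : mean_sqn (fun w => Z w - Z' w)%R = mean_sqn (fun w => Z' w - Z w)%R.
Proof. by apply: eq_integral => w _; rewrite -sqnN opprB. Qed.

Lemma mean_sqn_ae_eq Z Z' : measurable_fun setT Z -> measurable_fun setT Z' ->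
  mean_sqn (fun w => Z w - Z' w)%R <= 0 -> {ae P, forall w, Z w = Z' w}.
Proof.
move=> mZ mZ' ZZ0.
have h i : {ae P, forall w, Z w ord0 i = Z' w ord0 i}.
  apply: (@ae_eq_integral_sqr _ _ _ P); [exact: measurable_coord|exact: measurable_coord|].
  apply: le_trans ZZ0; apply: le_trans (mean_sqr_coord_le i (measurable_rowB mZ mZ')).
  by rewrite le_eqVlt; apply/orP; left; apply/eqP; apply: eq_integral => w _; rewrite !mxE.
have ha : {ae P, forall w, forall i, Z w ord0 i = Z' w ord0 i} by exact: filter_forall.
apply: filterS ha => w hw.
by apply/matrixP => i j; rewrite [i]ord1.
Qed.

End mean_sqn.

Section volterra.
Local Open Scope ereal_scope.
Context (dd : measure_display) (Omega : measurableType dd) (R : realType)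
  (P : probability Omega R) (F : R -> set (set Omega)) (W : R -> Omega -> R)
  (d : nat) (alpha : R) (B S : R -> 'rV[R]_d -> 'rV[R]_d) (L : R).
Hypotheses (HF : complete_filtration P F) (HW : brownian_motion P F W).
Hypothesis alpha_itv : (2^-1 < alpha < 1)%R.
Hypotheses (mB : state_measurable B) (mS : state_measurable S) (L0 : (0 <= L)%R).
Hypothesis LB : forall x y (t : R), (0 <= t)%R ->
  (eucl_norm (B t x - B t y) <= L * eucl_norm (x - y))%R.
Hypothesis LS : forall x y (t : R), (0 <= t)%R ->
  (eucl_norm (S t x - S t y) <= L * eucl_norm (x - y))%R.
Local Notation mu := (@lebesgue_measure R).
Local Notation ker := (ker alpha).
Local Notation c := (Gamma alpha)^-1%R.
Local Notation mean_sqn := (mean_sqn P).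
Implicit Types (X Y : R -> Omega -> 'rV[R]_d) (eta zeta : Omega -> 'rV[R]_d).

(* Z is a value at time t of the right-hand side of the equation for X. *)
Definition volterra eta X (t : R) (Z : Omega -> 'rV[R]_d) :=
  (forall i : 'I_d, {ae P, forall w,
    mu.-integrable `[0%R, t] (fun s => (ker (t - s) * nem B X i s w)%:E)}) /\
  exists J : 'I_d -> Omega -> R,
    (forall i, is_ito_integral P F W t (fun s w => ker (t - s) * nem S X i s w)%R (J i)) /\
    {ae P, forall w, forall i, Z w ord0 i = eta w ord0 i +
       c * ((\int[mu]_(s in `[0%R, t]) (ker (t - s) * nem B X i s w)) + J i w)}%R.

Definition drift_dist X Y (i : 'I_d) (s : R) (w : Omega) : R := (nem B X i s w - nem B Y i s w)%R.
Definition noise_dist X Y (i : 'I_d) (s : R) (w : Omega) : R := (nem S X i s w - nem S Y i s w)%R.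

Definition path_conv (T : R) X Y (t : R) (w : Omega) : \bar R :=
  vconv alpha T (fun s => (sqdist X Y s w)%:E) t.

Definition mean_sqdist X Y (s : R) : \bar R := \int[P]_w (sqdist X Y s w)%:E.

Section two_processes.
Variables X Y : R -> Omega -> 'rV[R]_d.
Hypotheses (mX : timely_measurable X) (mY : timely_measurable Y).

Let mXY : measurable_fun setT (fun p : R * Omega => (sqdist X Y p.1 p.2)%:E).
Proof. by apply/measurable_EFinP; exact: measurable_sqdist. Qed.

Let XY0 s w : 0 <= (sqdist X Y s w)%:E. Proof. by rewrite lee_fin sqdist_ge0. Qed.

Lemma measurable_mean_sqdist : measurable_fun setT (mean_sqdist X Y).
Proof.
by apply: (@measurable_mean _ _ _ P (fun p => (sqdist X Y p.1 p.2)%:E)) => // p; exact: XY0.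
Qed.

Lemma mean_sqdist_ge0 s : 0 <= mean_sqdist X Y s.
Proof. by apply: integral_ge0 => w _; exact: XY0. Qed.

Let mpath (t : R) : measurable_fun setT
  (fun p : R * Omega => (ker (t - p.1) ^+ 2)%:E * (sqdist X Y p.1 p.2)%:E).
Proof.
apply: emeasurable_funM => //.
exact: (measurableT_comp (measurable_ker_sqr_shift alpha t) measurable_fst).
Qed.

Lemma measurable_path_conv T t : measurable_fun setT (path_conv T X Y t).
Proof.
apply: (@measurable_time_integral _ _ _ `[0%R, T] (measurable_itv _)
  (fun p => (ker (t - p.1) ^+ 2)%:E * (sqdist X Y p.1 p.2)%:E)) => // p.
by rewrite mule_ge0// lee_fin sqr_ge0.
Qed.

Lemma path_conv_ge0 T t w : 0 <= path_conv T X Y t w.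
Proof. exact: vconv_ge0. Qed.

Lemma mean_path_conv T t :
  \int[P]_w path_conv T X Y t w = vconv alpha T (mean_sqdist X Y) t.
Proof.
rewrite (@time_outcome_tonelli _ _ _ P _ (measurable_itv _)
  (fun p => (ker (t - p.1) ^+ 2)%:E * (sqdist X Y p.1 p.2)%:E)) => //; last first.
  by move=> p; rewrite mule_ge0// lee_fin sqr_ge0.
apply: eq_integral => s _; rewrite /= ge0_integralZl//.
  by apply/measurable_EFinP; exact: (measurableT_comp (measurable_sqdist mX mY) (measurable_pair1 s)).
by rewrite lee_fin sqr_ge0.
Qed.

Lemma sum_nem_conv_le (G : R -> 'rV[R]_d -> 'rV[R]_d) T t w : state_measurable G ->
  (forall x y (t : R), (0 <= t)%R -> (eucl_norm (G t x - G t y) <= L * eucl_norm (x - y))%R) ->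
  \sum_(i < d) \int[mu]_(s in `[0%R, T])
     ((ker (t - s) * (nem G X i s w - nem G Y i s w)) ^+ 2)%:E <= (L ^+ 2)%:E * path_conv T X Y t w.
Proof.
move=> mG LG.
have mD : measurable (`[0%R, T]%classic : set R) by exact: measurable_itv.
have mg i : measurable_fun setT (fun s : R => ((ker (t - s) * (nem G X i s w - nem G Y i s w)) ^+ 2)%:E).
  apply: measurable_sqr_EFin => //; apply: measurable_funM; first exact: measurable_ker_shift.
  apply: measurable_funB.
    exact: (measurableT_comp (measurable_nem i mG mX) (measurable_pair2 w)).
  exact: (measurableT_comp (measurable_nem i mG mY) (measurable_pair2 w)).
rewrite -ge0_integral_sum//; last 2 first.
- by move=> i; apply: measurable_funTS; exact: mg.
- by move=> i s _; rewrite lee_fin sqr_ge0.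
have mq : measurable_fun setT (fun s : R => (ker (t - s) ^+ 2)%:E * (sqdist X Y s w)%:E).
  exact: (measurableT_comp (mpath t) (measurable_pair2 w)).
rewrite /path_conv /vconv -ge0_integralZl//; last 3 first.
- by apply: measurable_funTS; exact: mq.
- by move=> s _; rewrite mule_ge0// lee_fin sqr_ge0.
- by rewrite lee_fin sqr_ge0.
apply: ge0_le_integral => //.
- by move=> s _; apply: sume_ge0 => i _; rewrite lee_fin sqr_ge0.
- by apply: emeasurable_sum => i; apply: measurable_funTS; exact: mg.
- by apply: measurable_funTS; apply: measurable_funeM; exact: mq.
- move=> s _; rewrite sumEFin -!EFinM lee_fin.
  under eq_bigr do rewrite exprMn.
  rewrite -mulr_sumr mulrCA; apply: ler_wpM2l; first exact: sqr_ge0.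
  exact: nem_lipschitz.
Qed.

(** Cauchy-Schwarz against the constant function 1, whence the factor T. The bound holds along every
    path, as the pathwise Gronwall argument requires. *)
Lemma drift_conv_le T t w : (0 <= T)%R ->
  (\sum_(i < d) (\int[mu]_(s in `[0%R, T]) (ker (t - s) * drift_dist X Y i s w)) ^+ 2)%:E <=
  (T * L ^+ 2)%:E * path_conv T X Y t w.
Proof.
move=> T0; have mD : measurable (`[0%R, T]%classic : set R) by exact: measurable_itv.
apply: (@le_trans _ _ (T%:E * \sum_(i < d) \int[mu]_(s in `[0%R, T])
     ((ker (t - s) * drift_dist X Y i s w) ^+ 2)%:E)); last first.
  by rewrite EFinM -muleA; apply: lee_wpmul2l; [rewrite lee_fin|exact: sum_nem_conv_le].
rewrite ge0_sume_distrr; last by move=> i _; exact: integral_sqr_ge0.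
rewrite -sumEFin; apply: lee_sum => i _.
have mg : measurable_fun (`[0%R, T]%classic : set R) (fun s : R => ker (t - s) * drift_dist X Y i s w)%R.
  apply: measurable_funTS; apply: measurable_funM; first exact: measurable_ker_shift.
  apply: measurable_funB.
    exact: (measurableT_comp (measurable_nem i mB mX) (measurable_pair2 w)).
  exact: (measurableT_comp (measurable_nem i mB mY) (measurable_pair2 w)).
have := @sqr_Rintegral_le _ _ _ mu _ mD (cst 1%R) _ (@measurable_cst _ _ _ _ _ _) mg.
have -> : \int[mu]_(x in `[0%R, T]) (cst 1%R x ^+ 2)%:E = T%:E.
  rewrite /= expr1n integral_cst// mul1e /= lebesgue_measure_itv/= lte_fin -EFinB subr0.
  by case: ltP => // T0'; congr EFin; apply/le_anti; rewrite T0 T0'.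
apply: le_trans; rewrite lee_fin le_eqVlt; apply/orP; left; apply/eqP.
by congr (_ ^+ 2)%R; congr fine; apply: eq_integral => s _; rewrite /= mul1r.
Qed.

Lemma noise_conv_le T t (J J' : 'I_d -> Omega -> R) : (0 <= t)%R -> (t <= T)%R ->
  (forall i, is_ito_integral P F W t (fun s w => ker (t - s) * nem S X i s w)%R (J i)) ->
  (forall i, is_ito_integral P F W t (fun s w => ker (t - s) * nem S Y i s w)%R (J' i)) ->
  \sum_(i < d) \int[P]_w ((J i w - J' i w) ^+ 2)%:E <=
  (16 * L ^+ 2)%:E * vconv alpha T (mean_sqdist X Y) t.
Proof.
move=> t0 tT HJ HJ'; have mD : measurable (`[0%R, T]%classic : set R) by exact: measurable_itv.
have mg i : measurable_fun setT (fun p : R * Omega =>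
    ((ker (t - p.1) * (nem S X i p.1 p.2 - nem S Y i p.1 p.2)) ^+ 2)%:E).
  apply: measurable_sqr_EFin => //; apply: measurable_funM.
    exact: (measurableT_comp (measurable_ker_shift alpha t) measurable_fst).
  by apply: measurable_funB; exact: measurable_nem.
have mgi i : measurable_fun setT (fun w => \int[mu]_(s in `[0%R, T])
     ((ker (t - s) * (nem S X i s w - nem S Y i s w)) ^+ 2)%:E).
  by apply: (@measurable_time_integral _ _ _ _ mD (fun p : R * Omega =>
    ((ker (t - p.1) * (nem S X i p.1 p.2 - nem S Y i p.1 p.2)) ^+ 2)%:E)) => // p; rewrite lee_fin sqr_ge0.
apply: (@le_trans _ _ (16%:E * \sum_(i < d) \int[P]_w \int[mu]_(s in `[0%R, T])
     ((ker (t - s) * (nem S X i s w - nem S Y i s w)) ^+ 2)%:E)).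
  rewrite ge0_sume_distrr; last by move=> i _; apply: integral_ge0 => w _; exact: integral_sqr_ge0.
  apply: lee_sum => i _; apply: (le_trans (ito_isometry_le HF HW t0 tT t0 tT (HJ i) (HJ' i))).
  rewrite le_eqVlt; apply/orP; left; apply/eqP; congr (_ * _).
  apply: eq_integral => w _; apply: eq_integral => s; rewrite inE/= in_itv/= => /andP[s0 sT].
  rewrite /cut s0/=; case: leP => st; first by rewrite mulrBr.
  by rewrite ker_neg ?mul0r ?subrr// subr_le0 ltW.
rewrite -ge0_integral_sum//; last by move=> i w _; exact: integral_sqr_ge0.
rewrite EFinM -muleA; apply: lee_wpmul2l => //; rewrite -mean_path_conv -ge0_integralZl//; last 3 first.
- exact: measurable_path_conv.
- by move=> w _; exact: path_conv_ge0.
- by rewrite lee_fin sqr_ge0.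
apply: ge0_le_integral => //.
- by move=> w _; apply: sume_ge0 => i _; exact: integral_sqr_ge0.
- exact: emeasurable_sum.
- by apply: measurable_funeM; exact: measurable_path_conv.
- by move=> w _; exact: sum_nem_conv_le.
Qed.

End two_processes.

(** The factor 3 comes from (x + y + z)^2 <= 3 (x^2 + y^2 + z^2), applied to the initial value, the
    drift and the noise; in K the drift contributes T L^2 and the noise 16 L^2, each times 3 c^2.
    Since [Z] and [Z'] are arbitrary values of the right-hand sides, the estimate serves both for
    two solutions and for consecutive Picard iterates. *)
Lemma volterra_sqdist_le (T : R) : (0 <= T)%R -> exists2 K : R, (0 <= K)%R &
  forall X Y eta zeta t Z Z', timely_measurable X -> timely_measurable Y ->
  measurable_wrt (F 0%R) eta -> measurable_wrt (F 0%R) zeta ->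
  (0 <= t)%R -> (t <= T)%R ->
  measurable_wrt (F t) Z -> measurable_wrt (F t) Z' ->
  volterra eta X t Z -> volterra zeta Y t Z' ->
  mean_sqn (fun w => Z w - Z' w)%R <=
    3%:E * mean_sqn (fun w => eta w - zeta w)%R + K%:E * vconv alpha T (mean_sqdist X Y) t.
Proof.
move=> T0; exists (3 * c ^+ 2 * T * L ^+ 2 + 3 * c ^+ 2 * (16 * L ^+ 2))%R.
  have c2 := sqr_ge0 c; have L2 := sqr_ge0 L.
  have c3 : (0 <= 3 * c ^+ 2)%R by rewrite mulr_ge0.
  by rewrite addr_ge0// mulr_ge0// mulr_ge0.
move=> X Y eta zeta t Z Z' mX mY meta mzeta t0 tT mZ mZ' [iB [J [HJ ZE]]] [iB' [J' [HJ' ZE']]].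
have coord (G : Omega -> 'rV[R]_d) x i : (0 <= x)%R -> measurable_wrt (F x) G -> measurable_fun setT (fun w => G w ord0 i : R).
  by move=> x0 mG; apply: (filtration_fun HF x0); exact: measurable_wrt_coord.
have msqn (G G' : Omega -> 'rV[R]_d) x : (0 <= x)%R -> measurable_wrt (F x) G -> measurable_wrt (F x) G' ->
    measurable_fun setT (fun w => (sqn (G w - G' w))%:E : \bar R).
  move=> x0 mG mG'; apply/measurable_EFinP.
  exact: (measurable_sqnB (F := F) HF (X := fun=> G) (Y := fun=> G') x0).
have mJ i : measurable_fun setT (J i) by have [_ h _] := HJ i; exact: (filtration_fun HF t0).
have mJ' i : measurable_fun setT (J' i) by have [_ h _] := HJ' i; exact: (filtration_fun HF t0).
have mQ := measurable_path_conv mX mY T t.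
have Q0 w : 0 <= path_conv T X Y t w := path_conv_ge0 X Y T t w.
have mJJ i : measurable_fun setT (fun w => ((J i w - J' i w) ^+ 2)%:E : \bar R).
  by apply: measurable_sqr_EFin; exact: measurable_funB.
have c2 : (0 <= 3 * c ^+ 2)%R by rewrite mulr_ge0// sqr_ge0.
have pos3 : (0 <= 3 * c ^+ 2 * T * L ^+ 2)%R by rewrite mulr_ge0 ?sqr_ge0// mulr_ge0.
pose U w := (3%:E * (sqn (eta w - zeta w))%:E + (3 * c ^+ 2 * T * L ^+ 2)%:E * path_conv T X Y t w) +
  (3 * c ^+ 2)%:E * \sum_(i < d) ((J i w - J' i w) ^+ 2)%:E.
apply: (@le_trans _ _ (\int[P]_w U w)).
  apply: ae_ge0_le_integral => //.
  - by move=> w _; rewrite lee_fin sqn_ge0.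
  - exact: (msqn _ _ t).
  - move=> w _; rewrite /U !adde_ge0// mule_ge0//; first by rewrite lee_fin sqn_ge0.
    by apply: sume_ge0 => i _; rewrite lee_fin sqr_ge0.
  - apply: emeasurable_funD; first apply: emeasurable_funD.
    + by apply: measurable_funeM; exact: (msqn _ _ 0%R).
    + exact: measurable_funeM.
    + by apply: measurable_funeM; exact: emeasurable_sum.
  have iBa : {ae P, forall w, forall i, mu.-integrable `[0%R, t] (fun s => (ker (t - s) * nem B X i s w)%:E)}.
    exact: filter_forall.
  have iBa' : {ae P, forall w, forall i, mu.-integrable `[0%R, t] (fun s => (ker (t - s) * nem B Y i s w)%:E)}.
    exact: filter_forall.
  apply: filterS (filterI (filterI iBa iBa') (filterI ZE ZE')) => w [[h1 h2] [h3 h4]] _.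
  pose D i := (\int[mu]_(s in `[0%R, T]) (ker (t - s) * drift_dist X Y i s w))%R.
  have AD i : ((\int[mu]_(s in `[0%R, t]) (ker (t - s) * nem B X i s w)) -
      (\int[mu]_(s in `[0%R, t]) (ker (t - s) * nem B Y i s w)) = D i)%R.
    rewrite -RintegralB; [|exact: measurable_itv|exact: h1|exact: h2].
    congr fine; rewrite (integral_itv_cut tT); last first.
      by move=> s ts; rewrite ker_neg ?mul0r// subr_le0 ltW.
    by apply: eq_integral => s _; rewrite mulrBr.
  apply: (@le_trans _ _ (3 * sqn (eta w - zeta w) + 3 * c ^+ 2 * (\sum_(i < d) D i ^+ 2) +
      3 * c ^+ 2 * (\sum_(i < d) (J i w - J' i w) ^+ 2))%:E).
    rewrite lee_fin /sqn !mulr_sumr -!big_split/=; apply: ler_sum => i _.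
    rewrite 4!mxE h3 h4 -AD.
    set a := (\int[_]_(_ in _) _)%R; set a' := (\int[_]_(_ in _) _)%R.
    rewrite -/a -/a'.
    move: (eta w ord0 i) (zeta w ord0 i) (J i w) (J' i w) => e z j j'.
    rewrite (_ : e + c * (a + j) - (z + c * (a' + j')) = (e - z) + c * (a - a') + c * (j - j'))%R; last by ring.
    rewrite [leRHS](_ : _ = 3 * (e - z) ^+ 2 + 3 * (c * (a - a')) ^+ 2 + 3 * (c * (j - j')) ^+ 2)%R; last by ring.
    move: (e - z)%R (c * (a - a'))%R (c * (j - j'))%R => x y v.
    have := sqr_ge0 (x - y)%R; have := sqr_ge0 (y - v)%R; have := sqr_ge0 (x - v)%R.
    by rewrite !expr2; lra.
  rewrite !EFinD /U; apply: leeD; first apply: leeD.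
  - by rewrite EFinM.
  - rewrite -[(_ * T * _)%R]mulrA EFinM [X in _ <= X * _]EFinM -muleA.
    by apply: lee_wpmul2l => //; exact: drift_conv_le.
  - by rewrite EFinM sumEFin.
rewrite /U ge0_integralD//; last 4 first.
- move=> w _; rewrite adde_ge0// mule_ge0//; by rewrite lee_fin sqn_ge0.
- apply: emeasurable_funD; last exact: measurable_funeM.
  by apply: measurable_funeM; exact: (msqn _ _ 0%R).
- by move=> w _; rewrite mule_ge0//; apply: sume_ge0 => i _; rewrite lee_fin sqr_ge0.
- by apply: measurable_funeM; exact: emeasurable_sum.
rewrite ge0_integralD//; last 4 first.
- by move=> w _; rewrite mule_ge0// lee_fin sqn_ge0.
- by apply: measurable_funeM; exact: (msqn _ _ 0%R).
- by move=> w _; rewrite mule_ge0.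
- exact: measurable_funeM.
rewrite ge0_integralZl//; last 2 first.
- exact: (msqn _ _ 0%R).
- by move=> w _; rewrite lee_fin sqn_ge0.
rewrite ge0_integralZl// mean_path_conv//.
rewrite ge0_integralZl//; last 2 first.
- exact: emeasurable_sum.
- by move=> w _; apply: sume_ge0 => i _; rewrite lee_fin sqr_ge0.
rewrite ge0_integral_sum//; last by move=> i w _; rewrite lee_fin sqr_ge0.
have v0 : 0 <= vconv alpha T (mean_sqdist X Y) t by apply: vconv_ge0; exact: mean_sqdist_ge0.
rewrite [(_ + 3 * _ * (16 * _))%:E]EFinD ge0_muleDl ?lee_fin//; last first.
  by rewrite mulr_ge0// mulr_ge0// sqr_ge0.
rewrite addeA leeD2l// [X in _ <= X * _]EFinM -muleA; apply: lee_wpmul2l => //.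
exact: noise_conv_le.
Qed.

(** * Stability and uniqueness *)

(* Two solutions are not assumed to be bounded in mean square on [0, T], so a
   finiteness statement has to precede the Gronwall argument: this is the role
   of the pathwise estimates below. *)
Section coupled_solutions.
Variables (X Y : R -> Omega -> 'rV[R]_d) (eta zeta : Omega -> 'rV[R]_d).
Hypotheses (mX : timely_measurable X) (mY : timely_measurable Y).
Hypotheses (meta : measurable_wrt (F 0%R) eta) (mzeta : measurable_wrt (F 0%R) zeta).
Hypothesis vX : forall t, (0 <= t)%R -> volterra eta X t (X t).
Hypothesis vY : forall t, (0 <= t)%R -> volterra zeta Y t (Y t).
Hypothesis initial_lty : mean_sqn (fun w => eta w - zeta w)%R < +oo.

Definition noise_msq i (s : R) : \bar R := \int[P]_w (noise_dist X Y i s w ^+ 2)%:E.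

Let mdrift i : jointly_measurable (drift_dist X Y i).
Proof. by apply: measurable_funB; exact: measurable_nem. Qed.

Let mnoise i : jointly_measurable (noise_dist X Y i).
Proof. by apply: measurable_funB; exact: measurable_nem. Qed.

Let mnoise2 i : measurable_fun setT (fun p : R * Omega => (noise_dist X Y i p.1 p.2 ^+ 2)%:E).
Proof. by apply: measurable_sqr_EFin => //; exact: mnoise. Qed.

Let mdriftw i w : measurable_fun setT (fun s : R => drift_dist X Y i s w).
Proof. exact: (measurableT_comp (mdrift i) (measurable_pair2 w)). Qed.

Let mitv (T : R) : measurable (`[0%R, T]%classic : set R).
Proof. exact: measurable_itv. Qed.

Lemma measurable_noise_msq i : measurable_fun setT (noise_msq i).
Proof.
by apply: (@measurable_mean _ _ _ P (fun p => (noise_dist X Y i p.1 p.2 ^+ 2)%:E)) => // p; rewrite lee_fin sqr_ge0.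
Qed.

Lemma noise_msq_ge0 i s : 0 <= noise_msq i s.
Proof. exact: integral_sqr_ge0. Qed.

Lemma mean_noise_conv T t i :
  \int[P]_w \int[mu]_(s in `[0%R, T]) ((ker (t - s) * noise_dist X Y i s w) ^+ 2)%:E =
  vconv alpha T (noise_msq i) t.
Proof.
rewrite (@time_outcome_tonelli _ _ _ P _ (mitv T)
  (fun p => ((ker (t - p.1) * noise_dist X Y i p.1 p.2) ^+ 2)%:E)) => //; last 2 first.
- apply: measurable_sqr_EFin => //; apply: measurable_funM; last exact: mnoise.
  exact: (measurableT_comp (measurable_ker_shift alpha t) measurable_fst).
- by move=> p; rewrite lee_fin sqr_ge0.
apply: eq_integral => s _; rewrite /= -ge0_integralZl//.
- by apply: eq_integral => w _; rewrite exprMn EFinM.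
- by apply: measurable_sqr_EFin => //; exact: (measurableT_comp (mnoise i) (measurable_pair1 s)).
- by move=> w _; rewrite lee_fin sqr_ge0.
- by rewrite lee_fin sqr_ge0.
Qed.

Lemma drift_ae_integrable T i : (0 <= T)%R ->
  {ae P, forall w, \int[mu]_(s in `[0%R, T]) `|drift_dist X Y i s w|%:E < +oo}.
Proof.
move=> T0; have T1 : (0 <= T + 1)%R by lra.
have [iX _] := vX T1; have [iY _] := vY T1.
apply: filterS (filterI (iX i) (iY i)) => w [hX hY].
have /integrableP[_ h] := @integrableB _ _ _ mu _ (mitv _) _ _ hX hY.
apply: (le_lt_trans (integral_le_ker_weight alpha_itv 1 T0 _ _)) => //.
  by apply/measurable_EFinP; apply: measurableT_comp => //; exact: mdriftw.
apply: lte_mul_pinfty; [|by []|].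
  by rewrite lee_fin exprn_ge0// invr_ge0 ker_ge0.
apply: le_lt_trans h; rewrite le_eqVlt; apply/orP; left; apply/eqP; apply: eq_integral => s _.
by rewrite -EFinB /= -mulrBr normrM (ger0_norm (ker_ge0 _ _)) EFinM.
Qed.

(** The Ito integrals in the equation at time T + 1 make the noise square integrable against the
    squared kernel; this weight, with exponent 2, is bounded below on [0, T]. *)
Lemma integral_noise_msq_lty T i : (0 <= T)%R -> \int[mu]_(s in `[0%R, T]) noise_msq i s < +oo.
Proof.
move=> T0; have T1 : (0 <= T + 1)%R by lra.
have [_ [J [HJ _]]] := vX T1; have [_ [J' [HJ' _]]] := vY T1.
have [[_ _ fX] _ _] := HJ i; have [[_ _ fY] _ _] := HJ' i.
apply: (le_lt_trans (integral_le_ker_weight alpha_itv 2 T0 (measurable_noise_msq i) (noise_msq_ge0 i))).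
apply: lte_mul_pinfty; [|by []|].
  by rewrite lee_fin sqr_ge0.
rewrite -[X in X < _]/(vconv alpha (T + 1) (noise_msq i) (T + 1)) -mean_noise_conv.
have mk (G : R -> Omega -> 'rV[R]_d) (mG : timely_measurable G) : jointly_measurable (fun s w => ker (T + 1 - s) * nem S G i s w)%R.
  apply: measurable_funM; last exact: measurable_nem.
  exact: (measurableT_comp (measurable_ker_shift alpha (T + 1)) measurable_fst).
have := @mean_sqrB_le _ _ _ P _ (mitv (T + 1)) (fun s w => ker (T + 1 - s) * nem S X i s w)%R
  (fun s w => ker (T + 1 - s) * nem S Y i s w)%R (fun _ _ => 0%R) (mk _ mX) (mk _ mY) (measurable_cst _).
under [X in X <= _ -> _]eq_integral do under eq_integral do rewrite -mulrBr.
move=> h; apply: (le_lt_trans h).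
have p2 : 0 <= (2 : R)%:E by rewrite lee_fin.
have f2 : (2 : R)%:E \is a fin_num by [].
apply: lte_add_pinfty; apply: (lte_mul_pinfty p2 f2).
- rewrite (eq_integral (fun w => \int[mu]_(s in `[0%R, (T + 1)%R]) ((ker (T + 1 - s) * nem S X i s w) ^+ 2)%:E)).
    exact: fX.
  by move=> w _; apply: eq_integral => s _; rewrite subr0.
- rewrite (eq_integral (fun w => \int[mu]_(s in `[0%R, (T + 1)%R]) ((ker (T + 1 - s) * nem S Y i s w) ^+ 2)%:E)).
    exact: fY.
  by move=> w _; apply: eq_integral => s _; rewrite sub0r sqrrN.
Qed.

(* X - Y minus its drift part: by the equation this is the difference of the
   initial values and of the Ito integrals, whose second moments are under control. *)
Definition residual T i (t : R) (w : Omega) : R :=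
  (nem (fun _ x => x) X i t w - nem (fun _ x => x) Y i t w -
   c * (\int[mu]_(s in `[0%R, T]) (ker (t - s) * drift_dist X Y i s w)))%R.

Lemma measurable_residual T i : jointly_measurable (residual T i).
Proof.
have mid : state_measurable (fun (_ : R) (x : 'rV[R]_d) => x) by apply: measurable_funTS; exact: measurable_snd.
apply: measurable_funB; first by apply: measurable_funB; exact: measurable_nem.
apply: measurable_funM => //.
apply: (@measurable_time_Rintegral _ _ _ `[0%R, T]
  (fun (s : R) (p : R * Omega) => ker (p.1 - s) * drift_dist X Y i s p.2)%R (mitv T)).
apply: measurable_funM.
  apply: (@measurableT_comp _ _ _ _ _ _ ker _ (fun q : R * (R * Omega) => q.2.1 - q.1)%R).
    exact: measurable_ker.
  apply: measurable_funB => //; exact: (measurableT_comp measurable_fst measurable_snd).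
apply: (@measurableT_comp _ _ _ _ _ _ (fun p : R * Omega => drift_dist X Y i p.1 p.2) _
  (fun q : R * (R * Omega) => (q.1, q.2.2))); first exact: mdrift.
by apply: measurable_fun_pair => //; exact: (measurableT_comp measurable_snd measurable_snd).
Qed.

(** On the event where both equations hold the drift parts cancel. The constant 32 is 2, from the
    square of a sum of two terms, times the 16 of [ito_isometry_le]. *)
Lemma mean_sqr_residual_le T t i : (0 <= t)%R -> (t <= T)%R ->
  \int[P]_w (residual T i t w ^+ 2)%:E <=
  2%:E * \int[P]_w ((eta w ord0 i - zeta w ord0 i) ^+ 2)%:E +
  (32 * c ^+ 2)%:E * vconv alpha T (noise_msq i) t.
Proof.
move=> t0 tT; have [iX [J [HJ EX]]] := vX t0; have [iY [J' [HJ' EY]]] := vY t0.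
have mJ : measurable_fun setT (J i) by have [_ h _] := HJ i; exact: (filtration_fun HF t0).
have mJ' : measurable_fun setT (J' i) by have [_ h _] := HJ' i; exact: (filtration_fun HF t0).
have me : measurable_fun setT (fun w => eta w ord0 i).
  by apply: (filtration_fun HF (lexx 0%R)); exact: measurable_wrt_coord.
have mz : measurable_fun setT (fun w => zeta w ord0 i).
  by apply: (filtration_fun HF (lexx 0%R)); exact: measurable_wrt_coord.
have m1 : measurable_fun setT (fun w => ((eta w ord0 i - zeta w ord0 i) ^+ 2)%:E).
  by apply: measurable_sqr_EFin => //; exact: measurable_funB.
have m2 : measurable_fun setT (fun w => ((J i w - J' i w) ^+ 2)%:E).
  by apply: measurable_sqr_EFin => //; exact: measurable_funB.
have c2 : 0 <= (2 * c ^+ 2)%:E by rewrite lee_fin mulr_ge0// sqr_ge0.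
apply: (@le_trans _ _ (\int[P]_w (2%:E * ((eta w ord0 i - zeta w ord0 i) ^+ 2)%:E +
    (2 * c ^+ 2)%:E * ((J i w - J' i w) ^+ 2)%:E))).
  apply: ae_ge0_le_integral => //.
  - by move=> w _; rewrite lee_fin sqr_ge0.
  - by apply: measurable_sqr_EFin => //; exact: (measurableT_comp (measurable_residual T i) (measurable_pair1 t)).
  - by move=> w _; rewrite adde_ge0// mule_ge0// lee_fin sqr_ge0.
  - by apply: emeasurable_funD; exact: measurable_funeM.
  apply: filterS (filterI (filterI (iX i) (iY i)) (filterI EX EY)) => w [[h1 h2] [h3 h4]] _.
  have AD : ((\int[mu]_(s in `[0%R, t]) (ker (t - s) * nem B X i s w)) -
      (\int[mu]_(s in `[0%R, t]) (ker (t - s) * nem B Y i s w)) =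
      \int[mu]_(s in `[0%R, T]) (ker (t - s) * drift_dist X Y i s w))%R.
    rewrite -RintegralB; [|exact: mitv|exact: h1|exact: h2].
    congr fine; rewrite (integral_itv_cut tT); last first.
      by move=> s ts; rewrite ker_neg ?mul0r// subr_le0 ltW.
    by apply: eq_integral => s _; rewrite mulrBr.
  rewrite /residual -AD /nem t0 h3 h4 -!EFinM -EFinD lee_fin.
  move: (\int[_]_(_ in _) _)%R (\int[_]_(_ in _) _)%R (eta w ord0 i) (zeta w ord0 i) (J i w) (J' i w) => a a' e z j j'.
  rewrite (_ : _ - _ = (e - z) + c * (j - j'))%R; last by ring.
  rewrite -[(2 * c ^+ 2 * _)%R]mulrA -exprMn; move: (e - z)%R (c * (j - j'))%R => x y.
  by have := sqr_ge0 (x - y)%R; rewrite !expr2; lra.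
rewrite ge0_integralD//; last 4 first.
- by move=> w _; rewrite mule_ge0// lee_fin sqr_ge0.
- exact: measurable_funeM.
- by move=> w _; rewrite mule_ge0// lee_fin sqr_ge0.
- exact: measurable_funeM.
rewrite !ge0_integralZl//; [|by move=> w _; rewrite lee_fin sqr_ge0..].
rewrite leeD2l// (_ : 32 * c ^+ 2 = 2 * c ^+ 2 * 16)%R; last by ring.
rewrite [X in _ <= X * _]EFinM -muleA; apply: lee_wpmul2l => //.
apply: (le_trans (ito_isometry_le HF HW t0 tT t0 tT (HJ i) (HJ' i))).
rewrite -mean_noise_conv le_eqVlt; apply/orP; left; apply/eqP; congr (_ * _).
apply: eq_integral => w _; apply: eq_integral => s; rewrite inE/= in_itv/= => /andP[s0 sT].
rewrite /cut s0/=; case: leP => st; first by rewrite mulrBr.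
by rewrite ker_neg ?mul0r ?subrr// subr_le0 ltW.
Qed.

(** Young's inequality turns the time integral of the convolution in [mean_sqr_residual_le] into the
    integral of [noise_msq], which is finite. *)
Lemma mean_integral_residual_lty T i : (0 <= T)%R ->
  \int[P]_w \int[mu]_(t in `[0%R, T]) (residual T i t w ^+ 2)%:E < +oo.
Proof.
move=> T0; rewrite (@time_outcome_tonelli _ _ _ P _ (mitv T) (fun p => (residual T i p.1 p.2 ^+ 2)%:E)); last 2 first.
- by apply: measurable_sqr_EFin => //; exact: measurable_residual.
- by move=> p; rewrite lee_fin sqr_ge0.
set a := \int[P]_w ((eta w ord0 i - zeta w ord0 i) ^+ 2)%:E.
have a0 : 0 <= a by exact: integral_sqr_ge0.
have alty : a < +oo.
  apply: le_lt_trans initial_lty; apply: ge0_le_integral => //.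
  - by move=> w _; rewrite lee_fin sqr_ge0.
  - apply: measurable_sqr_EFin => //; apply: measurable_funB; apply: (filtration_fun HF (lexx 0%R));
      exact: measurable_wrt_coord.
  - apply/measurable_EFinP.
    exact: (measurable_sqnB (F := F) HF (X := fun=> eta) (Y := fun=> zeta) (lexx 0%R)).
  - by move=> w _; rewrite lee_fin; have := coord_sqr_le (eta w - zeta w)%R i; rewrite !mxE.
have [C C0 HC] := integral_vconv_le alpha_itv T.
have mv := measurable_vconv alpha T (measurable_noise_msq i) (noise_msq_ge0 i).
have v0 t : 0 <= vconv alpha T (noise_msq i) t by apply: vconv_ge0; exact: noise_msq_ge0.
have c32 : (0 <= 32 * c ^+ 2)%R by rewrite mulr_ge0// sqr_ge0.
apply: (@le_lt_trans _ _ (\int[mu]_(t in `[0%R, T]) (2%:E * a + (32 * c ^+ 2)%:E * vconv alpha T (noise_msq i) t))).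
  apply: ge0_le_integral => //.
  - by move=> t _; exact: integral_sqr_ge0.
  - apply: measurable_funTS.
    apply: (@measurable_mean _ _ _ P (fun p => (residual T i p.1 p.2 ^+ 2)%:E)).
      by apply: measurable_sqr_EFin => //; exact: measurable_residual.
    by move=> p; rewrite lee_fin sqr_ge0.
  - by apply: measurable_funTS; apply: emeasurable_funD => //; exact: measurable_funeM.
  - by move=> t; rewrite /= in_itv/= => /andP[t0 tT]; exact: mean_sqr_residual_le.
rewrite ge0_integralD//; last 3 first.
- by move=> t _; rewrite mule_ge0.
- by move=> t _; rewrite mule_ge0.
- by apply: measurable_funTS; exact: measurable_funeM.
apply: lte_add_pinfty.
  rewrite integral_cst// lte_mul_pinfty// ?mule_ge0//.
  - by rewrite ge0_fin_numE ?mule_ge0// lte_mul_pinfty.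
  - by rewrite /= lebesgue_measure_itv/=; case: ifP => // _; rewrite -EFinB ltry.
rewrite ge0_integralZl//; last exact: measurable_funTS.
apply: lte_mul_pinfty => //; apply: (le_lt_trans (HC _ (measurable_noise_msq i) (noise_msq_ge0 i))).
by apply: lte_mul_pinfty => //; exact: integral_noise_msq_lty.
Qed.

Let residual_sum T (w : Omega) (t : R) : \bar R := 2%:E * \sum_(i < d) (residual T i t w ^+ 2)%:E.

Let drift_conv T i (t : R) (w : Omega) : R :=
  (\int[mu]_(s in `[0%R, T]) (ker (t - s) * drift_dist X Y i s w))%R.

Let mres T w : measurable_fun setT (residual_sum T w).
Proof.
apply: measurable_funeM; apply: emeasurable_sum => i; apply: measurable_sqr_EFin => //.
exact: (measurableT_comp (measurable_residual T i) (measurable_pair2 w)).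
Qed.

Let res0 T w t : 0 <= residual_sum T w t.
Proof. by rewrite mule_ge0// sume_ge0// => i _; rewrite lee_fin sqr_ge0. Qed.

Let integral_residual_sum T w : \int[mu]_(t in `[0%R, T]) residual_sum T w t =
  2%:E * \sum_(i < d) \int[mu]_(t in `[0%R, T]) (residual T i t w ^+ 2)%:E.
Proof.
have mr i : measurable_fun setT (fun t => (residual T i t w ^+ 2)%:E).
  apply: measurable_sqr_EFin => //.
  exact: (measurableT_comp (measurable_residual T i) (measurable_pair2 w)).
have r0 i t : 0 <= (residual T i t w ^+ 2)%:E by rewrite lee_fin sqr_ge0.
rewrite ge0_integralZl//; last 2 first.
- by apply: measurable_funTS; apply: emeasurable_sum => i; exact: mr.
- by move=> t _; exact: sume_ge0.
by rewrite ge0_integral_sum// => i; apply: measurable_funTS; exact: mr.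
Qed.

Let sqdist_residual_le T t w : (0 <= t)%R ->
  (sqdist X Y t w)%:E <= residual_sum T w t +
    (2 * c ^+ 2)%:E * (\sum_(i < d) drift_conv T i t w ^+ 2)%:E.
Proof.
move=> t0; rewrite /residual_sum sumEFin -!EFinM -EFinD lee_fin /sqdist t0 /sqn !mulr_sumr -big_split/=.
apply: ler_sum => i _; rewrite !mxE /residual -/(drift_conv T i t w) /nem t0.
move: (drift_conv T i t w) (X t w ord0 i) (Y t w ord0 i) => n x y.
rewrite -[(2 * c ^+ 2 * _)%R]mulrA -exprMn; move: (c * n)%R => z.
by have := sqr_ge0 ((x - y - z) - z)%R; rewrite !expr2; lra.
Qed.

(** The distance is the residual plus a drift convolution. By [sqr_conv_le] the square of the latter
    is at most the L1 norm of the drift difference times the convolution of its absolute value,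
    which is integrable in time by Young's inequality. *)
Lemma path_integral_lty T w : (0 <= T)%R ->
  (forall i, \int[mu]_(s in `[0%R, T]) `|drift_dist X Y i s w|%:E < +oo) ->
  (forall i, \int[mu]_(t in `[0%R, T]) (residual T i t w ^+ 2)%:E < +oo) ->
  \int[mu]_(t in `[0%R, T]) (sqdist X Y t w)%:E < +oo.
Proof.
move=> T0 Dlty Rlty; have [C C0 HC] := integral_vconv_le alpha_itv T.
have ma i : measurable_fun setT (fun s : R => `|drift_dist X Y i s w|%:E).
  by apply/measurable_EFinP; apply: measurableT_comp => //; exact: mdriftw.
have a0 i s : 0 <= `|drift_dist X Y i s w|%:E by rewrite lee_fin.
have mv i := measurable_vconv alpha T (ma i) (a0 i).
have v0 i t : 0 <= vconv alpha T (fun s => `|drift_dist X Y i s w|%:E) t by exact: vconv_ge0.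
pose n i := fine (\int[mu]_(s in `[0%R, T]) `|drift_dist X Y i s w|%:E).
have n0 i : (0 <= n i)%R by apply: fine_ge0; exact: integral_ge0.
have nE i : \int[mu]_(s in `[0%R, T]) `|drift_dist X Y i s w|%:E = (n i)%:E.
  by rewrite fineK// ge0_fin_numE//; exact: integral_ge0.
have c2 : (0 <= 2 * c ^+ 2)%R by rewrite mulr_ge0// sqr_ge0.
have msum : measurable_fun setT (fun t => \sum_(i < d)
    (n i)%:E * vconv alpha T (fun s => `|drift_dist X Y i s w|%:E) t).
  by apply: emeasurable_sum => i; apply: measurable_funeM; exact: mv.
have sum0 t : 0 <= \sum_(i < d) (n i)%:E * vconv alpha T (fun s => `|drift_dist X Y i s w|%:E) t.
  by apply: sume_ge0 => i _; apply: mule_ge0; [rewrite lee_fin|exact: v0].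
apply: (@le_lt_trans _ _ (\int[mu]_(t in `[0%R, T]) (residual_sum T w t + (2 * c ^+ 2)%:E *
    \sum_(i < d) (n i)%:E * vconv alpha T (fun s => `|drift_dist X Y i s w|%:E) t))).
  apply: ge0_le_integral => //.
  - by move=> t _; rewrite lee_fin sqdist_ge0.
  - apply: measurable_funTS; apply/measurable_EFinP.
    exact: (measurableT_comp (measurable_sqdist mX mY) (measurable_pair2 w)).
  - apply: measurable_funTS; apply: emeasurable_funD; first exact: mres.
    by apply: measurable_funeM; exact: msum.
  - move=> t; rewrite /= in_itv/= => /andP[t0 tT].
    apply: (le_trans (sqdist_residual_le T w t0)); rewrite leeD2l//.
    apply: lee_wpmul2l; first by rewrite lee_fin.
    rewrite -sumEFin; apply: lee_sum => i _; rewrite -nE.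
    exact: (sqr_conv_le alpha T t (mdriftw i w)).
rewrite ge0_integralD//; last 3 first.
- by apply: measurable_funTS; exact: mres.
- by move=> t _; apply: mule_ge0; [rewrite lee_fin|exact: sum0].
- by apply: measurable_funTS; apply: measurable_funeM; exact: msum.
apply: lte_add_pinfty.
  rewrite integral_residual_sum; apply: lte_mul_pinfty => //.
  by apply/lte_sum_pinfty => i _; exact: Rlty.
rewrite ge0_integralZl//; last by apply: measurable_funTS; exact: msum.
apply: lte_mul_pinfty => //.
rewrite ge0_integral_sum//; last 2 first.
- by move=> i; apply: measurable_funTS; apply: measurable_funeM; exact: mv.
- by move=> i t _; apply: mule_ge0; [rewrite lee_fin|exact: v0].
apply/lte_sum_pinfty => i _.
rewrite ge0_integralZl; [|exact: mitv|by apply: measurable_funTS; exact: mv|by move=> t _; exact: v0|by rewrite lee_fin].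
apply: lte_mul_pinfty; [by rewrite lee_fin|by []|]; apply: (le_lt_trans (HC _ (ma i) (a0 i))).
by rewrite nE -EFinM ltry.
Qed.

(** The Gronwall constant does not depend on the path. The inequality obtained along almost every
    path can therefore be integrated over the outcomes, where the right-hand side is finite by
    [mean_integral_residual_lty]. *)
Lemma integral_mean_sqdist_lty T : (0 <= T)%R ->
  \int[mu]_(t in `[0%R, T]) mean_sqdist X Y t < +oo.
Proof.
move=> T0; have A0 : (0 <= 2 * c ^+ 2 * (T * L ^+ 2))%R.
  by rewrite mulr_ge0// mulr_ge0// sqr_ge0.
have [C C0 HC] := gronwall_integral alpha_itv A0 T0.
have msq : measurable_fun setT (fun p : R * Omega => (sqdist X Y p.1 p.2)%:E).
  by apply/measurable_EFinP; exact: measurable_sqdist.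
have sq0 t w : 0 <= (sqdist X Y t w)%:E by rewrite lee_fin sqdist_ge0.
have msqw w : measurable_fun setT (fun t => (sqdist X Y t w)%:E).
  exact: (measurableT_comp msq (measurable_pair2 w)).
have mi i : measurable_fun setT (fun w => \int[mu]_(t in `[0%R, T]) (residual T i t w ^+ 2)%:E).
  apply: (@measurable_time_integral _ _ _ _ (mitv T) (fun p => (residual T i p.1 p.2 ^+ 2)%:E)).
    by apply: measurable_sqr_EFin => //; exact: measurable_residual.
  by move=> p; rewrite lee_fin sqr_ge0.
have i0 i w : 0 <= \int[mu]_(t in `[0%R, T]) (residual T i t w ^+ 2)%:E by exact: integral_sqr_ge0.
have aeD : {ae P, forall w, forall i, \int[mu]_(s in `[0%R, T]) `|drift_dist X Y i s w|%:E < +oo}.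
  by apply: filter_forall => i; exact: drift_ae_integrable.
have aeR : {ae P, forall w, forall i, \int[mu]_(t in `[0%R, T]) (residual T i t w ^+ 2)%:E < +oo}.
  apply: filter_forall => i.
  have : P.-integrable setT (fun w => \int[mu]_(t in `[0%R, T]) (residual T i t w ^+ 2)%:E).
    apply/integrableP; split; first exact: mi.
    apply: le_lt_trans (mean_integral_residual_lty i T0).
    by under eq_integral do rewrite gee0_abs//.
  move=> /(integrable_ae measurableT); apply: filterS => w /(_ Logic.I).
  by rewrite ge0_fin_numE.
rewrite -(@time_outcome_tonelli _ _ _ P _ (mitv T) (fun p => (sqdist X Y p.1 p.2)%:E))//.
apply: (@le_lt_trans _ _ (\int[P]_w (C%:E * (2%:E * \sum_(i < d)
    \int[mu]_(t in `[0%R, T]) (residual T i t w ^+ 2)%:E)))).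
  apply: ae_ge0_le_integral => //.
  - by move=> w _; apply: integral_ge0 => t _; exact: sq0.
  - exact: (@measurable_time_integral _ _ _ _ (mitv T) (fun p => (sqdist X Y p.1 p.2)%:E)).
  - by move=> w _; rewrite !mule_ge0// sume_ge0.
  - by apply: measurable_funeM; apply: measurable_funeM; exact: emeasurable_sum.
  apply: filterS (filterI aeD aeR) => w [hD hR] _.
  rewrite -integral_residual_sum; apply: HC; [exact: msqw|move=> t; exact: sq0|exact: mres|exact: res0|
    exact: path_integral_lty|].
  move=> t t0 tT; apply: (le_trans (sqdist_residual_le T w t0)).
  rewrite addeC leeD2r// [X in _ <= X * _]EFinM -muleA; apply: lee_wpmul2l.
    by rewrite lee_fin mulr_ge0// sqr_ge0.
  exact: drift_conv_le.
rewrite ge0_integralZl//; last 2 first.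
- by apply: measurable_funeM; exact: emeasurable_sum.
- by move=> w _; rewrite mule_ge0// sume_ge0.
apply: lte_mul_pinfty => //; rewrite ge0_integralZl//; last 2 first.
- exact: emeasurable_sum.
- by move=> w _; rewrite sume_ge0.
apply: lte_mul_pinfty => //; rewrite ge0_integral_sum//.
by apply/lte_sum_pinfty => i _; exact: mean_integral_residual_lty.
Qed.

End coupled_solutions.

(** The constant is the one of [gronwall_sup] times the factor 3 of the initial values;
    [integral_mean_sqdist_lty] supplies the finiteness that [gronwall_sup] demands. *)
Lemma volterra_stability (T : R) : (0 <= T)%R -> exists2 K : R, (0 <= K)%R &
  forall X Y eta zeta (a : R), timely_measurable X -> timely_measurable Y ->
  (forall t, (0 <= t)%R -> measurable_wrt (F t) (X t)) ->
  (forall t, (0 <= t)%R -> measurable_wrt (F t) (Y t)) ->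
  measurable_wrt (F 0%R) eta -> measurable_wrt (F 0%R) zeta ->
  (forall t, (0 <= t)%R -> volterra eta X t (X t)) ->
  (forall t, (0 <= t)%R -> volterra zeta Y t (Y t)) ->
  mean_sqn (fun w => eta w - zeta w)%R = a%:E ->
  forall t, (0 <= t)%R -> (t <= T)%R ->
  mean_sqn (fun w => X t w - Y t w)%R <= (K * a)%:E.
Proof.
move=> T0; have [A A0 HA] := volterra_sqdist_le T0.
have [C C0 HC] := gronwall_sup alpha_itv A0 T0.
exists (C * 3)%R; first by rewrite mulr_ge0.
move=> X Y eta zeta a mX mY aX aY meta mzeta vX vY ea t t0 tT.
have e s : (0 <= s)%R -> mean_sqn (fun w => X s w - Y s w)%R = mean_sqdist X Y s.
  by move=> s0; apply: eq_integral => w _; rewrite /sqdist s0.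
have a0 : (0 <= a)%R.
  by rewrite -lee_fin -ea; apply: integral_ge0 => w _; rewrite lee_fin sqn_ge0.
rewrite e// -mulrA; apply: HC => //.
- by rewrite mulr_ge0.
- exact: measurable_mean_sqdist.
- exact: mean_sqdist_ge0.
- by apply: (@integral_mean_sqdist_lty X Y eta zeta) => //; rewrite ea ltry.
- move=> s s0 sT; rewrite -e// addeC EFinM -ea.
  by apply: HA => //; [exact: aX|exact: aY|exact: vX|exact: vY].
Qed.

(** * Existence *)

Section existence.
Variable Sb : R.
Hypothesis Sb0 : (0 <= Sb)%R.
Hypothesis S_bounded : {ae mu, forall s : R, (0 <= s)%R -> (sqn (S s 0%R) <= Sb)%R}.
Hypothesis B_sqr_integrable : forall T : R, \int[mu]_(s in `[0%R, T]) (sqn (B s 0%R))%:E < +oo.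

(** The class in which the Picard iteration runs. The bound of the second moments uniformly on
    bounded intervals goes beyond adaptedness and makes the coefficients along the process square
    integrable. *)
Definition ms_process X := [/\ timely_measurable X,
  forall t, (0 <= t)%R -> measurable_wrt (F t) (X t) &
  forall T, (0 <= T)%R -> exists2 C : R, (0 <= C)%R &
    forall t, (0 <= t)%R -> (t <= T)%R -> mean_sqn (X t) <= C%:E].

Let mitv (T : R) : measurable (`[0%R, T]%classic : set R).
Proof. exact: measurable_itv. Qed.

Lemma growth (G : R -> 'rV[R]_d -> 'rV[R]_d) :
  (forall x y (t : R), (0 <= t)%R -> (eucl_norm (G t x - G t y) <= L * eucl_norm (x - y))%R) ->
  forall t x, (0 <= t)%R -> (sqn (G t x) <= 2 * L ^+ 2 * sqn x + 2 * sqn (G t 0))%R.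
Proof.
move=> LG t x t0; have := sqnD_le (G t x - G t 0)%R (G t 0%R); rewrite subrK => /le_trans; apply.
rewrite lerD2r -mulrA ler_wpM2l// -!sqr_eucl_norm -exprMn.
have := LG x 0%R t t0; rewrite subr0 => h.
by rewrite ler_pXn2r// nnegrE ?mulr_ge0// eucl_norm_ge0.
Qed.

Section one_process.
Variables (X : R -> Omega -> 'rV[R]_d) (T : R).
Hypotheses (gX : ms_process X) (T0 : (0 <= T)%R).

Let mX : timely_measurable X. Proof. by have [] := gX. Qed.

Let mB2 i : measurable_fun setT (fun p : R * Omega => (nem B X i p.1 p.2 ^+ 2)%:E).
Proof. by apply: measurable_sqr_EFin => //; exact: measurable_nem. Qed.

Let sq0 (f : R -> Omega -> R) (p : R * Omega) : 0 <= (f p.1 p.2 ^+ 2)%:E.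
Proof. by rewrite lee_fin sqr_ge0. Qed.

Let msqnX s : (0 <= s)%R -> measurable_fun setT (fun w => (sqn (X s w))%:E).
Proof.
move=> s0; have [_ aX _] := gX; apply/measurable_EFinP.
apply: (measurableT_comp measurable_sqn); apply: (measurable_wrt_fun _ (aX s s0)).
exact: (filtration_measurable HF).
Qed.

Lemma mean_sqr_nem_le (G : R -> 'rV[R]_d -> 'rV[R]_d) : state_measurable G ->
  (forall x y (t : R), (0 <= t)%R -> (eucl_norm (G t x - G t y) <= L * eucl_norm (x - y))%R) ->
  exists2 C : R, (0 <= C)%R & forall i s, (0 <= s)%R -> (s <= T)%R ->
  \int[P]_w (nem G X i s w ^+ 2)%:E <= (C + 2 * sqn (G s 0))%:E.
Proof.
move=> mG LG; have [_ aX HX] := gX; have [C C0 HC] := HX T T0.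
exists (2 * L ^+ 2 * C)%R; first by rewrite mulr_ge0// mulr_ge0// sqr_ge0.
move=> i s s0 sT.
have L2 : (0 <= 2 * L ^+ 2)%R by rewrite mulr_ge0// sqr_ge0.
have g0 : (0 <= 2 * sqn (G s 0))%R by rewrite mulr_ge0// sqn_ge0.
apply: (@le_trans _ _ (\int[P]_w ((2 * L ^+ 2)%:E * (sqn (X s w))%:E + (2 * sqn (G s 0))%:E))).
  apply: ge0_le_integral => //.
  - by move=> w _; rewrite lee_fin sqr_ge0.
  - apply: measurable_sqr_EFin => //.
    exact: (measurableT_comp (measurable_nem i mG mX) (measurable_pair1 s)).
  - by apply: emeasurable_funD => //; apply: measurable_funeM; exact: msqnX.
  - move=> w _; rewrite -EFinM -EFinD lee_fin /nem s0.
    exact: (le_trans (coord_sqr_le _ i) (growth LG _ s0)).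
rewrite ge0_integralD//; last 2 first.
- by move=> w _; rewrite mule_ge0// lee_fin ?sqn_ge0.
- by apply: measurable_funeM; exact: msqnX.
rewrite integral_cst//= probability_setT mule1 EFinD leeD2r//.
rewrite ge0_integralZl//; last 2 first.
- exact: msqnX.
- by move=> w _; rewrite lee_fin sqn_ge0.
by rewrite [leRHS]EFinM lee_wpmul2l ?lee_fin//; exact: HC.
Qed.

(** The weight is left free: it is a shifted kernel when the noise integral is constructed, and a
    difference of two shifted kernels when its increments are estimated. The time integral makes an
    almost everywhere bound on [S s 0] sufficient. *)
Lemma noise_weight_le : exists2 M : R, (0 <= M)%R & forall i (k : R -> R), measurable_fun setT k ->
  \int[P]_w \int[mu]_(s in `[0%R, T]) ((k s * nem S X i s w) ^+ 2)%:E <=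
  M%:E * \int[mu]_(s in `[0%R, T]) (k s ^+ 2)%:E.
Proof.
have [C C0 HC] := mean_sqr_nem_le mS LS.
exists (C + 2 * Sb)%R; first by rewrite addr_ge0// mulr_ge0.
move=> i k mk; rewrite (@time_outcome_tonelli _ _ _ P _ (mitv T) (fun p => ((k p.1 * nem S X i p.1 p.2) ^+ 2)%:E)); last 2 first.
- apply: measurable_sqr_EFin => //; apply: measurable_funM; last exact: measurable_nem.
  exact: (measurableT_comp mk measurable_fst).
- by move=> p; rewrite lee_fin sqr_ge0.
have mk2 : measurable_fun setT (fun s => (k s ^+ 2)%:E) by exact: measurable_sqr_EFin.
have k0 s : 0 <= (k s ^+ 2)%:E by rewrite lee_fin sqr_ge0.
have M0 : (0 <= C + 2 * Sb)%R by rewrite addr_ge0// mulr_ge0.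
rewrite -ge0_integralZl//; last exact: measurable_funTS.
apply: ae_ge0_le_integral => //.
- by move=> s _; exact: integral_sqr_ge0.
- apply: measurable_funTS.
  apply: (@measurable_mean _ _ _ P (fun p => ((k p.1 * nem S X i p.1 p.2) ^+ 2)%:E)).
    apply: measurable_sqr_EFin => //; apply: measurable_funM; last exact: measurable_nem.
    exact: (measurableT_comp mk measurable_fst).
  by move=> p; rewrite lee_fin sqr_ge0.
- by move=> s _; rewrite mule_ge0.
- by apply: measurable_funTS; exact: measurable_funeM.
apply: (@filterS _ _ (ae_filter_ringOfSetsType mu) _ _ _ S_bounded) => s hs; rewrite /= in_itv/= => /andP[s0 sT].
rewrite [leLHS](_ : _ = (k s ^+ 2)%:E * \int[P]_w (nem S X i s w ^+ 2)%:E); last first.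
  rewrite -ge0_integralZl//; last 2 first.
  - by apply: measurable_sqr_EFin => //; exact: (measurableT_comp (measurable_nem i mS mX) (measurable_pair1 s)).
  - by move=> w _; rewrite lee_fin sqr_ge0.
  by apply: eq_integral => w _; rewrite exprMn EFinM.
rewrite muleC; apply: lee_wpmul2r => //; apply: (le_trans (HC i s s0 sT)).
by rewrite lee_fin lerD2l ler_wpM2l// hs.
Qed.

Lemma drift_square_le : exists2 D : R, (0 <= D)%R & forall i,
  \int[P]_w \int[mu]_(s in `[0%R, T]) (nem B X i s w ^+ 2)%:E <= D%:E.
Proof.
have [C C0 HC] := mean_sqr_nem_le mB LB.
have mb0 : measurable_fun (`[0%R, T]%classic : set R) (fun s => (sqn (B s 0%R))%:E).
  apply/measurable_EFinP; apply: measurable_sum => i; apply: measurable_funX.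
  (* Measurability in time of the coefficient at 0 is read off from the superposition with the zero
     process, at an arbitrary outcome. *)
  have mn := @measurable_nem _ Omega R d B (fun _ _ => 0%R) i mB (measurable_cst _).
  have h := measurableT_comp mn (measurable_pair2 (point : Omega)).
  apply: (@eq_measurable_fun _ _ _ _ _ (fun s => nem B (fun _ _ => 0%R) i s (point : Omega))).
    by move=> s; rewrite inE/= in_itv/= /nem => /andP[->].
  exact: measurable_funTS.
have b0 s : 0 <= (sqn (B s 0%R))%:E by rewrite lee_fin sqn_ge0.
pose D := C%:E * mu `[0%R, T] + 2%:E * \int[mu]_(s in `[0%R, T]) (sqn (B s 0%R))%:E.
have D0 : 0 <= D by rewrite adde_ge0// mule_ge0// integral_ge0.
have Dlty : D < +oo.
  apply: lte_add_pinfty; apply: lte_mul_pinfty => //.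
  by rewrite /= lebesgue_measure_itv/=; case: ifP => // _; rewrite -EFinB ltry.
exists (fine D); first exact: fine_ge0.
move=> i; rewrite fineK ?ge0_fin_numE// (@time_outcome_tonelli _ _ _ P _ (mitv T) (fun p => (nem B X i p.1 p.2 ^+ 2)%:E))//.
apply: (@le_trans _ _ (\int[mu]_(s in `[0%R, T]) (C%:E + 2%:E * (sqn (B s 0%R))%:E))).
  apply: ge0_le_integral => //.
  - by move=> s _; exact: integral_sqr_ge0.
  - apply: measurable_funTS; apply: (@measurable_mean _ _ _ P (fun p => (nem B X i p.1 p.2 ^+ 2)%:E)) => //.
  - by apply: emeasurable_funD => //; exact: measurable_funeM.
  - by move=> s; rewrite /= in_itv/= => /andP[s0 sT]; rewrite -EFinM -EFinD; exact: HC.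
rewrite ge0_integralD//; last 2 first.
- by move=> s _; rewrite mule_ge0.
- exact: measurable_funeM.
by rewrite integral_cst// ge0_integralZl//.
Qed.

End one_process.

(** The noise integrand has finite second moment by [noise_weight_le], and [time_integral_wrt] makes
    the drift integral adapted. The drift integrand is integrable along almost every path because
    both of its factors are square integrable there. *)
Lemma volterra_exists X eta t : ms_process X -> measurable_wrt (F 0%R) eta -> (0 <= t)%R ->
  exists Z, measurable_wrt (F t) Z /\ volterra eta X t Z.
Proof.
move=> gX meta t0; have [mX aX _] := gX.
have [M M0 HM] := noise_weight_le gX t0; have [D D0 HD] := drift_square_le gX t0.
have sg := filtration_sigma_algebra HF t0.
have mk : measurable_fun setT (fun s : R => ker (t - s)) by exact: measurable_ker_shift.
have kf : \int[mu]_(s in `[0%R, t]) (ker (t - s) ^+ 2)%:E < +oo.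
  by rewrite integral_sqr_ker//; exact: ker_mass_lty.
have HJ i : exists I, is_ito_integral P F W t (fun s w => ker (t - s) * nem S X i s w)%R I.
  apply: (ito_exists HF HW t0).
  - apply: measurable_funM; last exact: measurable_nem.
    exact: (measurableT_comp mk measurable_fst).
  - move=> s s0 st; apply: measurable_wrtM; first exact: (filtration_sigma_algebra HF s0).
      by apply: measurable_wrt_cst; exact: (filtration_sigma_algebra HF s0).
    by apply: (nem_wrt HF) => //; exact: aX.
  - by apply: (le_lt_trans (HM i _ mk)); apply: lte_mul_pinfty.
have [J HJJ] := choice HJ.
have fB i : \int[P]_w \int[mu]_(s in `[0%R, t]) (nem B X i s w ^+ 2)%:E < +oo.
  by apply: (le_lt_trans (HD i)); rewrite ltry.
pose A i w := (\int[mu]_(s in `[0%R, t]) (ker (t - s) * nem B X i s w))%R.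
have mA i : measurable_wrt (F t) (A i).
  apply: (time_integral_wrt HF t0 _ mk) => //; first exact: measurable_nem.
  by move=> s s0 st; apply: (nem_wrt HF) => //; exact: aX.
exists (fun w => \row_i (eta w ord0 i + c * (A i w + J i w))%R); split.
  apply: measurable_wrt_row => // i.
  under eq_fun do rewrite mxE.
  apply: measurable_wrtD => //.
    by apply: (filtration_wrt_le HF (lexx 0%R) t0); exact: measurable_wrt_coord.
  apply: measurable_wrtM => //; first exact: measurable_wrt_cst.
  by apply: measurable_wrtD => //; have [] := HJJ i.
split; last first.
  exists J; split => //; apply: nearW => w i; by rewrite mxE.
move=> i.
have mi : measurable_fun setT (fun w => \int[mu]_(s in `[0%R, t]) (nem B X i s w ^+ 2)%:E).
  apply: (@measurable_time_integral _ _ _ _ (mitv t) (fun p => (nem B X i p.1 p.2 ^+ 2)%:E)).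
    by apply: measurable_sqr_EFin => //; exact: measurable_nem.
  by move=> p; rewrite lee_fin sqr_ge0.
have : P.-integrable setT (fun w => \int[mu]_(s in `[0%R, t]) (nem B X i s w ^+ 2)%:E).
  apply/integrableP; split; first exact: mi.
  apply: le_lt_trans (fB i).
  by under eq_integral do rewrite gee0_abs ?integral_sqr_ge0//.
move=> /(integrable_ae measurableT); apply: filterS => w /(_ Logic.I).
rewrite ge0_fin_numE ?integral_sqr_ge0// => hw.
apply: (@integrable_mul_sqr _ _ _ mu _ (mitv t)) => //.
- exact: measurable_funTS.
- apply: measurable_funTS.
  exact: (measurableT_comp (measurable_nem i mB mX) (measurable_pair2 w)).
Qed.

Let wrt_fun t (Z : Omega -> 'rV[R]_d) : (0 <= t)%R -> measurable_wrt (F t) Z -> measurable_fun setT Z.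
Proof. by move=> t0; apply: measurable_wrt_fun; exact: (filtration_measurable HF). Qed.

Lemma volterra_ae eta X t Z Z' : {ae P, forall w, Z w = Z' w} ->
  volterra eta X t Z -> volterra eta X t Z'.
Proof.
move=> ZZ [iB [J [HJ EJ]]]; split => //; exists J; split => //.
by apply: filterS (filterI ZZ EJ) => w [<- h].
Qed.

(** All kernel values vanish at t = 0. Thus [eta] is the value at time 0, and second moments can be
    bounded through the increment from there. *)
Lemma volterra0 eta X : volterra eta X 0%R eta.
Proof.
have k0 s : (0 <= s)%R -> ker (0 - s) = 0%R by move=> s0; rewrite ker_neg// sub0r oppr_le0.
split=> [i|].
  apply: nearW => w; apply: (@eq_integrable _ _ _ mu _ (mitv 0%R) (cst 0)); last exact: integrable0.
  by move=> s; rewrite inE/= in_itv/= => /andP[s0 _]; rewrite k0// mul0r.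
exists (fun _ _ => 0%R); split.
  move=> i; apply: (@ito_integral_ext _ _ _ P F W 0%R (fun _ _ => 0%R)); last exact: ito_integral0.
  by move=> s w s0 _; rewrite k0// mul0r.
apply: nearW => w i; rewrite /Rintegral integral0_eq ?addr0 ?mulr0 ?addr0//.
by move=> s; rewrite /= in_itv/= => /andP[s0 _]; rewrite k0// mul0r.
Qed.

(* Hoelder continuity in mean square of order alpha - 1/2, which yields a
   measurable adapted modification. *)
Lemma volterra_increment_le X T : ms_process X -> (0 <= T)%R -> exists2 C : R, (0 <= C)%R &
  forall eta s t Z Z' i, measurable_wrt (F 0%R) eta -> (0 <= s)%R -> (s <= t)%R -> (t <= T)%R ->
  measurable_wrt (F t) Z -> measurable_wrt (F s) Z' ->
  volterra eta X t Z -> volterra eta X s Z' ->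
  \int[P]_w ((Z w ord0 i - Z' w ord0 i) ^+ 2)%:E <= C%:E * ker_mass alpha (t - s).
Proof.
move=> gX T0; have [mX aX _] := gX.
have [M M0 HM] := noise_weight_le gX T0.
have [D D0 HD] := drift_square_le gX T0.
(* Both terms carry 2 c^2 from the square of a sum and a 2 from [integral_sqr_kerB]; the noise has
   in addition the 16 of the isometry. *)
exists (4 * c ^+ 2 * D + 64 * c ^+ 2 * M)%R.
  by rewrite addr_ge0// mulr_ge0// mulr_ge0// sqr_ge0.
move=> eta s t Z Z' i meta s0 st tT mZ mZ' [iB [J [HJ EJ]]] [iB' [J' [HJ' EJ']]].
have t0 := le_trans s0 st; have sT := le_trans st tT.
have mJ : measurable_fun setT (J i) by have [_ h _] := HJ i; exact: (filtration_fun HF t0).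
have mJ' : measurable_fun setT (J' i) by have [_ h _] := HJ' i; exact: (filtration_fun HF s0).
pose k r := (ker (t - r) - ker (s - r))%R.
have mk : measurable_fun setT k by apply: measurable_funB; exact: measurable_ker_shift.
have mQ : measurable_fun setT (fun w => \int[mu]_(r in `[0%R, T]) (nem B X i r w ^+ 2)%:E).
  apply: (@measurable_time_integral _ _ _ _ (mitv T) (fun p => (nem B X i p.1 p.2 ^+ 2)%:E)).
    by apply: measurable_sqr_EFin => //; exact: measurable_nem.
  by move=> p; rewrite lee_fin sqr_ge0.
have Q0 w : 0 <= \int[mu]_(r in `[0%R, T]) (nem B X i r w ^+ 2)%:E by exact: integral_sqr_ge0.
have m2 : measurable_fun setT (fun w => ((J i w - J' i w) ^+ 2)%:E).
  by apply: measurable_sqr_EFin => //; exact: measurable_funB.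
set km := ker_mass alpha (t - s).
have km0 : 0 <= km := ker_mass_ge0 alpha (t - s).
have kmlty : km < +oo := ker_mass_lty alpha_itv (t - s).
have kmE : (fine km)%:E = km by rewrite fineK// ge0_fin_numE.
have fkm0 : (0 <= fine km)%R by exact: fine_ge0.
have c2 : (0 <= 2 * c ^+ 2)%R by rewrite mulr_ge0// sqr_ge0.
have kk : \int[mu]_(r in `[0%R, T]) (k r ^+ 2)%:E <= 2%:E * km by exact: integral_sqr_kerB.
have c4 : (0 <= 4 * c ^+ 2 * fine km)%R by rewrite mulr_ge0// mulr_ge0// sqr_ge0.
apply: (@le_trans _ _ (\int[P]_w ((4 * c ^+ 2 * fine km)%:E * \int[mu]_(r in `[0%R, T]) (nem B X i r w ^+ 2)%:E +
    (2 * c ^+ 2)%:E * ((J i w - J' i w) ^+ 2)%:E))).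
  apply: ae_ge0_le_integral => //.
  - by move=> w _; rewrite lee_fin sqr_ge0.
  - apply: measurable_sqr_EFin => //; apply: measurable_funB.
      by apply: measurable_coord; exact: (wrt_fun t0).
    by apply: measurable_coord; exact: (wrt_fun s0).
  - by move=> w _; rewrite adde_ge0// mule_ge0// lee_fin sqr_ge0.
  - by apply: emeasurable_funD; exact: measurable_funeM.
  apply: filterS (filterI (filterI (iB i) (iB' i)) (filterI EJ EJ')) => w [[h1 h2] [h3 h4]] _.
  have cutv (x : R) (f : R -> R) r : (x < r)%R -> (ker (x - r) * f r)%:E = 0.
    by move=> xr; rewrite ker_neg ?mul0r// subr_le0 ltW.
  have h1' := (integrable_itv_cut tT (cutv t (nem B X i ^~ w))).2 h1.
  have h2' := (integrable_itv_cut sT (cutv s (nem B X i ^~ w))).2 h2.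
  have AD : ((\int[mu]_(r in `[0%R, t]) (ker (t - r) * nem B X i r w)) -
      (\int[mu]_(r in `[0%R, s]) (ker (s - r) * nem B X i r w)) =
      \int[mu]_(r in `[0%R, T]) (k r * nem B X i r w))%R.
    rewrite /Rintegral -(integral_itv_cut tT (cutv t (nem B X i ^~ w))).
    rewrite -(integral_itv_cut sT (cutv s (nem B X i ^~ w))).
    rewrite -[LHS]RintegralB; [|exact: mitv|exact: h1'|exact: h2'].
    by congr fine; apply: eq_integral => r _; rewrite mulrBl.
  rewrite h3 h4.
  have sq := @sqr_Rintegral_le _ _ _ mu _ (mitv T) k (nem B X i ^~ w) (measurable_funTS mk)
    (measurable_funTS (measurableT_comp (measurable_nem i mB mX) (measurable_pair2 w))).
  apply: (@le_trans _ _ ((2 * c ^+ 2)%:E * ((\int[mu]_(r in `[0%R, T]) (k r * nem B X i r w))%R ^+ 2)%:E +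
     (2 * c ^+ 2)%:E * ((J i w - J' i w) ^+ 2)%:E)).
    rewrite -!EFinM -EFinD lee_fin -AD.
    move: (\int[_]_(_ in _) _)%R (\int[_]_(_ in _) _)%R (eta w ord0 i) (J i w) (J' i w) => a' a e j j'.
    rewrite (_ : _ - _ = c * (a - a') + c * (j - j'))%R; last by ring.
    rewrite [leRHS](_ : _ = 2 * (c * (a - a')) ^+ 2 + 2 * (c * (j - j')) ^+ 2)%R; last by ring.
    move: (c * (a - a'))%R (c * (j - j'))%R => x y.
    by have := sqr_ge0 (x - y)%R; rewrite !expr2; lra.
  rewrite leeD2r//; apply: le_trans (lee_wpmul2l _ sq) _; first by rewrite lee_fin.
  rewrite (_ : 4 * c ^+ 2 * fine km = 2 * c ^+ 2 * (2 * fine km))%R; last by ring.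
  rewrite [X in _ <= X * _]EFinM -muleA; apply: lee_wpmul2l; first by rewrite lee_fin.
  by apply: lee_wpmul2r => //; rewrite EFinM kmE.
rewrite ge0_integralD//; last 4 first.
- by move=> w _; rewrite mule_ge0.
- exact: measurable_funeM.
- by move=> w _; rewrite mule_ge0// lee_fin sqr_ge0.
- exact: measurable_funeM.
rewrite !ge0_integralZl//; last by move=> w _; rewrite lee_fin sqr_ge0.
have noise : \int[P]_w ((J i w - J' i w) ^+ 2)%:E <= (32 * M * fine km)%:E.
  apply: (le_trans (ito_isometry_le HF HW t0 tT s0 sT (HJ i) (HJ' i))).
  apply: (@le_trans _ _ (16%:E * (M%:E * (2%:E * km)))); last first.
    by rewrite -kmE -!EFinM lee_fin le_eqVlt; apply/orP; left; apply/eqP; ring.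
  apply: lee_wpmul2l => //.
  apply: le_trans (le_trans (HM i k mk) _); last by apply: lee_wpmul2l; [rewrite lee_fin|].
  rewrite le_eqVlt; apply/orP; left; apply/eqP.
  apply: eq_integral => w _; apply: eq_integral => r; rewrite inE/= in_itv/= => /andP[r0 rT].
  congr (_ ^+ 2)%:E; rewrite /cut r0/= /k mulrBl; congr (_ - _)%R.
    by case: leP => // tr; rewrite ker_neg ?mul0r// subr_le0 ltW.
  by case: leP => // tr; rewrite ker_neg ?mul0r// subr_le0 ltW.
apply: (@le_trans _ _ ((4 * c ^+ 2 * fine km)%:E * D%:E + (2 * c ^+ 2)%:E * (32 * M * fine km)%:E)).
  by apply: leeD; apply: lee_wpmul2l => //; rewrite lee_fin.
by rewrite -kmE -!EFinM -EFinD lee_fin le_eqVlt; apply/orP; left; apply/eqP; ring.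
Qed.

Let p2 : 0 <= (2 : R)%:E. Proof. by rewrite lee_fin. Qed.

Lemma timely_row (f : 'I_d -> R -> Omega -> R) : (forall i, jointly_measurable (f i)) ->
  timely_measurable (fun t w => \row_i f i t w).
Proof.
move=> mf; apply: measurable_fun_row.
  by apply: measurableX => //; exact: measurable_itv.
move=> i; rewrite (_ : (fun p => _) = (fun p : R * Omega => f i p.1 p.2)); last first.
  by apply/funext => p; rewrite mxE.
by apply: measurable_funTS; exact: mf.
Qed.

(** The values [Z t] are chosen independently for each t. Their coordinatewise modification still
    solves the equation, because [volterra] sees the value at time t only up to a null set. *)
Lemma volterra_step X eta : ms_process X -> measurable_wrt (F 0%R) eta -> mean_sqn eta < +oo ->
  exists X', ms_process X' /\ forall t, (0 <= t)%R -> volterra eta X t (X' t).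
Proof.
move=> gX meta eta2.
have b0 : (0 < 2 * alpha - 1)%R by move: alpha_itv => a12; lra.
(* The condition on t stands inside the existential, so that [choice] applies to all real t. *)
have exZ t : exists Z, (0 <= t)%R -> measurable_wrt (F t) Z /\ volterra eta X t Z.
  have [t0|_] := leP 0%R t; last by exists (fun=> 0%R).
  have [Z HZ] := volterra_exists gX meta t0.
  by exists Z.
have [Z HZ] := choice exZ.
have aZ t : (0 <= t)%R -> measurable_wrt (F t) (Z t) by move=> /HZ[].
have vZ t : (0 <= t)%R -> volterra eta X t (Z t) by move=> /HZ[].
(* The mean square increments over an interval of length r are of order r^(2 alpha - 1), by
   [volterra_increment_le] and [ker_mass_le]. *)
have exX i : exists Xi : R -> Omega -> R, jointly_measurable Xi /\
    forall t, (0 <= t)%R -> measurable_wrt (F t) (Xi t) /\ {ae P, forall w, Xi t w = Z t w ord0 i}.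
  apply: (measurable_adapted_modification HF b0 (Z := fun t w => Z t w ord0 i)).
    by move=> t t0; apply: measurable_wrt_coord; exact: aZ.
  move=> T T0; have [C C0 HC] := volterra_increment_le gX T0.
  exists (C * (2 * alpha - 1)^-1)%R; first by rewrite mulr_ge0// invr_ge0 ltW.
  move=> s t s0 st tT; have t0 := le_trans s0 st.
  apply: (le_trans (HC eta s t (Z t) (Z s) i meta s0 st tT (aZ t t0) (aZ s s0) (vZ t t0) (vZ s s0))).
  rewrite -mulrA EFinM; apply: lee_wpmul2l; first by rewrite lee_fin.
  by apply: ker_mass_le => //; rewrite subr_ge0.
have [Xi HXi] := choice exX.
have mXi i : jointly_measurable (Xi i) by have [] := HXi i.
pose X' t w : 'rV[R]_d := \row_i Xi i t w.
have eX t : (0 <= t)%R -> {ae P, forall w, Z t w = X' t w}.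
  move=> t0; have ha : {ae P, forall w, forall i, Xi i t w = Z t w ord0 i}.
    by apply: filter_forall => i; have [_ /(_ t t0)[]] := HXi i.
  by apply: filterS ha => w hw; apply/matrixP => i j; rewrite [i]ord1 mxE hw.
have aX' t : (0 <= t)%R -> measurable_wrt (F t) (X' t).
  by move=> t0; exact: (measurable_wrt_ae HF t0 (eX t t0) (aZ t t0)).
have vX' t : (0 <= t)%R -> volterra eta X t (X' t).
  by move=> t0; exact: (volterra_ae (eX t t0) (vZ t t0)).
exists X'; split => //; split => //; first exact: timely_row.
move=> T T0.
(* The second moment of [X' t] is bounded by that of [eta] and that of the increment from time 0,
   which is at most C times the kernel mass on [0, T]. *)
have v0 : volterra eta X 0%R eta by exact: volterra0.
have [C C0 HC] := volterra_increment_le gX T0.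
have km0 : 0 <= ker_mass alpha T := ker_mass_ge0 alpha T.
have kmE : (fine (ker_mass alpha T))%:E = ker_mass alpha T.
  by rewrite fineK// ge0_fin_numE// ker_mass_lty.
have etaE : (fine (mean_sqn eta))%:E = mean_sqn eta.
  by rewrite fineK// ge0_fin_numE// mean_sqn_ge0.
have meta' := wrt_fun (lexx 0%R) meta.
exists (2 * (d%:R * (C * fine (ker_mass alpha T))) + 2 * fine (mean_sqn eta))%R.
  by rewrite addr_ge0// mulr_ge0// ?mulr_ge0// fine_ge0// mean_sqn_ge0.
move=> t t0 tT; have mX't := wrt_fun t0 (aX' t t0).
have := @mean_sqnB_le _ _ _ P d (X' t) (fun=> 0%R) eta mX't (measurable_cst _) meta'.
rewrite (_ : (fun w => X' t w - 0)%R = X' t); last by apply/funext => w; rewrite subr0.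
rewrite (_ : (fun w => eta w - 0)%R = eta); last by apply/funext => w; rewrite subr0.
move=> h; apply: (le_trans h); rewrite [leRHS]EFinD; apply: leeD; last by rewrite EFinM etaE.
rewrite EFinM; apply: lee_wpmul2l => //.
rewrite mean_sqn_sum; last exact: measurable_rowB.
rewrite EFinM EFinM kmE.
apply: (@le_trans _ _ (\sum_(i < d) C%:E * ker_mass alpha T)).
  apply: lee_sum => i _; under eq_integral do rewrite !mxE -/(X' t).
  have := HC eta 0%R t (X' t) eta i meta (lexx 0%R) t0 tT (aX' t t0) meta (vX' t t0) v0.
  move=> hh; apply: le_trans (le_trans hh _).
    by rewrite le_eqVlt; apply/orP; left; apply/eqP; apply: eq_integral => w _; rewrite mxE.
  apply: lee_wpmul2l; first by rewrite lee_fin.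
  by apply: ker_mass_nd; rewrite subr0.
by rewrite -kmE -!EFinM sumEFin lee_fin sumr_const card_ord mulr_natl.
Qed.

Lemma volterra_solution_exists eta : measurable_wrt (F 0%R) eta -> mean_sqn eta < +oo ->
  exists X, ms_process X /\ forall t, (0 <= t)%R -> volterra eta X t (X t).
Proof.
move=> meta eta2; have meta' := wrt_fun (lexx 0%R) meta.
have [Phi HPhi] : exists Phi : (R -> Omega -> 'rV[R]_d) -> (R -> Omega -> 'rV[R]_d),
    forall X, ms_process X -> ms_process (Phi X) /\ forall t, (0 <= t)%R -> volterra eta X t (Phi X t).
  pose Q (X X' : R -> Omega -> 'rV[R]_d) :=
    ms_process X -> ms_process X' /\ forall t, (0 <= t)%R -> volterra eta X t (X' t).
  suff : forall X, exists X', Q X X' by move=> /choice[Phi HPhi]; exists Phi; exact: HPhi.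
  move=> X; have [gX|nX] := pselect (ms_process X); last by exists X.
  by have [X' h] := volterra_step gX meta eta2; exists X'.
have etaE : (fine (mean_sqn eta))%:E = mean_sqn eta.
  by rewrite fineK// ge0_fin_numE// mean_sqn_ge0.
(* The Picard iterates, started from the process constantly equal to [eta]. *)
pose x n := iter n Phi (fun _ => eta).
have gx n : ms_process (x n).
  elim: n => [|n IH]; last by have [] := HPhi _ IH.
  split.
  - by apply: measurable_funTS; exact: (measurableT_comp meta' measurable_snd).
  - by move=> t t0; apply: measurable_wrt_sub meta; exact: (filtration_nondecreasing HF).
  - move=> T T0; exists (fine (mean_sqn eta)); first exact/fine_ge0/mean_sqn_ge0.
    by move=> t _ _; rewrite etaE.
have mx n : timely_measurable (x n) by have [] := gx n.
have ax n t : (0 <= t)%R -> measurable_wrt (F t) (x n t) by have [_ h _] := gx n; exact: h.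
have mxt n t : (0 <= t)%R -> measurable_fun setT (x n t) by move=> t0; exact: (wrt_fun t0 (ax n t t0)).
have vx n t : (0 <= t)%R -> volterra eta (x n) t (x n.+1 t).
  by have [_ h] := HPhi _ (gx n); exact: h.
have dist Y Y' t : (0 <= t)%R -> mean_sqdist Y Y' t = mean_sqn (fun w => Y t w - Y' t w)%R.
  by move=> t0; apply: eq_integral => w _; rewrite /sqdist t0.
have contr T : (0 <= T)%R -> exists2 C : R, (0 <= C)%R & forall n t, (0 <= t)%R -> (t <= T)%R ->
    mean_sqn (fun w => x n.+1 t w - x n t w)%R <= (C * 4^-1 ^+ n)%:E.
  move=> T0; have [A A0 HA] := volterra_sqdist_le T0.
  have [l l0 Hl] := damping alpha_itv T A0.
  have [_ _ /(_ T T0)[C0 C00 HC0]] := gx 0%N; have [_ _ /(_ T T0)[C1 C10 HC1]] := gx 1%N.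
  (* Bounds the mean square distance of the first two iterates on [0, T]. *)
  pose K := (2 * C1 + 2 * C0)%R.
  have K0 : (0 <= K)%R by rewrite addr_ge0// mulr_ge0.
  (* The weight exp (l t) is carried through the induction: the next distance is at most A times the
     convolution of the current one, and [vconv_exp] gains the factor 1/4. *)
  have main n t : (0 <= t)%R -> (t <= T)%R ->
      mean_sqdist (x n.+1) (x n) t <= (K * 4^-1 ^+ n * expR (l * t))%:E.
    elim: n t => [|n IH] t t0 tT.
      rewrite dist// expr0 mulr1; apply: (@le_trans _ _ K%:E); last first.
        by rewrite lee_fin ler_peMr// -expR0 ler_expR mulr_ge0.
      apply: (le_trans (mean_sqnB_le P (mxt 1%N t t0) (mxt 0%N t t0) (measurable_cst (0%R : 'rV[R]_d)))).
      rewrite /K [leRHS]EFinD; apply: leeD; rewrite [leRHS]EFinM; apply: lee_wpmul2l => //.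
        by under eq_fun do rewrite subr0; exact: HC1.
      rewrite mean_sqnN (_ : (fun w => _) = x 0%N t); first exact: HC0.
      by apply/funext => w; rewrite subr0.
    rewrite dist//.
    have := HA (x n.+1) (x n) eta eta t (x n.+2 t) (x n.+1 t) (mx _) (mx _) meta meta t0 tT
      (ax _ t t0) (ax _ t t0) (vx n.+1 t t0) (vx n t t0).
    rewrite (_ : mean_sqn (fun w => eta w - eta w)%R = 0); last first.
      by apply: integral0_eq => w _; rewrite subrr /sqn big1// => i _; rewrite mxE expr0n.
    rewrite mule0 add0e => h; apply: (le_trans h).
    have me : measurable_fun setT (fun s : R => (expR (l * s))%:E).
      by apply/measurable_EFinP; apply: measurableT_comp => //; exact: measurable_funM.
    have e0 s : 0 <= (expR (l * s))%:E :> \bar R by rewrite lee_fin expR_ge0.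
    have z0 : (0 <= K * 4^-1 ^+ n :> R)%R by rewrite mulr_ge0// exprn_ge0// invr_ge0.
    apply: (@le_trans _ _ (A%:E * vconv alpha T (fun s => (K * 4^-1 ^+ n)%:E * (expR (l * s))%:E) t)).
      apply: lee_wpmul2l; first by rewrite lee_fin.
      apply: le_vconv.
      - exact: measurable_mean_sqdist.
      - exact: measurable_funeM.
      - exact: mean_sqdist_ge0.
      - by move=> s s0 sT; rewrite -EFinM; exact: IH.
    rewrite vconvZ// muleCA.
    apply: (@le_trans _ _ ((K * 4^-1 ^+ n)%:E * (4^-1 * expR (l * t))%:E)).
      by apply: lee_wpmul2l; [rewrite lee_fin|exact: vconv_exp].
    by rewrite -EFinM lee_fin exprS le_eqVlt; apply/orP; left; apply/eqP; ring.
  exists (K * expR (l * T))%R; first by rewrite mulr_ge0// expR_ge0.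
  move=> n t t0 tT; rewrite -dist//; apply: (le_trans (main n t t0 tT)).
  rewrite lee_fin -!mulrA ler_wpM2l// mulrC ler_wpM2r ?exprn_ge0 ?invr_ge0//.
  by rewrite ler_expR ler_wpM2l.
pose id_ (_ : R) (y : 'rV[R]_d) := y.
have mid : state_measurable id_ by apply: measurable_funTS; exact: measurable_snd.
pose xi i n (p : R * Omega) := nem id_ (x n) i p.1 p.2.
(* The limit is taken of functions on the product, extended by 0 to negative times. This one formula
   is jointly measurable, and its section at t >= 0 is the limit of [F t]-measurable functions. *)
pose X t w : 'rV[R]_d := \row_i pointwise_lim (xi i) (t, w).
have Xcoord t : (0 <= t)%R -> forall w i, X t w ord0 i = pointwise_lim (fun n w => x n t w ord0 i) w.
  by move=> t0 w i; rewrite mxE /pointwise_lim /xi /nem /= t0.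
have mX : timely_measurable X.
  apply: (@timely_row (fun i t w => pointwise_lim (xi i) (t, w))) => i.
  rewrite /jointly_measurable (_ : (fun p => _) = pointwise_lim (xi i)); last by apply/funext => -[].
  by apply: measurable_pointwise_lim => n; exact: measurable_nem.
have aX t : (0 <= t)%R -> measurable_wrt (F t) (X t).
  move=> t0; have sg := filtration_sigma_algebra HF t0.
  apply: measurable_wrt_row => // i; under eq_fun do rewrite Xcoord//.
  apply: measurable_wrt_pointwise_lim => // n.
  by apply: measurable_wrt_coord; exact: ax.
have mXt t : (0 <= t)%R -> measurable_fun setT (X t) by move=> t0; exact: (wrt_fun t0 (aX t t0)).
have close T : (0 <= T)%R -> exists2 C : R, (0 <= C)%R & forall n t, (0 <= t)%R -> (t <= T)%R ->
    mean_sqn (fun w => X t w - x n t w)%R <= (C * 4^-1 ^+ n)%:E.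
  move=> T0; have [C C0 HC] := contr T T0; exists (d%:R * (4 * C))%R; first by rewrite mulr_ge0// mulr_ge0.
  move=> n t t0 tT; rewrite mean_sqn_sum; last by apply: measurable_rowB; [exact: mXt|exact: mxt].
  apply: (@le_trans _ _ (\sum_(i < d) (4 * C * 4^-1 ^+ n)%:E)); last first.
    by rewrite sumEFin lee_fin sumr_const card_ord -(mulr_natl (4 * C * 4^-1 ^+ n)%R d) !mulrA.
  apply: lee_sum => i _.
  have mc k : measurable_fun setT (fun w => x k t w ord0 i) by apply: measurable_coord; exact: mxt.
  have inc k : \int[P]_w ((x k.+1 t w ord0 i - x k t w ord0 i) ^+ 2)%:E <= (C * 4^-1 ^+ k)%:E.
    apply: le_trans (HC k t t0 tT).
    apply: le_trans (mean_sqr_coord_le P i (measurable_rowB (mxt k.+1 t t0) (mxt k t t0))).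
    by rewrite le_eqVlt; apply/orP; left; apply/eqP; apply: eq_integral => w _; rewrite !mxE.
  apply: le_trans (L2_cvg_pointwise_lim mc C0 inc n).
  rewrite le_eqVlt; apply/orP; left; apply/eqP; apply: eq_integral => w _.
  have rowB (u v : 'rV[R]_d) : ((u - v) ord0 i = u ord0 i - v ord0 i)%R by rewrite !mxE.
  by rewrite rowB Xcoord.
have gX : ms_process X.
  split => // T T0; have [C C0 HC] := close T T0; have [_ _ /(_ T T0)[C1 C10 HC1]] := gx 0%N.
  exists (2 * C + 2 * C1)%R; first by rewrite addr_ge0// mulr_ge0.
  move=> t t0 tT.
  have := mean_sqnB_le P (mXt t t0) (measurable_cst (0%R : 'rV[R]_d)) (mxt 0%N t t0).
  have sub0 (Z : Omega -> 'rV[R]_d) : (fun w => Z w - 0)%R = Z by apply/funext => w; rewrite subr0.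
  rewrite /= !sub0 => h; apply: (le_trans h); rewrite [leRHS]EFinD; apply: leeD; rewrite [leRHS]EFinM; apply: lee_wpmul2l => //.
    by have := HC 0%N t t0 tT; rewrite expr0 mulr1.
  exact: (HC1 t t0 tT).
exists X; split => // t t0.
(* To see that the limit is a fixed point, let [Z] be a value of the right-hand side for [X]. The
   iterate of index n + 1 at time t is within order 4^-n of [Z], because [X] is that close to the
   iterate of index n, and also of [X t]; hence [Z] and [X t] agree almost surely. *)
have [Z [mZ vZ]] := volterra_exists gX meta t0.
apply: (volterra_ae _ vZ); have mZ' := wrt_fun t0 mZ.
apply: (mean_sqn_ae_eq mZ' (mXt t t0)).
have [C C0 HC] := close t t0.
have [A A0 HA] := volterra_sqdist_le t0.
have km0 : 0 <= ker_mass alpha t := ker_mass_ge0 alpha t.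
have kmE : (fine (ker_mass alpha t))%:E = ker_mass alpha t.
  by rewrite fineK// ge0_fin_numE// ker_mass_lty.
pose K := (2 * (A * (C * fine (ker_mass alpha t))) + 2 * C)%R.
have key n : mean_sqn (fun w => Z w - X t w)%R <= (K * 4^-1 ^+ n)%:E.
  have z0 : (0 <= 4^-1 ^+ n :> R)%R by rewrite exprn_ge0// invr_ge0.
  apply: (le_trans (mean_sqnB_le P mZ' (mXt t t0) (mxt n.+1 t t0))).
  apply: (@le_trans _ _ (2%:E * (A * (C * 4^-1 ^+ n * fine (ker_mass alpha t)))%:E +
      2%:E * (C * 4^-1 ^+ n.+1)%:E)).
    apply: leeD; apply: lee_wpmul2l => //; last by rewrite mean_sqnN; exact: HC.
    have := HA X (x n) eta eta t Z (x n.+1 t) mX (mx _) meta meta t0 (lexx t) mZ (ax _ t t0) vZ (vx n t t0).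
    rewrite (_ : mean_sqn (fun w => eta w - eta w)%R = 0); last first.
      by apply: integral0_eq => w _; rewrite subrr /sqn big1// => i _; rewrite mxE expr0n.
    rewrite mule0 add0e => h; apply: (le_trans h).
    rewrite EFinM; apply: lee_wpmul2l; first by rewrite lee_fin.
    have Cz : (0 <= C * 4^-1 ^+ n)%R by rewrite mulr_ge0.
    rewrite EFinM kmE -(vconv_cst alpha Cz (lexx t)); apply: le_vconv.
    - exact: measurable_mean_sqdist.
    - exact: measurable_cst.
    - exact: mean_sqdist_ge0.
    - by move=> s s0 st; rewrite dist//; exact: HC.
  rewrite -!EFinM -EFinD lee_fin exprS /K [leRHS]mulrDl lerD//.
    by rewrite le_eqVlt; apply/orP; left; apply/eqP; ring.
  have : (0 <= C * 4^-1 ^+ n)%R by rewrite mulr_ge0.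
  by move: (4^-1 ^+ n)%R => z; lra.
exact: (le0_geometric key).
Qed.

End existence.

End volterra.

(** * Translation between the stated equation and its Volterra form *)

Section bridge.
Context (dd : measure_display) (Omega : measurableType dd) (R : realType)
  (P : probability Omega R) (F : R -> set (set Omega)) (W : R -> Omega -> R)
  (d : nat) (alpha : R) (b sigma : R -> 'rV[R]_d -> 'rV[R]_d).
Hypothesis alpha_itv : 2^-1 < alpha < 1.
Local Notation mu := (@lebesgue_measure R).

Lemma mean_eucl_norm (f : Omega -> 'rV[R]_d) :
  ('E_P[fun w => (eucl_norm (f w) ^+ 2)%R] = mean_sqn P f)%E.
Proof. by rewrite unlock; apply: eq_integral => w _; rewrite sqr_eucl_norm. Qed.

Let kernelE t s (x : R) (y : R) : 0 <= s -> s <= t ->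
  (t - s) `^ (alpha - 1) * x = ker alpha (t - s) * (if 0 <= s then x else y).
Proof. by move=> s0 st; rewrite s0 kerE// subr_ge0. Qed.

Lemma volterraE (eta : Omega -> 'rV[R]_d) (X : R -> Omega -> 'rV[R]_d) t Z :
  ((forall i : 'I_d, {ae P, forall w,
      lebesgue_measure.-integrable `[0, t]
        (fun s => ((t - s) `^ (alpha - 1) * b s (X s w) ord0 i)%:E)}) /\
    exists J : 'I_d -> Omega -> R,
      (forall i, is_ito_integral P F W t
        (fun s w => (t - s) `^ (alpha - 1) * sigma s (X s w) ord0 i) (J i)) /\
      {ae P, forall w, Z w = eta w + (Gamma alpha)^-1 *:
        (\row_i (\int[lebesgue_measure]_(s in `[0, t])
                   ((t - s) `^ (alpha - 1) * b s (X s w) ord0 i))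
         + \row_i J i w)}) <->
  volterra P F W alpha b sigma eta X t Z.
Proof.
have mitv : measurable (`[0, t]%classic : set R) by exact: measurable_itv.
have eB i w s : s \in (`[0, t]%classic : set R) ->
    (t - s) `^ (alpha - 1) * b s (X s w) ord0 i = ker alpha (t - s) * nem b X i s w.
  by rewrite inE/= in_itv/= => /andP[s0 st]; exact: kernelE.
have eR i w : \int[mu]_(s in `[0, t]) ((t - s) `^ (alpha - 1) * b s (X s w) ord0 i) =
    \int[mu]_(s in `[0, t]) (ker alpha (t - s) * nem b X i s w).
  by congr fine; apply: eq_integral => s ts; rewrite eB.
split=> -[iB [J [HJ EJ]]]; split.
- move=> i; apply: filterS (iB i) => w; apply: (@eq_integrable _ _ _ mu _ mitv) => s ts.
  by rewrite eB.
- exists J; split.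
    by move=> i; apply: ito_integral_ext (HJ i) => s w s0 st; exact: kernelE.
  by apply: filterS EJ => w -> i; rewrite !mxE eR.
- move=> i; apply: filterS (iB i) => w; apply: (@eq_integrable _ _ _ mu _ mitv) => s ts.
  by rewrite eB.
- exists J; split.
    by move=> i; apply: ito_integral_ext (HJ i) => s w s0 st; symmetry; exact: kernelE.
  by apply: filterS EJ => w h; apply/matrixP => j i; rewrite [j]ord1 h !mxE eR.
Qed.

Lemma is_solutionE (eta : Omega -> 'rV[R]_d) (X : R -> Omega -> 'rV[R]_d) :
  is_solution P F W alpha b sigma eta X <->
  [/\ timely_measurable X, adapted P F X &
      forall t, 0 <= t -> volterra P F W alpha b sigma eta X t (X t)].
Proof.
by split=> -[mX aX vX]; split => // t t0; apply/volterraE; exact: vX.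
Qed.

Lemma ess_bounded_sqn :
  (ess_sup (mrestr lebesgue_measure (measurable_nonneg_times R))
     (fun s : R => (eucl_norm (sigma s 0%R))%:E) < +oo)%E ->
  exists2 M : R, 0 <= M & {ae mu, forall s, 0 <= s -> sqn (sigma s 0) <= M}.
Proof.
(* The essential supremum is an extended real, possibly the default value of -oo; it is replaced by
   a nonnegative real bound so that squaring preserves inequalities. *)
move=> hs; have [y y0 hy] : exists2 y : R, 0 <= y &
    (ess_sup (mrestr lebesgue_measure (measurable_nonneg_times R))
     (fun s : R => (eucl_norm (sigma s 0%R))%:E) <= y%:E)%E.
  move: hs; case: (ess_sup _ _) => [r _| |_] //; last by exists 0 => //; exact: leNye.
  by exists (Num.max 0 r); rewrite ?lee_fin le_max lexx ?orbT.
exists (y ^+ 2); first exact: sqr_ge0.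
have /ess_supP[A [mA A0 hA]] := hy.
exists (A `&` `[0, +oo[%classic); split.
- by apply: measurableI => //; exact: measurable_itv.
- exact: A0.
move=> s /= /not_implyP[s0 hM]; split; last by rewrite /= in_itv/= s0.
apply: hA => /= hle; apply: hM; rewrite -sqr_eucl_norm.
by rewrite ler_pXn2r ?nnegrE ?eucl_norm_ge0.
Qed.

Lemma locally_sqr_integrable : state_measurable b ->
  (\int[mu]_(s in `[0%R, +oo[) (eucl_norm (b s 0%R) ^+ 2)%:E < +oo)%E ->
  forall T : R, (\int[mu]_(s in `[0%R, T]) (sqn (b s 0))%:E < +oo)%E.
Proof.
move=> mb hb T; apply: le_lt_trans hb.
under [leRHS]eq_integral do rewrite sqr_eucl_norm.
apply: ge0_subset_integral => //.
- apply/measurable_EFinP; apply: measurable_sum => i; apply: measurable_funX.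
  have mn := @measurable_nem _ Omega R d b (fun _ _ => 0%R) i mb (measurable_cst _).
  have h := measurableT_comp mn (measurable_pair2 (point : Omega)).
  apply: (@eq_measurable_fun _ _ _ _ _ (fun s => nem b (fun _ _ => 0%R) i s (point : Omega))).
    by move=> s; rewrite inE/= in_itv/= andbT /nem => ->.
  exact: measurable_funTS.
- by move=> s _; rewrite lee_fin sqn_ge0.
- by move=> s; rewrite /= !in_itv/= => /andP[->].
Qed.

End bridge.

Unset Implicit Arguments.

Theorem theorem1 (R : realType) (dd : measure_display)
    (Omega : measurableType dd) (P : probability Omega R)
    (F : R -> set (set Omega)) (W : R -> Omega -> R) (d : nat) (alpha : R)
    (b sigma : R -> 'rV[R]_d -> 'rV[R]_d)
    (HF : complete_filtration P F)
    (HW : brownian_motion P F W)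
    (Halpha : 2^-1 < alpha < 1)
    (mb : measurable_fun ((`[0, +oo[%classic : set R) `*` [set: 'rV[R]_d])
            (fun p : R * 'rV[R]_d => b p.1 p.2))
    (msigma : measurable_fun ((`[0, +oo[%classic : set R) `*` [set: 'rV[R]_d])
            (fun p : R * 'rV[R]_d => sigma p.1 p.2))
    (H1 : exists L : R, 0 < L /\
       forall (x y : 'rV[R]_d) (t : R), 0 <= t ->
         eucl_norm (b t x - b t y) + eucl_norm (sigma t x - sigma t y)
           <= L * eucl_norm (x - y))
    (H2_sigma : (ess_sup (mrestr lebesgue_measure (measurable_nonneg_times R))
                   (fun s : R => (eucl_norm (sigma s 0%R))%:E) < +oo)%E)
    (H2_b : (\int[lebesgue_measure]_(s in `[0%R, +oo[)
               (eucl_norm (b s 0%R) ^+ 2)%:E < +oo)%E) :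
  (forall eta : Omega -> 'rV[R]_d, ms_space P (F 0) eta ->
     exists X : R -> Omega -> 'rV[R]_d,
       is_solution P F W alpha b sigma eta X /\
       forall Y : R -> Omega -> 'rV[R]_d,
         is_solution P F W alpha b sigma eta Y ->
         forall t : R, 0 <= t -> {ae P, forall w, Y t w = X t w})
  /\
  (forall phi : (Omega -> 'rV[R]_d) -> R -> Omega -> 'rV[R]_d,
     (forall eta, ms_space P (F 0) eta ->
        is_solution P F W alpha b sigma eta (phi eta)) ->
     forall T : R, 0 < T ->
     forall eta, ms_space P (F 0) eta ->
     forall eps : R, 0 < eps ->
     exists delta : R, 0 < delta /\
       forall zeta, ms_space P (F 0) zeta ->
         ms_norm P (fun w => zeta w - eta w) < delta ->
         (ereal_sup [set (ms_norm P (fun w => (phi zeta t w - phi eta t w)%R))%:E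
                    | t in `[0%R, T]] < eps%:E)%E).
Proof.
have [L [L_gt0 HL]] := H1; have L0 := ltW L_gt0.
have Lb (x y : 'rV[R]_d) t : 0 <= t -> eucl_norm (b t x - b t y) <= L * eucl_norm (x - y).
  by move=> t0; apply: le_trans (HL x y t t0); rewrite lerDl eucl_norm_ge0.
have Ls (x y : 'rV[R]_d) t : 0 <= t -> eucl_norm (sigma t x - sigma t y) <= L * eucl_norm (x - y).
  by move=> t0; apply: le_trans (HL x y t t0); rewrite lerDr eucl_norm_ge0.
have [M M0 HM] := ess_bounded_sqn H2_sigma.
have Hb := locally_sqr_integrable Omega mb H2_b.
have wrt_fun t (Z : Omega -> 'rV[R]_d) : 0 <= t -> measurable_wrt (F t) Z -> measurable_fun setT Z.
  by move=> t0; apply: measurable_wrt_fun; exact: (filtration_measurable HF).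
have solE e X : is_solution P F W alpha b sigma e X <-> [/\ timely_measurable X, adapted P F X &
    forall t, 0 <= t -> volterra P F W alpha b sigma e X t (X t)] by exact: is_solutionE.
split=> [eta [meta]|phi Hphi T T0 eta heta eps eps0].
  rewrite mean_eucl_norm => eta2.
  have [X [[mX aX bX] vX]] := volterra_solution_exists HF HW Halpha mb msigma L0 Lb Ls M0 HM Hb meta eta2.
  exists X; split.
    apply/solE; split => // t t0; split; first exact: aX.
    by rewrite mean_eucl_norm; have [C C0 HC] := bX t t0; rewrite (le_lt_trans (HC t t0 _)) ?ltry.
  move=> Y /solE[mY aY vY] t t0.
  (* Uniqueness is stability for equal initial values, at mean square distance 0. *)
  have [K K0 HK] := volterra_stability HF HW Halpha mb msigma L0 Lb Ls t0.
  have aY' s : 0 <= s -> measurable_wrt (F s) (Y s) by move=> /aY[].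
  have e0 : mean_sqn P (fun w => eta w - eta w) = 0%:E.
    by apply: integral0_eq => w _; rewrite subrr /sqn big1// => i _; rewrite mxE expr0n.
  have := HK Y X eta eta 0 mY mX aY' aX meta meta vY vX e0 t t0 (lexx t).
  rewrite mulr0; apply: mean_sqn_ae_eq; first exact: (wrt_fun t _ t0 (aY' t t0)).
  exact: (wrt_fun t _ t0 (aX t t0)).
have [K K0 HK] := volterra_stability HF HW Halpha mb msigma L0 Lb Ls (ltW T0).
have sK0 : 0 <= Num.sqrt K := sqrtr_ge0 K.
(* Distances grow at most by the factor sqrt K. Adding 1 keeps the denominator positive when K = 0,
   and eps / 2 leaves room for a strict inequality after the supremum. *)
exists (eps / 2 / (Num.sqrt K + 1)); split.
  by rewrite !divr_gt0// ltr_wpDl.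
move=> zeta hzeta; rewrite /ms_norm mean_eucl_norm => hdelta.
have /solE[mX aX vX] := Hphi _ heta.
have /solE[mY aY vY] := Hphi _ hzeta.
have aX' s : 0 <= s -> measurable_wrt (F s) (phi eta s) by move=> /aX[].
have aY' s : 0 <= s -> measurable_wrt (F s) (phi zeta s) by move=> /aY[].
have [meta]:= heta; have [mzeta] := hzeta; rewrite !mean_eucl_norm => zeta2 eta2.
set a := fine (mean_sqn P (fun w => zeta w - eta w)) in hdelta.
(* The mean square distance of the initial values is finite, so that the [fine] inside [ms_norm]
   returns the true value. *)
have aE : mean_sqn P (fun w => zeta w - eta w) = a%:E.
  rewrite fineK// ge0_fin_numE ?mean_sqn_ge0//.
  have := mean_sqnB_le P (wrt_fun _ _ (lexx 0) mzeta) (wrt_fun _ _ (lexx 0) meta) (measurable_cst (0 : 'rV[R]_d)).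
  have sub0 (Z : Omega -> 'rV[R]_d) : (fun w => Z w - 0)%R = Z by apply/funext => w; rewrite subr0.
  rewrite mean_sqnN /= mean_sqnN [X in (_ * _ + _ * X)%E]mean_sqnN !sub0 => h.
  by apply: (le_lt_trans h); apply: lte_add_pinfty; apply: lte_mul_pinfty; rewrite ?lee_fin.
apply: (@le_lt_trans _ _ (eps / 2)%:E); last by rewrite lte_fin; lra.
apply: ge_ereal_sup => _ [t /= + <-]; rewrite in_itv/= => /andP[t0 tT].
rewrite lee_fin mean_eucl_norm.
have := HK (phi zeta) (phi eta) zeta eta a mY mX aY' aX' mzeta meta vY vX aE t t0 tT.
move=> h; have {}h : fine (mean_sqn P (fun w => phi zeta t w - phi eta t w)) <= K * a.
  rewrite -[leRHS]/(fine (K * a)%:E) fine_le// ge0_fin_numE ?mean_sqn_ge0//.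
  by apply: (le_lt_trans h); rewrite ltry.
apply: (le_trans (ler_wsqrtr h)); rewrite sqrtrM//.
apply: (@le_trans _ _ (Num.sqrt K * (eps / 2 / (Num.sqrt K + 1)))).
  by rewrite ler_wpM2l// ltW.
rewrite mulrCA ger_pMr ?divr_gt0// ler_pdivrMr ?mul1r ?lerDl//.
Qed.
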